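(* The discrete bulk form $A_\Omega^h=a_\Omega^h+j_\Omega^h$ is coercive with respect to the discrete energy norm $|||\cdot|||_{h,\Omega}$; that is, $$|||v|||_{h,\Omega}^2\lesssim A_\Omega^h(v,v)\qquad\text{for all } v\in V_\Omega^h .$$ Here $\lesssim$ means $\le$ up to a positive constant independent of $h$ and of the position of the domain relative to the background mesh $\mathcal{T}^h$.
   Context: **Geometry.** $\Omega\subset\mathbb{R}^d$ is a bounded domain with smooth boundary $\Gamma=\partial\Omega$, exterior unit normal $n$ and signed distance function $\rho$ (negative in $\Omega$). For $\delta_0>0$ small, $U_{\delta_0}(\Gamma)=\{|\rho|<\delta_0\}$ is a tubular neighbourhood in which each $x$ has a unique closest point $p(x)\in\Gamma$. $\mathcal{T}^h$ is a quasi-uniform mesh of shape-regular $d$-simplices with global mesh size $h$, covering $\Omega$. $\rho^h$ is a continuous piecewise linear (on $\mathcal{T}^h$) approximation of $\rho$; $\Gamma^h=\{\rho^h=0\}$ and $\Omega^h=\{\rho^h<0\}$ (subsets of the region covered by $\mathcal{T}^h$); $n^h$ is the piecewise constant exterior unit normal of $\Gamma^h$. Standing assumptions: $0<h\le h_0$ with $h_0$ small enough; $\Gamma^h\subset U_{\delta_0}(\Gamma)$ and $p:\Gamma^h\to\Gamma$ is a bijection; $\|\rho\|_{L^\infty(\Gamma^h)}\lesssim h^2$ and $\|n\circ p-n^h\|_{L^\infty(\Gamma^h)}\lesssim h$. **Meshes and faces.** With $T^\circ$ the interior of $T$: $\mathcal{T}_\Omega^h=\{T\in\mathcal{T}^h: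 T^\circ\cap\Omega^h\neq\emptyset\}$ and $\mathcal{T}_\Gamma^h=\{T\in\mathcal{T}_\Omega^h: T\cap\Gamma^h\ne\emptyset\}$. $\mathcal{F}_\Omega^h$ is the set of interior faces $F=T^+\cap T^-$ (common $(d-1)$-dimensional faces of two distinct elements) of $\mathcal{T}_\Omega^h$, and $\mathcal{F}_\Omega^{h,g}=\{F=T^+\cap T^-\in\mathcal{F}_\Omega^h: T^+\in\mathcal{T}_\Gamma^h\text{ or }T^-\in\mathcal{T}_\Gamma^h\}$. $n_F^\pm$ is the unit normal to $F$ exterior to $T^\pm$. **Jumps and averages.** With $w^\pm$ the traces on $F$ from $T^\pm$: $[w]=w^+-w^-$ and $\langle n_F\cdot\sigma\rangle=\tfrac12 n_F^+\cdot(\sigma^++\sigma^-)$. In $n_F\cdot[\nabla v]$ either choice of $n_F=n_F^\pm$ may be used. **Notation.** $(\cdot,\cdot)_U$, $\|\cdot\|_U$ denote $L^2(U)$ inner product and norm; for a collection $\mathcal{P}$ of sets, $(\cdot,\cdot)_{\mathcal{P}}=\sum_{P\in\mathcal{P}}(\cdot,\cdot)_P$ and $(\cdot,\cdot)_{\mathcal{P}\cap U}=\sum_{P\in\mathcal{P}}(\cdot,\cdot)_{P\cap U}$, and likewise for squared norms. Gradients of discrete functions are taken elementwise. **Space.** $V_\Omega^h=\bigoplus_{T\in\mathcal{T}_\Omega^h}P_1(T)$ (discontinuous piecewise linears). **Forms and norm.** With a discontinuous Galerkin penalty parameter $\gamma_\Omega$ and positive ghost penalty parameters $\mu_\Omega,\tau_\Omega$: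 $$a_\Omega^h(v,w)=(\nabla v,\nabla w)_{\mathcal{T}_\Omega^h\cap\Omega^h}+(v,w)_{\mathcal{T}_\Omega^h\cap\Omega^h}+\gamma_\Omega(h^{-1}[v],[w])_{\mathcal{F}_\Omega^h}-(\langle n_F\cdot\nabla v\rangle,[w])_{\mathcal{F}_\Omega^h\cap\Omega^h}-([v],\langle n_F\cdot\nabla w\rangle)_{\mathcal{F}_\Omega^h\cap\Omega^h},$$ $$j_\Omega^h(v,w)=\mu_\Omega h^{-1}([v],[w])_{\mathcal{F}_\Omega^{h,g}}+\tau_\Omega h(n_F\cdot[\nabla v],n_F\cdot[\nabla w])_{\mathcal{F}_\Omega^{h,g}},$$ $$A_\Omega^h(v,w)=a_\Omega^h(v,w)+j_\Omega^h(v,w),$$ $$|||v|||_{h,\Omega}^2=\|\nabla v\|_{\Omega^h}^2+\|v\|_{\Omega^h}^2+\|h^{-1/2}[v]\|_{\mathcal{F}_\Omega^h}^2+j_\Omega^h(v,v).$$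
   Formalization: Coercivity is proved for a discontinuous Galerkin penalty parameter γ_Ω that is large enough, with a threshold independent of h and the mesh position but depending on the ghost penalty parameters; without this it fails, e.g. for γ_Ω = 0. *)

(* Defs.v *)
From HB Require Import structures.
From mathcomp Require Import all_boot all_order all_algebra.
From mathcomp Require Import all_classical all_reals all_analysis.

Set Implicit Arguments.
Unset Strict Implicit.
Unset Printing Implicit Defensive.

Import Order.TTheory GRing.Theory Num.Theory.
Import numFieldNormedType.Exports.

Local Open Scope classical_set_scope.
Local Open Scope ring_scope.

Section LebesgueTuple.
Variable R : realType.
Local Notation RT := (measurableTypeR R).
Local Notation lebR := (@lebesgue_measure R).

Definition tuple_cons n (p : RT * n.-tuple RT) : n.+1.-tuple RT :=
  [tuple of p.1 :: p.2].

Lemma measurable_tuple_cons n : measurable_fun setT (@tuple_cons n).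
Proof. exact: measurable_cons. Qed.

Section LebCons.
Variables (n : nat) (m : {sigma_finite_measure set (n.-tuple RT) -> \bar R}).

Definition leb_cons : set (n.+1.-tuple RT) -> \bar R :=
  pushforward (lebR \x m)%E (@tuple_cons n).

Let leb_cons0 : leb_cons set0 = 0%E.
Proof. by rewrite /leb_cons /pushforward preimage_set0 measure0. Qed.

Let leb_cons_ge0 A : (0 <= leb_cons A)%E.
Proof. by rewrite /leb_cons /pushforward measure_ge0. Qed.

Let leb_cons_sigma_additive : semi_sigma_additive leb_cons.
Proof.
move=> F mF tF mUF; rewrite /leb_cons /pushforward preimage_bigcup.
apply: measure_semi_sigma_additive.
- by move=> k; rewrite -[X in measurable X]setTI; exact: measurable_tuple_cons.
- apply/trivIsetP => /= i j _ _ ij; rewrite -preimage_setI.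
  by move/trivIsetP : tF => /(_ _ _ _ _ ij) ->//; rewrite preimage_set0.
- rewrite -preimage_bigcup -[X in measurable X]setTI.
  exact: measurable_tuple_cons.
Qed.

HB.instance Definition _ := isMeasure.Build _ _ _ leb_cons
  leb_cons0 leb_cons_ge0 leb_cons_sigma_additive.

Let leb_cons_sigma_finite : sigma_finite setT leb_cons.
Proof.
have /sigma_finiteP[F [TF ndF Foo]] := sigma_finiteT lebR.
have /sigma_finiteP[G [TG ndG Goo]] := sigma_finiteT m.
pose uncons (t : n.+1.-tuple RT) : RT * n.-tuple RT :=
  (thead t, [tuple of behead t]).
have consK p : uncons (tuple_cons p) = p.
  by case: p => x t; congr pair; apply/val_inj.
have munc : measurable_fun setT uncons.
  apply/measurable_fun_pairP; split; first exact: measurable_tnth.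
  exact: measurable_behead.
exists (fun k => uncons @^-1` (F k `*` G k)).
  rewrite -preimage_bigcup (_ : \bigcup_k _ = setT) ?preimage_setT//.
  rewrite -subTset => -[x t] _.
  have : [set: RT] x by [].
  have : [set: n.-tuple RT] t by [].
  rewrite TF TG => -[l _ Gl] [k _ Fk]; exists (maxn k l) => //; split.
    by move: (x) Fk; exact/subsetPset/ndF/leq_maxl.
  by move: (t) Gl; exact/subsetPset/ndG/leq_maxr.
move=> k; have [mF Ffin] := Foo k; have [mG Gfin] := Goo k; split.
  by rewrite -[X in measurable X]setTI; apply: munc => //; exact: measurableX.
rewrite /leb_cons /pushforward -comp_preimage.
rewrite (_ : uncons \o _ = id); last by apply/funext => p; exact: consK.
rewrite preimage_id product_measure1E//.
by rewrite lte_mul_pinfty// ge0_fin_numE.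
Qed.

HB.instance Definition _ := Measure_isSigmaFinite.Build _ _ _ leb_cons
  leb_cons_sigma_finite.

End LebCons.

(* n-dimensional Lebesgue measure as an iterated product; for n = 0 it is the
   unit mass at the only point. *)
Fixpoint leb n : {sigma_finite_measure set (n.-tuple RT) -> \bar R} :=
  match n with
  | 0%N => \d_([tuple] : 0.-tuple RT)
  | n'.+1 => leb_cons (leb n')
  end.

Definition pt n (t : n.-tuple RT) : 'rV[R]_n := \row_i tnth t i.

Definition vol_int n (U : set 'rV[R]_n) (f : 'rV[R]_n -> R) : R :=
  \int[leb n]_(t in [set t | U (pt t)]) f (pt t).

End LebesgueTuple.

Section Euclidean.
Variables (R : realType) (d : nat).
Local Notation V := 'rV[R]_d.

Definition dot (x y : V) : R := \sum_i x 0 i * y 0 i.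

(* The library norm on row vectors is the maximum norm. *)
Definition enorm (x : V) : R := Num.sqrt (dot x x).

Definition diam (A : set V) : R :=
  sup [set r | exists x y, [/\ A x, A y & r = enorm (x - y)]].

(* The rows of a frame are an orthonormal basis of the orthogonal complement
   of the unit vector nu. *)
Definition is_frame (nu : V) (Q : 'M[R]_(d.-1, d)) : Prop :=
  Q *m Q^T = 1%:M /\ Q *m nu^T = 0.

Definition frame (nu : V) : 'M[R]_(d.-1, d) := xget 0 (is_frame nu).

(* Integral of f over a subset A of the hyperplane x0 + nu^perp with respect
   to the (d-1)-dimensional surface measure, that is, Lebesgue measure in
   orthonormal coordinates of the hyperplane. *)
Definition plane_int (x0 nu : V) (A : set V) (f : V -> R) : R :=
  vol_int [set s | A (x0 + s *m frame nu)] (fun s => f (x0 + s *m frame nu)).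

(* nu is the exterior unit normal of E at x: near x, E contains every open
   cone strictly around -nu and misses every such cone around nu.  It is the
   usual normal for a C^1 domain, and for a polyhedral domain it exists in the
   relative interior of the facets and at no kink. *)
Definition is_outer_normal (E : set V) (x nu : V) : Prop :=
  enorm nu = 1 /\
  forall eps, 0 < eps -> exists2 r, 0 < r & forall z, enorm (z - x) < r ->
    (dot nu (z - x) < - eps * enorm (z - x) -> E z) /\
    (eps * enorm (z - x) < dot nu (z - x) -> ~ E z).

Definition outer_normal (E : set V) (x : V) : V := xget 0 (is_outer_normal E x).

Definition boundary (A : set V) : set V := closure A `\` interior A.

Definition partial (i : 'I_d) (f : V -> R) (x : V) : R :=
  'D_(delta_mx 0 i) f x.

Fixpoint Ck_on (k : nat) (W : set V) (f : V -> R) : Prop :=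
  match k with
  | 0%N => forall x, W x -> {for x, continuous f}
  | k'.+1 => (forall x, W x -> differentiable f x) /\
             forall i, Ck_on k' W (partial i f)
  end.

Definition smooth_on (W : set V) (f : V -> R) : Prop :=
  forall k, Ck_on k W f.

Definition smooth_boundary (Om : set V) : Prop :=
  forall y, boundary Om y -> exists W (phi : V -> R),
    [/\ open W, W y, smooth_on W phi,
        (forall x, W x -> exists i, partial i phi x != 0) &
        (forall x, W x -> (Om x <-> phi x < 0))].

Definition smooth_bounded_domain (Om : set V) : Prop :=
  [/\ open Om, Om !=set0, connected Om, bounded_set Om & smooth_boundary Om].

Definition dist_to (A : set V) (x : V) : R :=
  inf [set enorm (x - y) | y in A].

Definition signed_dist (Om : set V) (x : V) : R :=
  if x \in Om then - dist_to (boundary Om) x else dist_to (boundary Om) x.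

Definition is_closest (A : set V) (x y : V) : Prop :=
  A y /\ forall z, A z -> enorm (x - y) <= enorm (x - z).

Definition closest (Om : set V) (x : V) : V :=
  xget 0 (is_closest (boundary Om) x).

Definition tube (Om : set V) (delta : R) : set V :=
  [set x | `|signed_dist Om x| < delta].

Definition tubular (Om : set V) (delta : R) : Prop :=
  0 < delta /\
  forall x, tube Om delta x -> exists! y, is_closest (boundary Om) x y.

(* P_1: the affine function x |-> grad . x + cst. *)
Record affine := Affine { grad : V; cst : R }.

Definition aff (w : affine) (x : V) : R := dot (grad w) x + cst w.

End Euclidean.

Coercion aff : affine >-> Funclass.

Section Mesh.
Variables (R : realType) (d : nat).
Local Notation V := 'rV[R]_d.

(* Convex hull of the vertices a k, k \in S. *)
Definition hull (a : 'I_d.+1 -> V) (S : {set 'I_d.+1}) : set V :=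
  [set x | exists l : 'I_d.+1 -> R,
     [/\ (forall k, 0 <= l k), (forall k, k \notin S -> l k = 0),
         \sum_k l k = 1 & x = \sum_k l k *: a k]].

Definition affinely_independent (a : 'I_d.+1 -> V) : Prop :=
  (\matrix_(k < d) (a (lift ord0 k) - a ord0)) \in unitmx.

Record mesh := Mesh { nelt : nat; vtx : 'I_nelt -> 'I_d.+1 -> V }.

Variable M : mesh.
Local Notation elt_ix := 'I_(nelt M).

Definition elt (i : elt_ix) : set V := hull (vtx i) [set: 'I_d.+1]%SET.

(* Positions in element i of the vertices shared with element j. *)
Definition common (i j : elt_ix) : {set 'I_d.+1} :=
  [set k | [exists l, vtx i k == vtx j l]]%SET.

Definition conforming_mesh : Prop :=
  [/\ forall i, affinely_independent (@vtx M i),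
      forall i j, i != j -> elt i <> elt j &
      forall i j, elt i `&` elt j = hull (vtx i) (common i j)].

Definition region : set V := \bigcup_i elt i.

Definition mesh_size : R := \big[Num.max/0]_i diam (elt i).

Definition shape_regular (sigma : R) : Prop :=
  forall i, exists c, forall x,
    enorm (x - c) <= diam (elt i) / sigma -> elt i x.

Definition quasi_uniform (kappa : R) : Prop :=
  forall i, mesh_size <= kappa * diam (elt i).

Definition is_piecewise_linear (rhoh : V -> R) : Prop :=
  {within region, continuous rhoh} /\
  forall i, exists w : affine R d, forall x, elt i x -> rhoh x = w x.

(* Pairs (T^+, T^-); each interface is taken once, T^+ being the element with
   the smaller index. *)
Definition is_face (e : elt_ix * elt_ix) : bool :=
  (e.1 < e.2)%N && (#|common e.1 e.2| == d).

Definition face (e : elt_ix * elt_ix) : set V := elt e.1 `&` elt e.2.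

(* The unit normal n_F^+, exterior to T^+; n_F^- is its opposite. *)
Definition face_normal (e : elt_ix * elt_ix) : V :=
  xget 0 [set nu | [/\ enorm nu = 1,
    forall x y, face e x -> face e y -> dot nu (x - y) = 0 &
    forall x y, face e x -> elt e.1 y -> dot nu (y - x) <= 0]].

Definition face_int (e : elt_ix * elt_ix) (A : set V) (f : V -> R) : R :=
  plane_int (xget 0 (face e)) (face_normal e) A f.

Variable rhoh : V -> R.

Definition Gamma_h : set V := [set x | region x /\ rhoh x = 0].
Definition Omega_h : set V := [set x | region x /\ rhoh x < 0].

Definition in_TOmega (i : elt_ix) : bool :=
  `[< interior (elt i) `&` Omega_h !=set0 >].
Definition in_TGamma (i : elt_ix) : bool :=
  in_TOmega i && `[< elt i `&` Gamma_h !=set0 >].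
Definition in_FOmega (e : elt_ix * elt_ix) : bool :=
  [&& is_face e, in_TOmega e.1 & in_TOmega e.2].
Definition in_FOmega_g (e : elt_ix * elt_ix) : bool :=
  in_FOmega e && (in_TGamma e.1 || in_TGamma e.2).

(* V_Omega^h is represented by families indexed by all elements; only the
   components on T_Omega^h enter the forms below. *)
Definition DG : Type := elt_ix -> affine R d.

Definition jump (v : DG) (e : elt_ix * elt_ix) (x : V) : R :=
  v e.1 x - v e.2 x.

Definition avg_flux (v : DG) (e : elt_ix * elt_ix) : R :=
  2^-1 * dot (face_normal e) (grad (v e.1) + grad (v e.2)).

Definition jump_flux (v : DG) (e : elt_ix * elt_ix) : R :=
  dot (face_normal e) (grad (v e.1) - grad (v e.2)).

Variable h : R.

Definition a_form (gamma : R) (v w : DG) : R :=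
  \sum_(i | in_TOmega i)
    vol_int (elt i `&` Omega_h) (fun=> dot (grad (v i)) (grad (w i)))
  + \sum_(i | in_TOmega i)
    vol_int (elt i `&` Omega_h) (fun x => v i x * w i x)
  + gamma * \sum_(e | in_FOmega e)
      face_int e (face e) (fun x => (h^-1 * jump v e x) * jump w e x)
  - \sum_(e | in_FOmega e)
      face_int e (face e `&` Omega_h) (fun x => avg_flux v e * jump w e x)
  - \sum_(e | in_FOmega e)
      face_int e (face e `&` Omega_h) (fun x => jump v e x * avg_flux w e).

Definition j_form (mu tau : R) (v w : DG) : R :=
  mu * h^-1 * \sum_(e | in_FOmega_g e)
    face_int e (face e) (fun x => jump v e x * jump w e x)
  + tau * h * \sum_(e | in_FOmega_g e)
    face_int e (face e) (fun=> jump_flux v e * jump_flux w e).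

Definition A_form (gamma mu tau : R) (v w : DG) : R :=
  a_form gamma v w + j_form mu tau v w.

Definition energy_norm_sq (mu tau : R) (v : DG) : R :=
  \sum_(i | in_TOmega i)
    vol_int (elt i `&` Omega_h) (fun=> enorm (grad (v i)) ^+ 2)
  + \sum_(i | in_TOmega i)
    vol_int (elt i `&` Omega_h) (fun x => v i x ^+ 2)
  + \sum_(e | in_FOmega e)
      face_int e (face e) (fun x => ((Num.sqrt h)^-1 * jump v e x) ^+ 2)
  + j_form mu tau v v.

(* The last two clauses bound the L^oo norm of n o p - n^h on Gamma^h, where
   n^h is the outer normal of Omega^h.  The first of them says that n^h exists
   almost everywhere: a closed polyhedral part of the (d-1)-dimensional
   polyhedral set Gamma^h is null iff it has empty relative interior.  The
   other one is an honest supremum bound because n o p is continuous and n^h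
   locally constant, and the bound on rho is pointwise because rho is
   continuous. *)
Definition geometry_assumptions (Om : set V) (delta crho cn : R) : Prop :=
  [/\ Gamma_h `<=` tube Om delta,
      set_bij Gamma_h (boundary Om) (closest Om),
      forall x, Gamma_h x -> `|signed_dist Om x| <= crho * h ^+ 2,
      Gamma_h `<=`
        closure [set x | Gamma_h x /\ exists nu, is_outer_normal Omega_h x nu] &
      forall x, Gamma_h x -> (exists nu, is_outer_normal Omega_h x nu) ->
        enorm (outer_normal Om (closest Om x) - outer_normal Omega_h x)
          <= cn * h].

End Mesh.

(* Main.v *)
(* Young's inequality reduces coercivity to a bound of the energy for
   h |F \cap Omega_h| |grad v|^2 on both sides of every interior face F.  If T is
   cut badly by Gamma_h, one moves from T through faces of F_Omega^{h,g}, each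
   step costing a ghost penalty jump, to a nearby element T'' such that
   h |F \cap Omega_h| <= C |T'' \cap Omega_h|.  To find T'', let a be the vertex
   of F where rho^h is smallest, and consider the elements that can be reached
   from T through faces containing a.  If one of them is not cut, it serves as
   T''.  Otherwise their normals are close to a single direction n.  The mesh may
   have gaps, but Gamma_h has no boundary near a, because it is mapped
   bijectively onto the closed surface Gamma; so a walk on which rho^h stays
   nonnegative cannot leave these elements.  Walking up and down in direction n
   shows that Gamma_h is near a a graph over a whole cube of size comparable to
   h.  Subdividing this cube yields one element T'' whose part of Gamma_h covers
   a smaller cube, and the cone over it with apex a has the required volume. *)
Require Import Defs.
From mathcomp Require Import all_boot all_order all_algebra.
From mathcomp Require Import all_classical all_reals all_analysis.
From mathcomp Require Import measurable_realfun ring lra.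

Set Implicit Arguments.
Unset Strict Implicit.
Unset Printing Implicit Defensive.

Import Order.TTheory GRing.Theory Num.Theory.
Import numFieldNormedType.Exports.

Local Open Scope classical_set_scope.
Local Open Scope ring_scope.

(** * Vectors, frames and cubes *)

(** The comparison of [h * vol (face_omega e)] with [vol (omega j)] succeeds because both sides are
    governed by one number t, the fraction of a segment from a in direction n after which rho^h
    vanishes. The part of F in Omega_h lies in a slab of thickness about t h, and the cone with apex
    a has height about t h, so t cancels. The slab bound fails only if F is nearly orthogonal to n,
    and then an element next to F reaches so far below a that a fixed fraction of it lies in
    Omega_h. The gradients of rho^h on two elements have close directions but no comparable lengths,
    since the assumptions bound normals only. Depths are therefore carried from one element to
    another by the shape of the zero set and never by comparing values of rho^h. A walk can be
    continued only where it crosses a facet in its relative interior. Its segments are therefore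
    perturbed to generic ones, with ends in open sets on which the sign of rho^h is known. The
    threshold for h depends on the geometry only, the one for gamma also on mu and tau, and the
    coercivity constant is 2. *)

Section Vectors.
Variables (R : realType) (d : nat).
Local Notation V := 'rV[R]_d.
Implicit Types (x y z u : V) (w : affine R d).

Lemma dotC x y : dot x y = dot y x.
Proof. by apply: eq_bigr => i _; rewrite mulrC. Qed.

Lemma dotDl x y z : dot (x + y) z = dot x z + dot y z.
Proof. by rewrite /dot -big_split; apply: eq_bigr => i _; rewrite mxE mulrDl. Qed.

Lemma dotDr x y z : dot z (x + y) = dot z x + dot z y.
Proof. by rewrite dotC dotDl !(dotC z). Qed.

Lemma dotZl a x y : dot (a *: x) y = a * dot x y.
Proof. by rewrite /dot mulr_sumr; apply: eq_bigr => i _; rewrite mxE mulrA. Qed.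

Lemma dotZr a x y : dot x (a *: y) = a * dot x y.
Proof. by rewrite dotC dotZl dotC. Qed.

Lemma dotNl x y : dot (- x) y = - dot x y.
Proof. by rewrite -scaleN1r dotZl mulN1r. Qed.

Lemma dotNr x y : dot x (- y) = - dot x y.
Proof. by rewrite dotC dotNl dotC. Qed.

Lemma dotBl x y z : dot (x - y) z = dot x z - dot y z.
Proof. by rewrite dotDl dotNl. Qed.

Lemma dotBr x y z : dot z (x - y) = dot z x - dot z y.
Proof. by rewrite dotDr dotNr. Qed.

Lemma dot0l x : dot 0 x = 0.
Proof. by rewrite -(scale0r 0) dotZl mul0r. Qed.

Lemma dot0r x : dot x 0 = 0.
Proof. by rewrite dotC dot0l. Qed.

Lemma dot_sumr (I : Type) (r : seq I) (P : pred I) (F : I -> V) x :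
  dot x (\sum_(i <- r | P i) F i) = \sum_(i <- r | P i) dot x (F i).
Proof.
by apply: (big_morph (dot x)) => [u v|]; rewrite ?dotDr ?dot0r.
Qed.

Lemma dot_ge0 x : 0 <= dot x x.
Proof. by apply: sumr_ge0 => i _; rewrite -expr2 sqr_ge0. Qed.

Lemma dot_eq0 x : (dot x x == 0) = (x == 0).
Proof.
apply/idP/eqP => [|->]; last by rewrite dot0l.
rewrite /dot psumr_eq0 => [/allP h|i _]; last by rewrite -expr2 sqr_ge0.
apply/rowP => i; rewrite mxE; apply/eqP.
by have := h i (mem_index_enum i); rewrite mulf_eq0 orbb.
Qed.

Lemma enorm_ge0 x : 0 <= enorm x.
Proof. exact: sqrtr_ge0. Qed.

Lemma enorm_sq x : enorm x ^+ 2 = dot x x.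
Proof. by rewrite sqr_sqrtr ?dot_ge0. Qed.

Lemma enorm_eq0 x : (enorm x == 0) = (x == 0).
Proof. by rewrite -[RHS]dot_eq0 -enorm_sq sqrf_eq0. Qed.

Lemma enorm_gt0 x : (0 < enorm x) = (x != 0).
Proof. by rewrite lt_neqAle enorm_ge0 andbT eq_sym enorm_eq0. Qed.

Lemma enorm0 : enorm (0 : V) = 0.
Proof. by apply/eqP; rewrite enorm_eq0. Qed.

Lemma enormZ a x : enorm (a *: x) = `|a| * enorm x.
Proof.
rewrite /enorm dotZl dotZr mulrA -expr2 sqrtrM ?sqr_ge0//.
by rewrite sqrtr_sqr.
Qed.

Lemma enormN x : enorm (- x) = enorm x.
Proof. by rewrite -scaleN1r enormZ normrN1 mul1r. Qed.

Lemma enormB x y : enorm (x - y) = enorm (y - x).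
Proof. by rewrite -enormN opprB. Qed.

Lemma cauchy_schwarz x y : dot x y <= enorm x * enorm y.
Proof.
have [->|y0] := eqVneq y 0; first by rewrite dot0r enorm0 mulr0.
have [->|x0] := eqVneq x 0; first by rewrite dot0l enorm0 mul0r.
have nx : 0 < enorm x by rewrite enorm_gt0.
have ny : 0 < enorm y by rewrite enorm_gt0.
have := dot_ge0 (enorm y *: x - enorm x *: y).
rewrite dotBl !dotBr !dotZl !dotZr (dotC y x) -!enorm_sq => h.
have : 0 <= 2 * (enorm x * enorm y) * (enorm x * enorm y - dot x y).
  by apply: le_trans h _; rewrite le_eqVlt; apply/orP; left; apply/eqP; ring.
by rewrite pmulr_rge0 ?subr_ge0// !mulr_gt0.
Qed.

Lemma norm_dot_le x y : `|dot x y| <= enorm x * enorm y.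
Proof.
rewrite ler_norml cauchy_schwarz andbT -(opprK (dot x y)) lerN2 -dotNl.
by rewrite (le_trans (cauchy_schwarz _ _)) ?enormN.
Qed.

Lemma enormD x y : enorm (x + y) <= enorm x + enorm y.
Proof.
rewrite -(@ler_pXn2r _ 2)// ?nnegrE ?addr_ge0 ?enorm_ge0//.
rewrite sqrrD enorm_sq dotDl !dotDr !enorm_sq (dotC y x).
have := cauchy_schwarz x y; lra.
Qed.

Lemma enorm_dist y x z : enorm (x - z) <= enorm (x - y) + enorm (y - z).
Proof. by rewrite (le_trans _ (enormD _ _))// addrA subrK. Qed.

Lemma coord_le_enorm x i : `|x 0 i| <= enorm x.
Proof.
rewrite -(@ler_pXn2r _ 2)// ?nnegrE ?enorm_ge0//.
rewrite enorm_sq /dot (bigD1 i)//= real_normK ?num_real// expr2 lerDl.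
by apply: sumr_ge0 => j _; rewrite -expr2 sqr_ge0.
Qed.

(** The factor d in place of its square root keeps all later constants free of roots. *)
Lemma enorm_le_coord x (c : R) : (forall i, `|x 0 i| <= c) -> enorm x <= d%:R * c.
Proof.
move=> h; have [d0|d0] := posnP d.
  have -> : x = 0 by apply/rowP => i; have := ltn_ord i; rewrite {2}d0.
  by rewrite enorm0 d0 mul0r.
have c0 : 0 <= c by apply: le_trans (h (Ordinal d0)).
rewrite -(@ler_pXn2r _ 2)// ?nnegrE ?enorm_ge0 ?mulr_ge0//.
rewrite enorm_sq exprMn.
apply: (@le_trans _ _ (\sum_(i < d) c ^+ 2)).
  apply: ler_sum => i _; rewrite -expr2 -real_normK ?num_real//.
  by rewrite ler_pXn2r ?nnegrE// .
rewrite sumr_const card_ord -[leLHS]mulr_natl ler_wpM2r ?sqr_ge0//.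
by rewrite -natrX ler_nat expnS expn1 leq_pmulr.
Qed.

Lemma dot_max_coord x : (0 < d)%N ->
  exists i, enorm x <= d%:R * `|x 0 i|.
Proof.
move=> d0; have [i _ hi] := @arg_maxP _ R _ (Ordinal d0) predT (fun i => `|x 0 i|) isT.
by exists i; apply: enorm_le_coord => j; exact: hi.
Qed.

Lemma affB w x y : w x - w y = dot (grad w) (x - y).
Proof. by rewrite /aff dotBr opprD addrACA subrr addr0. Qed.

Lemma aff_conv w (I : finType) (l : I -> R) (p : I -> V) :
  \sum_i l i = 1 -> w (\sum_i l i *: p i) = \sum_i l i * w (p i).
Proof.
move=> l1; rewrite /aff dot_sumr -[Defs.cst w in LHS]mul1r -l1 mulr_suml -big_split.
by apply: eq_bigr => i _; rewrite dotZr mulrDr.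
Qed.

Lemma aff_line w x u t : w (x + t *: u) = w x + t * dot (grad w) u.
Proof. by rewrite /aff dotDr dotZr addrAC. Qed.

Lemma aff_seg w x y t : w (x + t *: (y - x)) = (1 - t) * w x + t * w y.
Proof. by rewrite aff_line -affB; ring. Qed.

End Vectors.

Lemma dot_mulmx (R : realType) m (u v : 'rV[R]_m) : dot u v = (u *m v^T) 0 0.
Proof. by rewrite mxE; apply: eq_bigr => i _; rewrite mxE. Qed.

(* Rows 1, 2, ... of the Householder reflection that exchanges the first basis
   vector and nu. *)
Lemma exists_frame (R : realType) (d : nat) (nu : 'rV[R]_d) : (0 < d)%N ->
  enorm nu = 1 -> exists Q, is_frame nu Q.
Proof.
case: d nu => [//|n] nu _ nu1.
pose e0 : 'rV[R]_n.+1 := delta_mx 0 0.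
have [H HH Hnu] : exists2 H : 'M[R]_n.+1, H *m H^T = 1%:M & e0 *m H = nu.
  (* For nu = e0 the reflection vector e0 - nu vanishes, and the identity takes its place. *)
  have [->|ne] := eqVneq nu e0.
    by exists 1%:M; rewrite ?trmx1 ?mulmx1.
  pose u := e0 - nu; pose s := dot u u.
  have s0 : s != 0 by rewrite dot_eq0 subr_eq0 eq_sym.
  have de0 : dot e0 e0 = 1.
    rewrite /dot (bigD1 0)//= big1 ?addr0 ?mxE ?eqxx ?mulr1// => i i0.
    by rewrite mxE (negPf i0) andbF mul0r.
  have dnu : dot nu nu = 1 by rewrite -enorm_sq nu1 expr1n.
  have se : s = 2 * dot e0 u.
    by rewrite /s {1}/u dotBl /u !dotBr de0 dnu (dotC nu); ring.
  have uu : u *m u^T = s%:M.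
    by apply/matrixP => i j; rewrite !ord1 -dot_mulmx mxE.
  exists (1%:M - (2 / s) *: (u^T *m u)).
    have -> : (1%:M - (2 / s) *: (u^T *m u))^T = 1%:M - (2 / s) *: (u^T *m u).
      by rewrite raddfB /= trmx1 linearZ /= trmx_mul trmxK.
    rewrite mulmxBr mulmx1 mulmxBl mul1mx -!scalemxAl -!scalemxAr.
    rewrite -mulmxA (mulmxA u) uu mul_scalar_mx -scalemxAr !scalerA.
    have e : 2 / s - 2 / s * (2 / s * s) = - (2 / s) by field.
    by rewrite -scalerBl e scaleNr opprK subrK.
  rewrite mulmxBr mulmx1 -scalemxAr mulmxA.
  have -> : e0 *m u^T = (dot e0 u)%:M.
    by apply/matrixP => i j; rewrite !ord1 -dot_mulmx mxE.
  rewrite mul_scalar_mx scalerA mulrAC -se divff// scale1r /u.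
  by rewrite opprB addrC subrK.
exists (rowsub (lift ord0) H); split.
  rewrite trmx_mxsub mul_rowsub_mx mulmx_colsub HH.
  by apply/matrixP => i j; rewrite !mxE (inj_eq (@lift_inj _ _)).
rewrite mul_rowsub_mx -Hnu trmx_mul mulmxA HH mul1mx.
by apply/matrixP => i j; rewrite !mxE andbF.
Qed.

(** Stacking nu on Q gives a square matrix O with orthonormal rows. A right inverse of a square
    matrix is a left inverse, and O^T O = 1 is the expansion. *)
Lemma frame_decomposition (R : realType) (d : nat) (nu : 'rV[R]_d) Q :
    (0 < d)%N -> enorm nu = 1 -> is_frame nu Q ->
  forall x, x = dot nu x *: nu + (x *m Q^T) *m Q.
Proof.
case: d nu Q => [//|n] nu Q _ nu1 [QQ Qn] x.
pose O : 'M[R]_(1 + n) := col_mx nu Q.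
have OO : O *m O^T = 1%:M.
  rewrite /O tr_col_mx mul_col_row QQ Qn -[nu *m Q^T]trmxK trmx_mul trmxK Qn.
  rewrite trmx0 scalar_mx_block; congr block_mx.
  by apply/matrixP => i j; rewrite !ord1 -dot_mulmx mxE -enorm_sq nu1 expr1n.
have {}OO : O^T *m O = 1%:M by exact: mulmx1C.
rewrite -[LHS]mulmx1 -[1%:M]OO /O tr_col_mx mul_row_col mulmxDr !mulmxA.
congr (_ + _); rewrite dotC (_ : x *m nu^T = (dot x nu)%:M) ?mul_scalar_mx//.
by apply/matrixP => i j; rewrite !ord1 -dot_mulmx mxE.
Qed.

Section FrameProperties.
Variables (R : realType) (d : nat) (nu : 'rV[R]_d).
Hypotheses (d_gt0 : (0 < d)%N) (nu1 : enorm nu = 1).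
Local Notation Q := (frame nu).

Lemma frameP : is_frame nu Q.
Proof. by apply: xgetPex; exact: exists_frame. Qed.

Lemma frame_normal s : dot nu (s *m Q) = 0.
Proof.
by rewrite dotC dot_mulmx -mulmxA (proj2 frameP) mulmx0 mxE.
Qed.

Lemma enorm_frame s : enorm (s *m Q) = enorm s.
Proof.
rewrite /enorm !dot_mulmx trmx_mul mulmxA -(mulmxA s) (proj1 frameP).
by rewrite mulmx1.
Qed.

Lemma frame_decomp x : x = dot nu x *: nu + (x *m Q^T) *m Q.
Proof. exact: frame_decomposition d_gt0 nu1 frameP x. Qed.

Lemma enorm_frame_decomp x :
  enorm x ^+ 2 = dot nu x ^+ 2 + enorm (x *m Q^T) ^+ 2.
Proof.
rewrite {1}(frame_decomp x) enorm_sq dotDl !dotDr !dotZl !dotZr.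
rewrite frame_normal (dotC _ nu) frame_normal !mulr0 !addr0 add0r.
by rewrite -!enorm_sq nu1 enorm_frame expr1n mulr1 expr2.
Qed.

End FrameProperties.

(** * Cubes and the signs of affine functions *)

Section Cubes.
Variables (R : realType) (n : nat).
Local Notation V := 'rV[R]_n.
Implicit Types (c g x : V) (l : R) (w : affine R n).

Definition cube c l : set V := [set x | forall i, `|x 0 i - c 0 i| <= l].

Lemma cube_center c l : 0 <= l -> cube c l c.
Proof. by move=> l0 i; rewrite subrr normr0. Qed.

Lemma enorm_le_l1 g : enorm g <= \sum_i `|g 0 i|.
Proof.
have [->|g0] := eqVneq g 0; first by rewrite enorm0 sumr_ge0.
rewrite -(@ler_pM2r _ (enorm g)) ?enorm_gt0// -expr2 enorm_sq mulr_suml.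
apply: ler_sum => i _; rewrite -expr2 -real_normK ?num_real// expr2.
by rewrite ler_wpM2l// coord_le_enorm.
Qed.

(** The small cube sits in the corner to which g points: its centre is shifted by 2l/3 in each
    coordinate with the sign of that coordinate of g, so all its points are shifted by at least l/3
    in this sense. *)
Lemma exists_corner g c l : 0 <= l ->
  exists2 c', cube c' (l / 3) `<=` cube c l &
    forall x, cube c' (l / 3) x -> l / 3 * enorm g <= dot g (x - c).
Proof.
move=> l0; pose s i : R := if g 0 i < 0 then -1 else 1.
have sN i : `|s i| = 1 by rewrite /s; case: ifP => _; rewrite ?normrN1 ?normr1.
exists (c + (2 * l / 3) *: \row_i s i) => [x xc i|x xc].
  have := xc i; rewrite !mxE => h.
  rewrite (_ : x 0 i - c 0 i =
    (x 0 i - (c 0 i + 2 * l / 3 * s i)) + 2 * l / 3 * s i); last by ring.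
  apply: le_trans (ler_normD _ _) _.
  rewrite normrM sN mulr1 ger0_norm ?divr_ge0 ?mulr_ge0//; lra.
apply: (@le_trans _ _ (l / 3 * \sum_i `|g 0 i|)).
  by rewrite ler_wpM2l ?divr_ge0// enorm_le_l1.
rewrite mulr_sumr; apply: ler_sum => i _; rewrite !mxE.
have := xc i; rewrite !mxE /s; case: ltP => gi.
  rewrite [`|g 0 i|]ltr0_norm// ler_norml => /andP[h1 h2]; nra.
rewrite [`|g 0 i|]ger0_norm// ler_norml => /andP[h1 h2]; nra.
Qed.

(** The functions are treated one after the other, each time passing to a corner a third as large:
    along the gradient if the value at the centre is nonnegative, against it otherwise. The final
    size depends only on the number of functions, which makes later constants uniform. *)
Lemma exists_subcube_sign (I : finType) (w : I -> affine R n) c l : 0 < l ->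
  exists2 c', cube c' (l / 3 ^+ #|I|) `<=` cube c l &
  forall i, ((forall x, cube c' (l / 3 ^+ #|I|) x -> 0 <= w i x) \/
             (forall x, cube c' (l / 3 ^+ #|I|) x -> w i x < 0)) /\
    (grad (w i) != 0 -> forall x, cube c' (l / 3 ^+ #|I|) x -> w i x != 0).
Proof.
move=> l0.
suff H : forall s : seq I, exists2 c',
    cube c' (l / 3 ^+ size s) `<=` cube c l & forall i, i \in s ->
    ((forall x, cube c' (l / 3 ^+ size s) x -> 0 <= w i x) \/
     (forall x, cube c' (l / 3 ^+ size s) x -> w i x < 0)) /\
    (grad (w i) != 0 -> forall x, cube c' (l / 3 ^+ size s) x -> w i x != 0).
  have [c' cc' h] := H (enum I); exists c'; rewrite -?cardE// in cc' h *.
  by move=> i; apply: h; rewrite mem_enum.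
elim=> [|i s [c1 cc1 h1]]; first by exists c => //=; rewrite expr0 divr1.
have l1 : 0 < l / 3 ^+ size s by rewrite divr_gt0// exprn_gt0.
have lE : l / 3 ^+ size (i :: s) = l / 3 ^+ size s / 3.
  by rewrite /= exprS invfM (mulrC 3^-1) mulrA.
have key : exists2 c', cube c' (l / 3 ^+ size s / 3) `<=`
     cube c1 (l / 3 ^+ size s) &
    ((forall x, cube c' (l / 3 ^+ size s / 3) x -> 0 <= w i x) \/
     (forall x, cube c' (l / 3 ^+ size s / 3) x -> w i x < 0)) /\
    (grad (w i) != 0 -> forall x, cube c' (l / 3 ^+ size s / 3) x -> w i x != 0).
  have wE x : w i x = w i c1 + dot (grad (w i)) (x - c1) by rewrite -affB; ring.
  have [wc|wc] := leP 0 (w i c1).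
    have [c' s' h'] := exists_corner (grad (w i)) c1 (ltW l1).
    exists c' => //; split.
      left => x /h' hx; rewrite wE.
      have : 0 <= l / 3 ^+ size s / 3 * enorm (grad (w i)).
        by rewrite mulr_ge0 ?enorm_ge0// divr_ge0// ltW.
      lra.
    move=> g0 x /h' hx; rewrite wE gt_eqF//.
    have : 0 < l / 3 ^+ size s / 3 * enorm (grad (w i)).
      by rewrite mulr_gt0 ?divr_gt0// enorm_gt0.
    lra.
  have [c' s' h'] := exists_corner (- grad (w i)) c1 (ltW l1).
  have h x : cube c' (l / 3 ^+ size s / 3) x -> w i x < 0.
    move/h'; rewrite dotNl => hx; rewrite wE.
    have : 0 <= l / 3 ^+ size s / 3 * enorm (- grad (w i)).
      by rewrite mulr_ge0 ?enorm_ge0// divr_ge0// ltW.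
    lra.
  by exists c' => //; split=> [|_ x /h]; [right|move/lt_eqF ->].
have [c' s' h'] := key; exists c'; rewrite lE; first exact: subset_trans s' cc1.
move=> j; rewrite inE => /predU1P[->//|/h1[hl hr]]; split.
  by case: hl => hl; [left|right] => x /s'; exact: hl.
by move=> /hr{}hr x /s'; exact: hr.
Qed.

End Cubes.

(** * Volumes and integrals *)

Section LebesgueBoxes.
Variable R : realType.
Local Notation RT := (measurableTypeR R).
Local Notation lebR := (@lebesgue_measure R).

Definition tuple_box n (c : 'I_n -> R) (l : R) : set (n.-tuple RT) :=
  [set t | forall i, `|tnth t i - c i| <= l].

(** A prism over a box in the coordinates other than k. Its fibres in direction k are intervals of
    length (hi - lo)/|p k|, so its measure is explicit even for oblique p. *)
Definition tuple_slab n (p c : 'I_n -> R) (k : 'I_n) (l lo hi : R) :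
    set (n.-tuple RT) :=
  [set t | (forall i, i != k -> `|tnth t i - c i| <= l) /\
           lo < \sum_i p i * tnth t i <= hi].

Lemma measurable_lin n (p : 'I_n -> R) :
  measurable_fun [set: n.-tuple RT] (fun t => \sum_i p i * (tnth t i : R)).
Proof.
apply: measurable_sum => i; apply: measurable_funM; first exact: measurable_cst.
exact: measurable_tnth.
Qed.

Lemma measurable_preimage_le n (f : n.-tuple RT -> R) (a : R) :
  measurable_fun setT f -> measurable [set t | f t <= a].
Proof.
move=> mf; rewrite (_ : [set t | _] = setT `&` f @^-1` `]-oo, a]%classic).
  exact: mf.
by apply/seteqP; split=> t; rewrite /= in_itv /=; tauto.
Qed.

Lemma measurable_preimage_lt n (f : n.-tuple RT -> R) (a : R) :
  measurable_fun setT f -> measurable [set t | f t < a].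
Proof.
move=> mf; rewrite (_ : [set t | _] = setT `&` f @^-1` `]-oo, a[%classic).
  exact: mf.
by apply/seteqP; split=> t; rewrite /= in_itv /=; tauto.
Qed.

Lemma measurable_forall n (I : finType) (A : I -> set (n.-tuple RT)) :
  (forall i, measurable (A i)) -> measurable [set t | forall i, A i t].
Proof.
move=> mA; rewrite (_ : [set t | _] = \bigcap_(i in setT) A i).
  by apply: fin_bigcap_measurable => //; exact: finite_finset.
by apply/seteqP; split=> t /= h i; [move=> _|]; apply: h.
Qed.

Lemma measurable_dist n (c : R) l (i : 'I_n) :
  measurable [set t : n.-tuple RT | `|(tnth t i : R) - c| <= l].
Proof.
apply: measurable_preimage_le; apply: measurableT_comp => //.
apply: measurable_funB => //; exact: measurable_tnth.
Qed.

Lemma measurable_dist1 (c l : R) : measurable [set x : RT | `|(x : R) - c| <= l].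
Proof.
rewrite [X in measurable X](_ : _ = [set` `[c - l, c + l]]).
  exact: measurable_itv.
by apply/seteqP; split=> x /=; rewrite in_itv /= ler_distl.
Qed.

Lemma measurable_tuple_box n (c : 'I_n -> R) l : measurable (tuple_box c l).
Proof. by apply: measurable_forall => i; exact: measurable_dist. Qed.

Lemma measurable_tuple_slab n (p c : 'I_n -> R) k l lo hi :
  measurable (tuple_slab p c k l lo hi).
Proof.
apply: measurableI.
  apply: measurable_forall => i.
  have [->|ik] := eqVneq i k.
    rewrite [X in measurable X](_ : _ = setT); first exact: measurableT.
    by apply/seteqP; split=> // t _.
  rewrite [X in measurable X](_ : _ = [set t : n.-tuple RT | `|(tnth t i : R) - c i| <= l]).
    exact: measurable_dist.
  by apply/seteqP; split=> t /= h; [exact: h|move=> _].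
rewrite [X in measurable X](_ : _ =
  ~` [set t | \sum_i p i * (tnth t i : R) <= lo]
  `&` [set t | \sum_i p i * (tnth t i : R) <= hi]).
  apply: measurableI; last (apply: measurable_preimage_le; exact: measurable_lin).
  by apply: measurableC; (apply: measurable_preimage_le; exact: measurable_lin).
apply/seteqP; split=> t /=.
  by move=> /andP[h1 h2]; split=> //; apply/negP; rewrite -ltNge.
by move=> [/negP]; rewrite -ltNge => -> ->.
Qed.

Lemma lebesgue_dist (c l : R) : 0 <= l ->
  lebR [set x : RT | `|(x : R) - c| <= l] = (2 * l)%:E.
Proof.
move=> l0; rewrite (_ : [set x | _] = [set` `[c - l, c + l]]).
  rewrite lebesgue_measure_itv /= lte_fin; case: ltP => h.
    by rewrite -EFinD; congr _%:E; ring.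
  by rewrite (_ : l = 0) ?mulr0//; lra.
by apply/seteqP; split=> x /=; rewrite in_itv /= ler_distl.
Qed.

Lemma lebesgue_affine (p b lo hi : R) : p != 0 -> lo <= hi ->
  lebR [set x : RT | lo < p * (x : R) + b <= hi] = ((hi - lo) / `|p|)%:E.
Proof.
move=> p0 lohi; have [pp|pn] : 0 < p \/ p < 0 by apply/orP; rewrite orbC -neq_lt.
  rewrite (_ : [set x | _] = [set` `](lo - b) / p, (hi - b) / p]]).
    rewrite lebesgue_measure_itv /= lte_fin gtr0_norm// ltr_pM2r ?invr_gt0//.
    rewrite ltrD2r; case: ltP => h; first by rewrite -EFinD; congr _%:E; field.
    by rewrite (_ : hi - lo = 0) ?mul0r//; lra.
  apply/seteqP; split=> x /=; rewrite in_itv /= ltr_pdivrMr// ler_pdivlMr//;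
    by move=> /andP[h1 h2]; apply/andP; split; lra.
rewrite (_ : [set x | _] = [set` `[(hi - b) / p, (lo - b) / p[]).
  rewrite lebesgue_measure_itv /= lte_fin ltr0_norm// ltr_nM2r ?invr_lt0//.
  rewrite ltrD2r; case: ltP => h; first by rewrite -EFinD; congr _%:E; field.
  by rewrite (_ : hi - lo = 0) ?mul0r//; lra.
apply/seteqP; split=> x /=; rewrite in_itv /= ltr_ndivlMr// ler_ndivrMr//;
  by move=> /andP[h1 h2]; apply/andP; split; lra.
Qed.

Lemma leb_box n (c : 'I_n -> R) l : 0 <= l ->
  leb R n (tuple_box c l) = ((2 * l) ^+ n)%:E.
Proof.
move=> l0; elim: n c => [|n IH] c.
  rewrite /= diracE (_ : _ \in _ = true) ?expr0//.
  by apply/mem_set => -[].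
have E : (@tuple_cons R n) @^-1` (tuple_box c l) =
    [set x : RT | `|(x : R) - c ord0| <= l] `*` tuple_box (c \o lift ord0) l.
  apply/seteqP; split=> -[x t] /=.
    by move=> h; split=> [|i]; [have := h ord0|have := h (lift ord0 i)];
       rewrite ?tnth0 ?tnthS.
  by move=> [h1 h2] i; case: (unliftP ord0 i) => [j ->|->]; rewrite ?tnth0 ?tnthS.
rewrite /= /leb_cons /pushforward E.
rewrite product_measure1E.
- rewrite IH.
  transitivity ((2 * l)%:E * ((2 * l) ^+ n)%:E)%E; last by rewrite -EFinM exprS.
  by congr (_ * _)%E; exact: lebesgue_dist.
- exact: measurable_dist1.
- exact: measurable_tuple_box.
Qed.

(** Fubini along coordinate k. The measure is built by prepending coordinates; if k is not the first
    one, induction applies to the tail, with lo and hi shifted by the contribution of the first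
    coordinate. *)
Lemma leb_slab n (p c : 'I_n -> R) k l lo hi : p k != 0 -> 0 <= l -> lo <= hi ->
  leb R n (tuple_slab p c k l lo hi) =
  ((2 * l) ^+ n.-1 * ((hi - lo) / `|p k|))%:E.
Proof.
move=> + l0; elim: n p c k lo hi => [p c []//|n IH] p c k lo hi pk lohi.
set A := tuple_slab _ _ _ _ _ _.
have q0 : 0 <= (hi - lo) / `|p k| by rewrite divr_ge0// subr_ge0.
have mX : measurable ((@tuple_cons R n) @^-1` A).
  rewrite -[X in measurable X]setTI; apply: measurable_tuple_cons => //.
  exact: measurable_tuple_slab.
have sumE x (t : n.-tuple RT) : \sum_i p i * (tnth (tuple_cons (x, t)) i : R) =
    p ord0 * (x : R) + \sum_i (p \o lift ord0) i * (tnth t i : R).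
  rewrite big_ord_recl tnth0; congr (_ + _).
  by apply: eq_bigr => i _; rewrite tnthS.
rewrite /= /leb_cons /pushforward.
case: (unliftP ord0 k) => [j kj|k0].
  rewrite /product_measure1.
  rewrite (_ : (fun x => _) = fun x => (((2 * l) ^+ n.-1 * ((hi - lo) / `|p k|))%:E
     * (\1_[set x : RT | `|(x : R) - c ord0| <= l] x)%:E)%E).
    rewrite ge0_integralZl//; last 2 first.
    - apply/measurable_EFinP; apply: measurable_indic.
      exact: measurable_dist1.
    - by rewrite lee_fin mulr_ge0// exprn_ge0// mulr_ge0.
    rewrite integral_indic ?setIT//; last exact: measurable_dist1.
    transitivity (((2 * l) ^+ n.-1 * ((hi - lo) / `|p k|))%:E * (2 * l)%:E)%E.
      by congr (_ * _)%E; exact: lebesgue_dist.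
    rewrite -EFinM mulrAC -exprSr prednK//.
    exact: leq_ltn_trans (leq0n j) (ltn_ord j).
  apply/funext => x /=; rewrite indicE.
  have [xc|xc] := boolP (_ \in _); last first.
    rewrite mule0 (_ : xsection _ _ = set0) ?measure0//.
    apply/seteqP; split=> // t; rewrite /xsection /= inE /A /tuple_slab /= => -[h _].
    have := h ord0; rewrite kj (negPf (neq_lift _ _)) tnth0 => /(_ isT).
    by move=> h'; case/negP: xc; rewrite inE.
  rewrite mule1; move: (IH (p \o lift ord0) (c \o lift ord0) j
    (lo - p ord0 * x) (hi - p ord0 * x)); rewrite /= -kj => /(_ pk).
  rewrite opprB addrA subrK lerD2r => /(_ lohi) <-; congr (leb R n _).
  move: xc; rewrite inE /= => xc.
  apply/seteqP; split=> t; rewrite /xsection /= inE /A /tuple_slab /= sumE.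
    move=> [h /andP[h1 h2]]; split=> [i ij|]; last by apply/andP; split; lra.
    by have := h (lift ord0 i); rewrite tnthS kj (inj_eq lift_inj); apply.
  move=> [h /andP[h1 h2]]; split=> [i ij|]; last by apply/andP; split; lra.
  case: (unliftP ord0 i) ij => [i' ->|-> _]; rewrite ?tnth0// tnthS kj.
  by rewrite (inj_eq lift_inj); exact: h.
pose c1 : 'I_n -> R := fun i => c (lift ord0 i).
(* Here k is the first coordinate. The order of integration is exchanged, so that the fibre over a
   fixed tail is an interval and the tails range over a box. *)
rewrite (@product_measure_unique _ _ _ _ _ _ _ (product_measure2 lebR (leb R n)))//; last first.
  by move=> A0 B mA mB; exact: product_measure2E.
pose F (t : n.-tuple RT) : \bar R :=
  (((hi - lo) / `|p k|)%:E * (\1_(tuple_box c1 l) t)%:E)%E.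
transitivity (\int[leb R n]_t F t)%E; rewrite /F; last first.
  rewrite ge0_integralZl//; last first.
    apply/measurable_EFinP; apply: measurable_indic.
    exact: measurable_tuple_box.
  rewrite integral_indic ?setIT//; last exact: measurable_tuple_box.
  transitivity (((hi - lo) / `|p k|)%:E * ((2 * l) ^+ n)%:E)%E.
    by congr (_ * _)%E; exact: leb_box.
  by rewrite -EFinM mulrC.
apply: eq_integral => t _ /=; rewrite /F indicE.
have [tc|tc] := boolP (_ \in _); last first.
  rewrite mule0 (_ : ysection _ _ = set0) ?measure0//.
  apply/seteqP; split=> // x; rewrite /ysection /= inE /A /tuple_slab /= => -[h _].
  case/negP: tc; rewrite inE => i; have := h (lift ord0 i).
  by rewrite k0 tnthS eq_sym (negPf (neq_lift _ _)); apply.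
rewrite mule1 -(lebesgue_affine (\sum_(i < n) p (lift ord0 i) * (tnth t i : R)) pk lohi).
congr (lebesgue_measure _).
move: tc; rewrite inE /= => tc.
apply/seteqP; split=> x; rewrite /ysection /= inE /A /tuple_slab /= sumE k0.
  by move=> [].
move=> h; split=> // i; case: (unliftP ord0 i) => [i' ->|->//]; rewrite tnthS => _.
exact: tc.
Qed.

End LebesgueBoxes.

(** * Integrals over bounded measurable sets *)

Section VolumeIntegrals.
Variables (R : realType) (n : nat).
Local Notation RT := (measurableTypeR R).
Local Notation V := 'rV[R]_n.
Implicit Types (U : set V) (c : V) (l : R) (f g : V -> R) (w : affine R n).

Definition tuple_set U : set (n.-tuple RT) := [set t | U (pt t)].

Definition vol U : R := fine (leb R n (tuple_set U)).

Definition bounded_measurable U : Prop :=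
  measurable (tuple_set U) /\ exists (c : V) (l : R), 0 <= l /\ U `<=` cube c l.

(** Boundedness on cubes suffices for integrability on every [bounded_measurable] set. Unlike
    integrability itself, the property is stable under products. *)
Definition regular f : Prop :=
  measurable_fun setT (fun t : n.-tuple RT => f (pt t)) /\
  forall (c : V) (l : R), exists M : R, forall x, cube c l x -> `|f x| <= M.

Lemma regular_cst (a : R) : regular (fun=> a).
Proof. by split=> [|c l]; [exact: measurable_cst|exists `|a|]. Qed.

Lemma regularD f g : regular f -> regular g -> regular (fun x => f x + g x).
Proof.
move=> [mf bf] [mg bg]; split=> [|c l]; first exact: measurable_funD.
have [M hM] := bf c l; have [N hN] := bg c l; exists (M + N) => x xc.
by rewrite (le_trans (ler_normD _ _))// lerD ?hM ?hN.
Qed.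

Lemma regularM f g : regular f -> regular g -> regular (fun x => f x * g x).
Proof.
move=> [mf bf] [mg bg]; split=> [|c l]; first exact: measurable_funM.
have [M hM] := bf c l; have [N hN] := bg c l; exists (M * N) => x xc.
by rewrite normrM ler_pM ?hM ?hN.
Qed.

Lemma regular_sqr f : regular f -> regular (fun x => f x ^+ 2).
Proof. by move=> rf; exact: regularM. Qed.

Lemma pt_coord (t : n.-tuple RT) i : pt t 0 i = tnth t i.
Proof. by rewrite mxE. Qed.

Lemma measurable_aff w : measurable_fun setT (fun t : n.-tuple RT => w (pt t)).
Proof.
apply: measurable_funD; last exact: measurable_cst.
rewrite [X in measurable_fun _ X](_ : _ =
  fun t : n.-tuple RT => \sum_i grad w 0 i * (tnth t i : R)).
  exact: measurable_lin.
by apply/funext => t; apply: eq_bigr => i _; rewrite pt_coord.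
Qed.

Lemma regular_aff w : regular w.
Proof.
split=> [|c l]; first exact: measurable_aff.
exists (`|w c| + enorm (grad w) * (n%:R * l)) => x xc.
rewrite -[w x](subrK (w c)) addrC (le_trans (ler_normD _ _))// lerD2l affB.
rewrite (le_trans (norm_dot_le _ _))// ler_wpM2l ?enorm_ge0//.
by apply: enorm_le_coord => i; rewrite !mxE; exact: xc.
Qed.

Lemma measurable_aff_ge0 w : measurable (tuple_set [set x | 0 <= w x]).
Proof.
rewrite [X in measurable X](_ : _ = ~` [set t : n.-tuple RT | w (pt t) < 0]).
  apply: measurableC; apply: measurable_preimage_lt; exact: measurable_aff.
by apply/seteqP; split=> t; rewrite /tuple_set /= leNgt => /negP.
Qed.

Lemma measurable_aff_lt0 w : measurable (tuple_set [set x | w x < 0]).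
Proof. by apply: measurable_preimage_lt; exact: measurable_aff. Qed.

Lemma measurable_tuple_setI U1 U2 : measurable (tuple_set U1) ->
  measurable (tuple_set U2) -> measurable (tuple_set (U1 `&` U2)).
Proof. by move=> m1 m2; apply: measurableI. Qed.

Lemma bounded_measurableS U1 U2 : bounded_measurable U1 ->
  measurable (tuple_set U2) -> U2 `<=` U1 -> bounded_measurable U2.
Proof.
move=> [_ [c [l [l0 h]]]] m2 s; split=> //; exists c, l; split=> //.
exact: subset_trans s h.
Qed.

Lemma tuple_set_cube c l :
  tuple_set (cube c l) = tuple_box (fun i => c 0 i) l.
Proof.
by apply/seteqP; split=> t h i; have := h i; rewrite ?pt_coord// -pt_coord.
Qed.

Lemma bounded_measurable_cube c l : 0 <= l -> bounded_measurable (cube c l).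
Proof.
move=> l0; split; last by exists c, l; split.
by rewrite tuple_set_cube; exact: measurable_tuple_box.
Qed.

Lemma vol_cube c l : 0 <= l -> vol (cube c l) = (2 * l) ^+ n.
Proof. by move=> l0; rewrite /vol tuple_set_cube leb_box. Qed.

Lemma leb_bounded U : bounded_measurable U -> (leb R n (tuple_set U) < +oo)%E.
Proof.
move=> [mU [c [l [l0 h]]]].
apply: (@le_lt_trans _ _ (leb R n (tuple_set (cube c l)))).
  apply: le_measure; rewrite ?inE//; first by case: (bounded_measurable_cube c l0).
  by move=> t; exact: h.
by rewrite tuple_set_cube leb_box// ltry.
Qed.

Lemma vol_ge0 U : 0 <= vol U.
Proof. by rewrite /vol fine_ge0. Qed.

Lemma le_vol U1 U2 : bounded_measurable U1 -> bounded_measurable U2 ->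
  U1 `<=` U2 -> vol U1 <= vol U2.
Proof.
move=> b1 b2 s; rewrite /vol fine_le// ?ge0_fin_numE ?leb_bounded//.
apply: le_measure; rewrite ?inE; [exact: (proj1 b1)|exact: (proj1 b2)|].
by move=> t; exact: s.
Qed.

Lemma vol_int_integrable U f : bounded_measurable U -> regular f ->
  (leb R n).-integrable (tuple_set U) (EFin \o (fun t => f (pt t))).
Proof.
move=> bU [mf bf]; apply: measurable_bounded_integrable.
- exact: (proj1 bU).
- exact: leb_bounded.
- exact: measurable_funS mf.
have [_ [c [l [_ h]]]] := bU; have [M hM] := bf c l.
exists M; split; first exact: num_real.
by move=> x Mx t Ut /=; apply: le_trans (hM _ (h _ Ut)) _; exact: ltW.
Qed.

Lemma vol_int_cst U (a : R) : bounded_measurable U ->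
  vol_int U (fun=> a) = a * vol U.
Proof. by move=> bU; rewrite /vol_int Rintegral_cst//; exact: (proj1 bU). Qed.

Lemma vol_intZ U f (a : R) : bounded_measurable U -> regular f ->
  vol_int U (fun x => a * f x) = a * vol_int U f.
Proof.
move=> bU rf; rewrite /vol_int RintegralZl//; first exact: (proj1 bU).
exact: vol_int_integrable.
Qed.

Lemma vol_intD U f g : bounded_measurable U -> regular f -> regular g ->
  vol_int U (fun x => f x + g x) = vol_int U f + vol_int U g.
Proof.
move=> bU rf rg; rewrite /vol_int RintegralD//; first exact: (proj1 bU).
- exact: vol_int_integrable.
- exact: vol_int_integrable.
Qed.

Lemma vol_int_ge0 U f : (forall x, U x -> 0 <= f x) -> 0 <= vol_int U f.
Proof. by move=> h; apply: Rintegral_ge0 => t; exact: h. Qed.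

Lemma le_vol_int U f g : bounded_measurable U -> regular f -> regular g ->
  (forall x, U x -> f x <= g x) -> vol_int U f <= vol_int U g.
Proof.
move=> bU rf rg h; apply: le_Rintegral.
- exact: (proj1 bU).
- exact: vol_int_integrable.
- exact: vol_int_integrable.
- by move=> t; exact: h.
Qed.

Lemma vol_intS U1 U2 f : bounded_measurable U1 -> bounded_measurable U2 ->
  regular f -> U1 `<=` U2 -> (forall x, 0 <= f x) ->
  vol_int U1 f <= vol_int U2 f.
Proof.
move=> b1 b2 rf s f0; rewrite /vol_int /Rintegral fine_le//.
- apply: integrable_fin_num; [exact: (proj1 b1)|exact: vol_int_integrable].
- apply: integrable_fin_num; [exact: (proj1 b2)|exact: vol_int_integrable].
apply: ge0_subset_integral => //.
- exact: (proj1 b1).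
- exact: (proj1 b2).
- by have /integrableP[] := vol_int_integrable b2 rf.
- by move=> t _; rewrite lee_fin.
- by move=> t; exact: s.
Qed.

Definition slab (p c : V) (k : 'I_n) (l lo hi : R) : set V :=
  [set x : V | (forall i, i != k -> `|x 0 i - c 0 i| <= l) /\ lo < dot p x <= hi].

Lemma tuple_set_slab p c k l lo hi : tuple_set (slab p c k l lo hi) =
  tuple_slab (fun i => p 0 i) (fun i => c 0 i) k l lo hi.
Proof.
have E t : dot p (pt t) = \sum_i p 0 i * (tnth t i : R).
  by apply: eq_bigr => i _; rewrite pt_coord.
apply/seteqP; split=> t; rewrite /tuple_set /= => -[h1 h2]; split.
- by move=> i /h1; rewrite pt_coord.
- by rewrite -E.
- by move=> i /h1; rewrite pt_coord.
- by move: h2; rewrite -E.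
Qed.

Lemma vol_slab (p : V) c (k : 'I_n) l (lo hi : R) : p 0 k != 0 -> 0 <= l -> lo <= hi ->
  vol (slab p c k l lo hi) = (2 * l) ^+ n.-1 * ((hi - lo) / `|p 0 k|).
Proof. by move=> *; rewrite /vol tuple_set_slab leb_slab. Qed.

Lemma bounded_measurable_slab (p : V) c (k : 'I_n) l (lo hi : R) : p 0 k != 0 -> 0 <= l ->
  bounded_measurable (slab p c k l lo hi).
Proof.
move=> pk l0; split.
  by rewrite tuple_set_slab; exact: measurable_tuple_slab.
have [lohi|hilo] := leP lo hi; last first.
  exists c, l; split=> // x [_ /andP[h1 h2]]; lra.
(* Bound for coordinate k: p k * x k equals dot p x minus the other terms, each of modulus at most
   |p i| (|c i| + l). *)
pose B := (`|lo| + `|hi| + \sum_(i | i != k) `|p 0 i| * (`|c 0 i| + l)) / `|p 0 k|.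
exists c, (l + `|c 0 k| + B); split.
  by rewrite !addr_ge0// divr_ge0// !addr_ge0// sumr_ge0// => i _; rewrite mulr_ge0 ?addr_ge0.
move=> x [xc /andP[h1 h2]] i.
have B0 : 0 <= B.
  by rewrite divr_ge0// !addr_ge0// sumr_ge0// => j _; rewrite mulr_ge0 ?addr_ge0.
have [->|ik] := eqVneq i k; last first.
  by rewrite (le_trans (xc _ ik))// -addrA lerDl addr_ge0.
apply: le_trans (ler_normB _ _) _; rewrite addrC lerD//; first by rewrite lerDr.
rewrite ler_pdivlMr ?normr_gt0// -normrM mulrC.
rewrite (_ : p 0 k * x 0 k = dot p x - \sum_(i | i != k) p 0 i * x 0 i); last first.
  by rewrite /dot (bigD1 k)//= addrK.
apply: le_trans (ler_normB _ _) _; rewrite lerD//.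
  have e1 := ler_norm hi; have e2 := ler_norm (- lo); rewrite normrN in e2.
  by rewrite ler_norml; apply/andP; split; move: (normr_ge0 lo) (normr_ge0 hi); lra.
apply: le_trans (ler_norm_sum _ _ _) _; apply: ler_sum => j jk.
rewrite normrM ler_wpM2l// -[x 0 j](subrK (c 0 j)) addrC (le_trans (ler_normD _ _))//.
by rewrite lerD2l xc.
Qed.

End VolumeIntegrals.

(** * Simplices *)

Section EuclideanTopology.
Variables (R : realType) (d : nat).
Local Notation V := 'rV[R]_d.
Implicit Types (x y : V) (w : affine R d) (U : set V).

Lemma nbhs_enormP x U :
  nbhs x U <-> exists2 e : R, 0 < e & forall y, enorm (y - x) < e -> U y.
Proof.
split=> [/nbhs_ballP[e /= e0 h]|[e e0 h]].
  exists e => // y yx; apply: h; split=> // i j; rewrite !ord1 -ball_normE /= distrC.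
  by have := coord_le_enorm (y - x) j; rewrite !mxE => /le_lt_trans; apply.
apply/nbhs_ballP; exists (e / d.+1%:R) => /=; first by rewrite divr_gt0.
move=> y [_ yx]; apply: h; apply: (@le_lt_trans _ _ (d%:R * (e / d.+1%:R))).
  apply: enorm_le_coord => i; have := yx 0 i; rewrite -ball_normE /= distrC !mxE.
  exact: ltW.
by rewrite mulrCA gtr_pMr// ltr_pdivrMr// mul1r ltr_nat.
Qed.

Lemma continuous_lipschitz (f : V -> R) (C : R) :
  (forall x y, `|f x - f y| <= C * enorm (x - y)) -> continuous f.
Proof.
move=> fC x W /nbhs_ballP[e /= e0 hW].
suff : nbhs x (f @^-1` W) by [].
apply/nbhs_enormP.
have C0 : 0 < `|C| + 1 by rewrite ltr_pwDr.
exists (e / (`|C| + 1)) => [|y yx]; first by rewrite divr_gt0.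
apply: hW; rewrite -ball_normE /=.
apply: le_lt_trans (fC _ _) _; rewrite enormB.
have : (`|C| + 1) * enorm (y - x) < e by rewrite mulrC -ltr_pdivlMr.
apply: le_lt_trans; rewrite ler_wpM2r ?enorm_ge0//.
by rewrite (le_trans (ler_norm _))// lerDl.
Qed.

Lemma continuous_aff w : continuous w.
Proof.
apply: (@continuous_lipschitz _ (enorm (grad w))) => x y.
by rewrite affB norm_dot_le.
Qed.

Lemma continuous_enorm_dist y : continuous (fun x => enorm (x - y)).
Proof.
apply: (@continuous_lipschitz _ 1) => x z; rewrite mul1r ler_norml.
have := enorm_dist z x y; have := enorm_dist x z y; rewrite (enormB z x); lra.
Qed.

Lemma closed_aff_ge0 w : closed [set x | 0 <= w x].
Proof.
rewrite [X in closed X](_ : _ = w @^-1` [set r | 0 <= r]).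
  by apply: closed_comp => [x _|]; [exact: continuous_aff|exact: closed_ge].
by apply/seteqP; split.
Qed.

End EuclideanTopology.

Section Simplex.
Variables (R : realType) (d : nat).
Local Notation V := 'rV[R]_d.
Implicit Types (a : 'I_d.+1 -> V) (lam : 'I_d.+1 -> affine R d).

Definition barycentric a lam : Prop :=
  [/\ forall k l, lam k (a l) = (k == l)%:R, forall x, \sum_k lam k x = 1 &
      forall x, \sum_k lam k x *: a k = x].

Lemma exists_barycentric a : affinely_independent a ->
  exists lam, barycentric a lam.
Proof.
rewrite /affinely_independent; set A := \matrix_(_ < _) _ => uA.
(* The columns of the inverse edge matrix are the gradients of the coordinates that vanish at vertex
   0; the coordinate of vertex 0 is what is missing to 1. *)
pose g (k : 'I_d) : V := (col k (invmx A))^T.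
have dg x k : dot (g k) x = (x *m invmx A) 0 k.
  by rewrite dotC mxE; apply: eq_bigr => i _; rewrite !mxE.
pose lam k := match unlift ord0 k with
  | Some k => Affine (g k) (- dot (g k) (a ord0))
  | None => Affine (- \sum_k g k) (1 + dot (\sum_k g k) (a ord0)) end.
have lamS k x : lam (lift ord0 k) x = ((x - a ord0) *m invmx A) 0 k.
  by rewrite /lam liftK /aff /= -dotBr dg.
have lam0 x : lam ord0 x = 1 - \sum_k lam (lift ord0 k) x.
  have -> : \sum_k lam (lift ord0 k) x = dot (\sum_k g k) (x - a ord0).
    by rewrite dotC dot_sumr; apply: eq_bigr => k _; rewrite lamS -dg dotC.
  rewrite [lam ord0](_ : _ = Affine (- \sum_k g k)
    (1 + dot (\sum_k g k) (a ord0))); last by rewrite /lam unlift_none.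
  by rewrite /aff /= dotNl dotBr; ring.
have aA l : (a (lift ord0 l) - a ord0) = row l A by rewrite rowK.
have lamSa k l : lam (lift ord0 k) (a l) = (lift ord0 k == l)%:R.
  rewrite lamS; case: (unliftP ord0 l) => [l' ->|->]; last first.
    by rewrite subrr mul0mx mxE eq_sym (negPf (neq_lift _ _)).
  by rewrite aA -row_mul mulmxV// !mxE (inj_eq lift_inj) eq_sym.
exists lam; split=> [k l|x|x].
- case: (unliftP ord0 k) => [k' ->//|->]; rewrite lam0.
  under eq_bigr do rewrite lamSa.
  case: (unliftP ord0 l) => [l' ->|->].
    rewrite (bigD1 l')//= eqxx big1 => [|i il].
      by rewrite addr0 subrr.
    by rewrite (inj_eq lift_inj) (negPf il).
  by rewrite big1 ?subr0 ?eqxx// => i _.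
- by rewrite big_ord_recl /= lam0 subrK.
- rewrite big_ord_recl /= lam0 scalerBl scale1r scaler_suml -addrA.
  rewrite addrC -sumrN -big_split /=.
  under eq_bigr do rewrite addrC -scalerBr aA lamS.
  rewrite -[X in X + _](_ : (x - a ord0) *m invmx A *m A = _).
    by rewrite mulmxKV// subrK.
  by rewrite mulmx_sum_row.
Qed.

Section Coordinates.
Variables (a : 'I_d.+1 -> V) (lam : 'I_d.+1 -> affine R d).
Hypothesis bary : barycentric a lam.
Implicit Types (x y u : V) (w : affine R d) (k l : 'I_d.+1).

Lemma bary_vtx k l : lam k (a l) = (k == l)%:R. Proof. by case: bary. Qed.

Lemma bary_sum x : \sum_k lam k x = 1. Proof. by case: bary. Qed.

Lemma bary_decomp x : \sum_k lam k x *: a k = x. Proof. by case: bary. Qed.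

Lemma aff_bary w x : w x = \sum_k lam k x * w (a k).
Proof. by rewrite -[in LHS](bary_decomp x) aff_conv ?bary_sum. Qed.

Lemma bary_conv (c : 'I_d.+1 -> R) k : \sum_l c l = 1 ->
  lam k (\sum_l c l *: a l) = c k.
Proof.
move=> c1; rewrite aff_conv// (bigD1 k)//= bary_vtx eqxx mulr1 big1 ?addr0//.
by move=> l lk; rewrite bary_vtx eq_sym (negPf lk) mulr0.
Qed.

Lemma hullP (S : {set 'I_d.+1}) x :
  hull a S x <-> (forall k, 0 <= lam k x) /\ (forall k, k \notin S -> lam k x = 0).
Proof.
split=> [[c [c0 cS c1 ->]]|[h0 hS]].
  by split=> k; rewrite bary_conv//; exact: cS.
by exists (lam^~ x); split=> //; rewrite ?bary_sum ?bary_decomp.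
Qed.

Lemma simplexP x : hull a [set: 'I_d.+1]%SET x <-> forall k, 0 <= lam k x.
Proof.
rewrite hullP; split=> [[]//|h]; split=> // k.
by rewrite inE.
Qed.

Lemma simplex_vtx k l : 0 <= lam k (a l).
Proof. by rewrite bary_vtx ler0n. Qed.

Lemma grad_bary_neq0 k : (0 < d)%N -> grad (lam k) != 0.
Proof.
move=> d0; have [l kl] : exists l, k != l.
  by case: (unliftP ord0 k) => [j ->|->]; [exists ord0|exists (lift ord0 (Ordinal d0))];
    rewrite // eq_sym.
apply/eqP => g0; have := affB (lam k) (a k) (a l).
by rewrite g0 dot0l !bary_vtx eqxx (negPf kl) subr0 => /eqP; rewrite oner_eq0.
Qed.

Lemma bary_le1 x k : (forall l, 0 <= lam l x) -> lam k x <= 1.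
Proof. by move=> h; rewrite -(bary_sum x) (bigD1 k)//= lerDl sumr_ge0. Qed.

Section InscribedBall.
Variables (c : V) (r : R).
Hypotheses (d_gt0 : (0 < d)%N) (r_gt0 : 0 < r)
  (ball_sub : forall x, enorm (x - c) <= r -> forall k, 0 <= lam k x).

(** A barycentric coordinate stays in [0,1] on the inscribed ball, and along the diameter parallel
    to its gradient it changes by 2r times the length of the gradient. *)
Lemma grad_bary_le k : enorm (grad (lam k)) <= (2 * r)^-1.
Proof.
have g0 : 0 < enorm (grad (lam k)) by rewrite enorm_gt0 grad_bary_neq0.
pose u := (enorm (grad (lam k)))^-1 *: grad (lam k).
have u1 : enorm u = 1.
  by rewrite enormZ ger0_norm ?invr_ge0 ?enorm_ge0// mulVf// gt_eqF.
have gu : dot (grad (lam k)) u = enorm (grad (lam k)).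
  by rewrite dotZr -enorm_sq expr2 mulKf// gt_eqF.
have hb s : `|s| <= r -> forall l, 0 <= lam l (c + s *: u).
  by move=> sr; apply: ball_sub; rewrite addrAC subrr add0r enormZ u1 mulr1.
have nr : `|r| <= r by rewrite gtr0_norm.
have nNr : `|- r| <= r by rewrite normrN.
have := bary_le1 k (hb r nr); have := hb (- r) nNr k.
rewrite !aff_line gu -[_^-1]mul1r ler_pdivlMr ?mulr_gt0//; lra.
Qed.

(** If all vertices were closer than r to the hyperplane through y, so would be their convex hull.
    But the hull contains both ends of the diameter of the inscribed ball in direction nu, which are
    2r apart. *)
Lemma exists_far_vtx (nu : V) y : enorm nu = 1 ->
  exists k, r <= dot nu (a k - y) \/ dot nu (a k - y) <= - r.
Proof.
move=> nu1; apply: contrapT => no.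
have hlt k : - r < dot nu (a k - y) < r.
  apply/andP; split; rewrite ltNge; apply/negP => h; apply: no; exists k; tauto.
pose w := Affine nu (- dot nu y).
have wE x : w x = dot nu (x - y) by rewrite /aff /= dotBr.
have hb s : `|s| <= r -> forall l, 0 <= lam l (c + s *: nu).
  by move=> sr; apply: ball_sub; rewrite addrAC subrr add0r enormZ nu1 mulr1.
have lt_conv x : (forall l, 0 <= lam l x) -> - r < w x < r.
  move=> lx; have [k0 k0x] : exists k, 0 < lam k x.
    apply: contrapT => h; have := bary_sum x; rewrite big1 => [/eqP|k _].
      by rewrite eq_sym oner_eq0.
    by apply/eqP; rewrite eq_le lx andbT leNgt; apply/negP => hk; apply: h; exists k.
  have pos (f : 'I_d.+1 -> R) : (forall k, 0 < f k) -> 0 < \sum_k lam k x * f k.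
    move=> f0; rewrite (bigD1 k0)//= ltr_pwDl ?mulr_gt0// sumr_ge0// => k _.
    by rewrite mulr_ge0// ltW.
  have e s : s = \sum_k lam k x * s by rewrite -mulr_suml bary_sum mul1r.
  rewrite (aff_bary w); apply/andP; split.
    rewrite -subr_gt0 opprK addrC [r in ltRHS](e r) -big_split /=.
    under eq_bigr do rewrite -mulrDr.
    apply: pos => k; rewrite wE; have /andP[] := hlt k; lra.
  rewrite -subr_gt0 [r in ltRHS](e r) -sumrB.
  under eq_bigr do rewrite -mulrBr.
  apply: pos => k; rewrite wE; have /andP[] := hlt k; lra.
have nr : `|r| <= r by rewrite gtr0_norm.
have nNr : `|- r| <= r by rewrite normrN.
have := lt_conv _ (hb r nr); have := lt_conv _ (hb (- r) nNr).
rewrite !aff_line /= -enorm_sq nu1 expr1n => /andP[? ?] /andP[? ?]; lra.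
Qed.

Lemma center_pos k : 0 < lam k c.
Proof.
have g0 := grad_bary_neq0 k d_gt0.
have gp : 0 < enorm (grad (lam k)) by rewrite enorm_gt0.
pose s := r / enorm (grad (lam k)).
have s0 : 0 < s by rewrite divr_gt0.
have hx : enorm (c + (- s) *: grad (lam k) - c) <= r.
  by rewrite addrAC subrr add0r enormZ normrN gtr0_norm// divfK ?gt_eqF.
have := ball_sub hx k; rewrite aff_line -enorm_sq mulNr subr_ge0.
by apply: lt_le_trans; rewrite mulr_gt0// exprn_gt0.
Qed.

Lemma bary_lipschitz k x y : lam k x - lam k y <= enorm (x - y) / (2 * r).
Proof.
rewrite affB (le_trans (cauchy_schwarz _ _))// mulrC ler_wpM2l ?enorm_ge0//.
exact: grad_bary_le.
Qed.

(** The affine function dot nu (y - x0) vanishes at all vertices but k and is thus a multiple of lam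
    k. Comparing gradients, the factor has modulus 1/|grad (lam k)|, the height of the simplex,
    which [grad_bary_le] bounds below by 2r. *)
Lemma facet_normalE (nu : V) k x0 : enorm nu = 1 ->
  (forall x y, (forall l, 0 <= lam l x) -> lam k x = 0 ->
    (forall l, 0 <= lam l y) -> lam k y = 0 -> dot nu (x - y) = 0) ->
  (forall y, (forall l, 0 <= lam l y) -> dot nu (y - x0) <= 0) ->
  (forall l, 0 <= lam l x0) -> lam k x0 = 0 ->
  dot nu (a k - x0) <= - (2 * r) /\
  forall y, dot nu (y - x0) = dot nu (a k - x0) * lam k y.
Proof.
move=> nu1 nufacet nuout x0s x0k.
have key y : dot nu (y - x0) = dot nu (a k - x0) * lam k y.
  pose w := Affine nu (- dot nu x0).
  have wE z : w z = dot nu (z - x0) by rewrite /aff /= dotBr.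
  rewrite -(wE y) (aff_bary w y) (bigD1 k)//= (wE (a k)).
  rewrite [X in _ + X]big1 => [|l lk]; first by rewrite addr0 mulrC.
  rewrite (wE (a l)) (nufacet (a l) x0) ?mulr0// => [j|]; first exact: simplex_vtx.
  by rewrite bary_vtx eq_sym (negPf lk).
split=> //.
have a0 : dot nu (a k - x0) <= 0 by apply: nuout => l; exact: simplex_vtx.
have E : nu = dot nu (a k - x0) *: grad (lam k).
  apply/eqP; rewrite -subr_eq0 -dot_eq0; apply/eqP.
  set u := nu - _; rewrite {1}/u dotBl dotZl.
  have := key (x0 + 1 *: u); rewrite aff_line x0k add0r mul1r scale1r.
  by rewrite (addrC x0) addrK => ->; rewrite subrr.
have n1 : 1 = - dot nu (a k - x0) * enorm (grad (lam k)).
  by rewrite -{1}nu1 {1}E enormZ ler0_norm.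
have := grad_bary_le k.
have gp : 0 < enorm (grad (lam k)) by rewrite enorm_gt0 grad_bary_neq0.
rewrite -[_^-1]mul1r ler_pdivlMr ?mulr_gt0// => h.
rewrite lerNr -(ler_pM2r gp) -n1 mulrC; lra.
Qed.

(** Contract the simplex towards e by the factor th. The inscribed ball becomes a ball of radius th
    r inside the simplex, on which w exceeds w e by at most th |grad w| h; the division by d fits a
    cube into this ball. *)
Lemma deep_point (w : affine R d) e th h : (forall k, 0 <= lam k e) ->
  (forall x, (forall k, 0 <= lam k x) -> enorm (x - e) <= h) ->
  0 < th -> th <= 1 -> w e + th * (enorm (grad w) * h) < 0 ->
  exists c', cube c' (th * r / d%:R) `<=`
    [set x | (forall k, 0 <= lam k x) /\ w x < 0].
Proof.
move=> es eh th0 th1 we; exists (e + th *: (c - e)) => x xc.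
have xn : enorm (x - (e + th *: (c - e))) <= th * r.
  have -> : th * r = d%:R * (th * r / d%:R).
    by rewrite [RHS]mulrC divfK// pnatr_eq0 -lt0n.
  by apply: enorm_le_coord => i; have := xc i; rewrite !mxE.
pose y := e + th^-1 *: (x - e).
have xE : x = e + th *: (y - e).
  have -> : y - e = th^-1 *: (x - e) by rewrite /y addrAC subrr add0r.
  by rewrite scalerA divff ?gt_eqF// scale1r addrC subrK.
have yc : enorm (y - c) <= r.
  rewrite -(ler_pM2l th0) (le_trans _ xn)// -[th in leLHS]gtr0_norm// -enormZ.
  rewrite {1}xE le_eqVlt; apply/orP; left; apply/eqP; congr enorm.
  rewrite opprD addrACA subrr add0r -scalerBr; congr (_ *: _).
  by rewrite opprB addrA subrK.
have ys := ball_sub yc; split=> [k|].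
  rewrite xE aff_seg addr_ge0// mulr_ge0//; first by rewrite subr_ge0.
  exact: ltW.
rewrite xE aff_line; apply: le_lt_trans we; rewrite lerD2l ler_pM2l//.
by rewrite (le_trans (cauchy_schwarz _ _))// ler_wpM2l ?enorm_ge0 ?eh.
Qed.

End InscribedBall.

Lemma interior_simplex_pos x k : (0 < d)%N ->
  interior (hull a [set: 'I_d.+1]%SET) x -> 0 < lam k x.
Proof.
move=> d0 /nbhs_enormP[e e0 h].
have gp : 0 < enorm (grad (lam k)) by rewrite enorm_gt0 grad_bary_neq0.
pose s := e / 2 / enorm (grad (lam k)).
have s0 : 0 < s by rewrite !divr_gt0.
have /simplexP/(_ k) : hull a [set: 'I_d.+1]%SET (x + (- s) *: grad (lam k)).
  apply: h; rewrite addrAC subrr add0r enormZ normrN gtr0_norm//.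
  by rewrite divfK ?gt_eqF//; lra.
rewrite aff_line -enorm_sq mulNr subr_ge0; apply: lt_le_trans.
by rewrite mulr_gt0// exprn_gt0.
Qed.

Lemma pos_interior_simplex x : (forall k, 0 < lam k x) ->
  interior (hull a [set: 'I_d.+1]%SET) x.
Proof.
move=> xp; have : \forall y \near nbhs x, forall k, 0 < lam k y.
  apply: filter_forall => k.
  have : nbhs (lam k x) [set t | 0 < t] by exact: lt_nbhsr.
  exact: continuous_aff.
by apply: filterS => y yp; apply/simplexP => k; exact: ltW.
Qed.

Lemma closed_simplex : closed (hull a [set: 'I_d.+1]%SET).
Proof.
rewrite (_ : hull _ _ = \bigcap_(k in setT) [set x | 0 <= lam k x]).
  by apply: closed_bigI => k _; exact: closed_aff_ge0.
by apply/seteqP; split=> x; [move/simplexP => h k _; exact: h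
  |move=> h; apply/simplexP => k; exact: h].
Qed.

Lemma enorm_simplex_le x : (forall k, 0 <= lam k x) ->
  enorm x <= \sum_k enorm (a k).
Proof.
move=> xs; rewrite -{1}(bary_decomp x).
apply: (@le_trans _ _ (\sum_k enorm (lam k x *: a k))).
  elim/big_ind2: _ => [|u s v t us vt|//]; first by rewrite enorm0.
  by rewrite (le_trans (enormD _ _))// lerD.
apply: ler_sum => k _; rewrite enormZ ger0_norm// ler_piMl ?enorm_ge0//.
exact: bary_le1.
Qed.

Lemma le_diam_simplex x y : (forall k, 0 <= lam k x) ->
  (forall k, 0 <= lam k y) -> enorm (x - y) <= diam (hull a [set: 'I_d.+1]%SET).
Proof.
move=> xs ys; apply: ub_le_sup; last first.
  by exists x, y; split=> //; apply/simplexP.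
exists (\sum_k enorm (a k) + \sum_k enorm (a k)) => _ [u [v [/simplexP us /simplexP vs ->]]].
by rewrite (le_trans (enormD _ _))// enormN lerD// enorm_simplex_le.
Qed.

Lemma bounded_measurable_simplex :
  bounded_measurable (hull a [set: 'I_d.+1]%SET).
Proof.
split.
  rewrite [X in measurable X](_ : _ =
    [set t | forall k, tuple_set [set x | 0 <= lam k x] t]).
    by apply: measurable_forall => k; exact: measurable_aff_ge0.
  by apply/seteqP; split=> t; rewrite /tuple_set /= => /simplexP.
exists 0, (\sum_k enorm (a k)); split.
  by apply: sumr_ge0 => k _; exact: enorm_ge0.
move=> x /simplexP xs i; rewrite mxE subr0.
exact: le_trans (coord_le_enorm _ _) (enorm_simplex_le xs).
Qed.

End Coordinates.
End Simplex.

(** * The mesh and its faces *)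

(** Pigeonhole principle: rounding every f i k / rho down is injective on A, because two points in
    one cell differ by less than rho in each coordinate, and there are K^d cells. *)
Lemma sub_card_inj (R : realType) (d : nat) (K : nat) (I : finType)
    (A : {pred I}) (f : I -> 'I_d -> R) (rho : R) :
  0 < rho ->
  (forall i k, i \in A -> 0 <= f i k < K%:R * rho) ->
  (forall i j, i \in A -> j \in A -> i != j ->
    exists k, rho <= `|f i k - f j k|) ->
  (#|A| <= K ^ d)%N.
Proof.
move=> rho0 fA sepA; have [A0|[i0 i0A]] := set_0Vmem [set x in A].
  by rewrite -cardsE A0 cards0.
have K0 : d = 0%N \/ (0 < K)%N.
  case: (posnP d) => [|d0]; [by left|right].
  have := fA i0 (Ordinal d0); rewrite inE in i0A => /(_ i0A) /andP[h1 h2].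
  by have := le_lt_trans h1 h2; rewrite pmulr_lgt0// ltr0n.
pose g (i : I) : {ffun 'I_d -> 'I_K.-1.+1} :=
  [ffun k => inord (Num.truncn (f i k / rho))].
have tl i k : i \in A -> (Num.truncn (f i k / rho) < K)%N.
  move=> iA; have /andP[h1 h2] := fA i k iA.
  rewrite -(ltr_nat R); apply: (@le_lt_trans _ _ (f i k / rho)).
    by rewrite Num.Theory.truncn_le divr_ge0// ltW.
  by rewrite ltr_pdivrMr.
have ginj : {in A &, injective g}.
  move=> i j iA jA gij; apply/eqP/negP => /negP ij.
  have [k] := sepA i j iA jA ij; rewrite leNgt => /negP; apply.
  have := congr1 (fun u : {ffun _} => nat_of_ord (u k)) gij.
  have Kp : K.-1.+1 = K by case: K0 => [d0|/prednK//]; have := ltn_ord k; rewrite {2}d0.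
  rewrite !ffunE !inordK ?Kp ?tl// => e.
  have /andP[i0' _] := fA i k iA; have /andP[j0' _] := fA j k jA.
  have /andP[a1 a2] := Num.Theory.truncn_itv (divr_ge0 i0' (ltW rho0)).
  have /andP[b1 b2] := Num.Theory.truncn_itv (divr_ge0 j0' (ltW rho0)).
  rewrite e -addn1 natrD in a1 a2; rewrite -addn1 natrD in b2.
  rewrite ler_pdivlMr// ltr_pdivrMr// in a1 a2 b1 b2 *.
  move: a1 a2 b1 b2; rewrite ?ler_pdivlMr// ?ltr_pdivrMr// => a1 a2 b1 b2.
  rewrite ltr_norml; apply/andP; split; lra.
rewrite -(card_in_imset ginj) (leq_trans (max_card _))//.
rewrite card_ffun !card_ord; case: K0 => [->|/prednK->//].
by rewrite !expn0.
Qed.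

Section MeshGeometry.
Variables (R : realType) (d : nat).
Local Notation V := 'rV[R]_d.
Variables (M : mesh R d).
Local Notation elt_ix := 'I_(nelt M).
Variables (lam : elt_ix -> 'I_d.+1 -> affine R d) (ctr : elt_ix -> V) (r h : R).
Hypotheses (d_gt0 : (0 < d)%N) (bary : forall i, barycentric (@vtx _ _ M i) (lam i))
  (conf : conforming_mesh M) (r_gt0 : 0 < r)
  (ball_elt : forall (i : elt_ix) (x : V), enorm (x - ctr i) <= r -> elt i x)
  (elt_diam : forall (i : elt_ix) (x y : V), elt i x -> elt i y -> enorm (x - y) <= h).
Implicit Types (i j : elt_ix) (x y u : V) (k l : 'I_d.+1).

Lemma eltP i x : elt i x <-> forall k, 0 <= lam i k x.
Proof. exact: simplexP. Qed.

Lemma elt_vtx i k : elt i (vtx i k).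
Proof. by apply/eltP => l; apply: simplex_vtx; exact: bary. Qed.

Lemma vtx_inj i : injective (vtx i).
Proof.
move=> k l e; have := bary_vtx (bary i) k l; rewrite -e bary_vtx// eqxx.
by case: eqP => // _ /eqP; rewrite oner_eq0.
Qed.

Lemma commonP i j k : reflect (exists l, vtx i k = vtx j l) (k \in common i j).
Proof.
by rewrite inE; apply: (iffP existsP) => -[l /eqP e]; exists l => //; apply/eqP.
Qed.

Lemma elt_common i j x k : elt i x -> elt j x -> k \notin common i j ->
  lam i k x = 0.
Proof.
move=> ix jx; have [_ _ /(_ i j) c] := conf.
have : hull (vtx i) (common i j) x by rewrite -c; split.
by move/(hullP (bary i)) => [_]; apply.
Qed.

Lemma common_elt i j x : (forall k, 0 <= lam i k x) ->
  (forall k, k \notin common i j -> lam i k x = 0) -> elt j x.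
Proof.
move=> x0 xc; have [_ _ /(_ i j) c] := conf.
suff : (elt i `&` elt j) x by case.
by rewrite c; apply/(hullP (bary i)).
Qed.

Lemma vtx_of_elt i j k : elt j (vtx i k) -> exists l, vtx j l = vtx i k.
Proof.
move=> jk; have : k \in common i j.
  apply: contraT => /(elt_common (elt_vtx i k) jk).
  by rewrite bary_vtx// eqxx => /eqP; rewrite oner_eq0.
by move/commonP => [l ->]; exists l.
Qed.

Lemma card_common i j : #|common i j| = #|common j i|.
Proof.
have H i' j' : (#|common i' j'| <= #|common j' i'|)%N.
  pose f k := xget k [set l | vtx i' k = vtx j' l].
  have fE k : k \in common i' j' -> vtx j' (f k) = vtx i' k.
    move=> /commonP e; rewrite /f.
    have : [set l | vtx i' k = vtx j' l] !=set0 by [].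
    by move/(xgetPex k) => /= <-.
  have finj : {in common i' j' &, injective f}.
    by move=> k l kc lc e; apply: (@vtx_inj i'); rewrite -!fE// e.
  rewrite -(card_in_imset finj); apply: subset_leq_card; apply/fintype.subsetP => l.
  by move=> /imsetP[k kc ->]; apply/commonP; exists k; rewrite fE.
by apply/eqP; rewrite eqn_leq !H.
Qed.

Lemma common_neqT i j : i != j -> common i j != [set: 'I_d.+1]%SET.
Proof.
move=> ij; apply/eqP => cT; have [_ /(_ i j ij) + _] := conf; apply.
have H i' j' : common i' j' = [set: 'I_d.+1]%SET -> elt i' `<=` elt j'.
  move=> c x /eltP ix; apply: (common_elt (i := i')) => // k.
  by rewrite c inE.
have cT' : common j i = [set: 'I_d.+1]%SET.
  by apply/eqP; rewrite eqEcard finset.subsetT -card_common cT leqnn.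
by apply/seteqP; split; exact: H.
Qed.

(** For i and j distinct, conformity would place x in the hull of the common vertices. These are not
    all vertices of i, so some coordinate of x would vanish. *)
Lemma elt_pos_uniq i j x : (forall k, 0 < lam i k x) -> elt j x -> i = j.
Proof.
move=> xp jx; apply/eqP/negP => /negP ij.
have : ~~ ([set: 'I_d.+1] \subset common i j)%SET.
  by rewrite finset.subTset common_neqT.
move/fintype.subsetPn => [k _ kc]; have := xp k; rewrite (elt_common _ jx kc) ?ltxx//.
by apply/eltP => l; exact: ltW.
Qed.

Lemma ctr_pos i k : 0 < lam i k (ctr i).
Proof.
by apply: (center_pos (bary i) d_gt0 r_gt0) => x /ball_elt /eltP.
Qed.

Definition touching i j : bool := `[< elt i `&` elt j !=set0 >].

(** Centres of touching elements lie in a cube of side 4h and are separated by r/(2d) in some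
    coordinate; 8dB bounds the ratio of these lengths when h <= rB. *)
Definition touch_bound (B : R) : nat :=
  ((Num.truncn (8 * d%:R * B)).+1 ^ d)%N.

(** Two centres closer than r/(2d) in every coordinate have distance at most r/2. One of them would
    then lie in the inscribed ball of the other element while being interior to its own. *)
Lemma card_touching (B : R) i : h <= r * B ->
  (#|touching i| <= touch_bound B)%N.
Proof.
move=> hB; have dp : 0 < d%:R :> R by rewrite ltr0n.
have h0 : 0 <= h.
  by apply: le_trans (enorm_ge0 _) (elt_diam (elt_vtx i ord0) (elt_vtx i ord0)).
apply: (@sub_card_inj R d _ elt_ix (touching i)
  (fun j (m : 'I_d) => ctr j 0 m - ctr i 0 m + 2 * h) (r / (2 * d%:R))); first by rewrite divr_gt0// mulr_gt0.
  move=> j k; rewrite unfold_in => /asboolP[x [ix jx]].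
  have cx j' : elt j' (ctr j') by apply/eltP => l; exact/ltW/ctr_pos.
  have : `|(ctr j - ctr i) 0 k| <= 2 * h.
    apply: le_trans (coord_le_enorm _ _) _.
    rewrite (le_trans (enorm_dist x _ _))// mulrDl !mul1r lerD//.
      exact: elt_diam (cx j) jx.
    exact: elt_diam ix (cx i).
  rewrite !mxE ler_norml => /andP[a1 a2]; apply/andP; split; first lra.
  apply: (@le_lt_trans _ _ (4 * h)); first lra.
  set t := Num.truncn _; have tB : 8 * d%:R * B < t.+1%:R by exact: Num.Theory.truncnS_gt.
  have -> : 4 * h = h * (8 * d%:R) / (2 * d%:R) by field; rewrite gt_eqF.
  rewrite [ltRHS]mulrA ltr_pM2r ?invr_gt0 ?mulr_gt0//.
  apply: (@le_lt_trans _ _ (r * (8 * d%:R * B))); last by rewrite mulrC ltr_pM2r.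
  by rewrite [leRHS]mulrCA [leLHS]mulrC ler_pM2l ?mulr_gt0.
move=> j j' _ _ jj'; apply: contrapT => no.
have : j = j'; last by apply/eqP.
apply: (@elt_pos_uniq _ _ (ctr j)); first exact: ctr_pos.
apply: ball_elt; apply: le_trans (@enorm_le_coord _ _ _ (r / (2 * d%:R)) _) _.
  move=> k; rewrite !mxE leNgt; apply/negP => hk; apply: no; exists k.
  by rewrite opprD addrACA subrr addr0 opprB addrA subrK ltW.
have -> : d%:R * (r / (2 * d%:R)) = r / 2 by field; rewrite gt_eqF.
by have := r_gt0; lra.
Qed.

(** Symmetric counterpart of [is_face], which admits a pair in one order only. *)
Definition adjacent i j : bool := (i != j) && (#|common i j| == d).

Lemma adjacent_sym i j : adjacent i j = adjacent j i.
Proof. by rewrite /adjacent eq_sym card_common. Qed.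

Lemma is_face_adjacent (e : elt_ix * elt_ix) : is_face e -> adjacent e.1 e.2.
Proof.
by move=> /andP[e12 c]; rewrite /adjacent c andbT -val_eqE neq_ltn e12.
Qed.

Lemma common_opposite i j : #|common i j| = d -> exists k, common i j = [set~ k]%SET.
Proof.
move=> c; have : #|~: common i j|%SET = 1%N.
  by apply/eqP; rewrite -(eqn_add2l #|common i j|) cardsC c card_ord addn1.
by move/eqP/cards1P => [k ck]; exists k; rewrite -ck finset.setCK.
Qed.

Lemma adjacentP i j : adjacent i j -> exists k l, [/\
  forall x, elt i x -> (elt j x <-> lam i k x = 0),
  forall x, elt j x -> (elt i x <-> lam j l x = 0) &
  exists2 alpha, alpha < 0 & forall x, lam i k x = alpha * lam j l x].
Proof.
move=> ij; have := ij; rewrite adjacent_sym => ji.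
case/andP: ij => ij /eqP cij; case/andP: ji => _ /eqP cji.
have H i' j' k : common i' j' = [set~ k]%SET ->
    forall x, elt i' x -> (elt j' x <-> lam i' k x = 0).
  move=> c x ix; split=> [jx|kx]; first by rewrite (elt_common ix jx)// c !inE eqxx.
  by apply: (common_elt (i := i')); [exact/eltP|move=> k'; rewrite c !inE negbK => /eqP ->].
have [k ck] := common_opposite cij; have [l cl] := common_opposite cji.
exists k, l; split; [exact: H|exact: H|].
have E x : lam i k x = lam i k (vtx j l) * lam j l x.
  rewrite (aff_bary (bary j)) (bigD1 l)//= [X in _ + X]big1 ?addr0 1?mulrC// => m ml.
  have : m \in common j i by rewrite cl !inE.
  move=> /commonP[k' e]; rewrite e bary_vtx// (_ : (k == k') = false) ?mulr0//.
  apply/negP => /eqP kk'; have : k' \in common i j by apply/commonP; exists m.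
  by rewrite ck kk' !inE eqxx.
exists (lam i k (vtx j l)) => //; rewrite ltNge; apply/negP => a0.
pose b := \sum_k' (if k' == k then 0 else d%:R^-1) *: vtx i k'.
have dp : 0 < d%:R :> R by rewrite ltr0n.
have s1 : \sum_k' (if k' == k then 0 else d%:R^-1) = 1 :> R.
  rewrite (bigD1 k)//= eqxx add0r (eq_bigr (fun=> d%:R^-1)); last by move=> m /negPf ->.
  by rewrite sumr_const cardC1 card_ord /= -[LHS]mulr_natr mulVf// gt_eqF.
have lb m : lam i m b = if m == k then 0 else d%:R^-1 by rewrite bary_conv.
have ib : elt i b by apply/eltP => m; rewrite lb; case: ifP => // _; rewrite invr_ge0 ltW.
have jb : elt j b by apply/(H _ _ _ ck) => //; rewrite lb eqxx.
pose v := vtx j l; pose S := \sum_m `|lam i m v|.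
have S0 : 0 <= S by apply: sumr_ge0.
have D0 : 0 < 1 + d%:R * S by rewrite ltr_pwDl// mulr_ge0// ltW.
(* With this s one has (1 - s)/d = s S. So each coordinate m other than k of the shifted point is s
   (lam i m v + S), which is nonnegative. *)
pose s := (1 + d%:R * S)^-1; have s0 : 0 < s by rewrite invr_gt0.
have sE : s * (1 + d%:R * S) = 1 by rewrite mulVf// gt_eqF.
have s1' : s <= 1 by rewrite invf_le1// lerDl mulr_ge0// ltW.
pose x := b + s *: (v - b).
have ix : elt i x.
  apply/eltP => m; rewrite aff_seg lb; case: ifP => [/eqP ->|_].
    by rewrite mulr0 add0r mulr_ge0// ltW.
  have : `|lam i m v| <= S by rewrite /S (bigD1 m)//= lerDl sumr_ge0.
  rewrite ler_norml => /andP[hm _].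
  have -> : (1 - s) / d%:R + s * lam i m v = s * (lam i m v + S).
    by rewrite -[X in X - s]sE; field; rewrite gt_eqF.
  by rewrite mulr_ge0 ?(ltW s0)//; lra.
have jx : elt j x.
  apply/eltP => m; rewrite aff_seg addr_ge0// mulr_ge0 ?subr_ge0 ?(ltW s0)//.
    by move/eltP: jb; exact.
  by move/eltP: (elt_vtx j l); exact.
have := proj1 (H _ _ _ cl _ jx) ix.
rewrite aff_seg (proj1 (H _ _ _ cl _ jb) ib) mulr0 add0r bary_vtx// eqxx mulr1.
by move/eqP; rewrite gt_eqF.
Qed.

(** The defining conditions are met by minus the normalized gradient of lam e.1 k, so the chosen
    normal satisfies them. Since the coordinates on both sides are negatively proportional, its
    opposite is exterior to the second element, and [facet_normalE] applies on either side. *)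
Lemma face_normalP (e : elt_ix * elt_ix) : is_face e -> exists k l, [/\
    enorm (face_normal e) = 1,
    forall x, face e x <-> elt e.1 x /\ lam e.1 k x = 0,
    forall x, face e x <-> elt e.2 x /\ lam e.2 l x = 0,
    forall x0, face e x0 -> dot (face_normal e) (vtx e.1 k - x0) <= - (2 * r) /\
      forall y, dot (face_normal e) (y - x0) =
        dot (face_normal e) (vtx e.1 k - x0) * lam e.1 k y &
    forall x0, face e x0 -> 2 * r <= dot (face_normal e) (vtx e.2 l - x0) /\
      forall y, dot (face_normal e) (y - x0) =
        dot (face_normal e) (vtx e.2 l - x0) * lam e.2 l y].
Proof.
move=> fe; have [k [l [H1 H2 [alpha a0 E]]]] := adjacentP (is_face_adjacent fe).
have F1 x : face e x <-> elt e.1 x /\ lam e.1 k x = 0.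
  by split=> [[x1 x2]|[x1 x0]]; split=> //; apply/(H1 _ x1).
have F2 x : face e x <-> elt e.2 x /\ lam e.2 l x = 0.
  by split=> [[x1 x2]|[x2 x0]]; split=> //; apply/(H2 _ x2).
pose g := grad (lam e.1 k).
have gp : 0 < enorm g by rewrite enorm_gt0 (grad_bary_neq0 (bary _)).
pose nu0 := - (enorm g)^-1 *: g.
have nu0E x y : dot nu0 (x - y) = - (enorm g)^-1 * (lam e.1 k x - lam e.1 k y).
  by rewrite /nu0 dotZl affB.
have : [set nu | [/\ enorm nu = 1,
    forall x y, face e x -> face e y -> dot nu (x - y) = 0 &
    forall x y, face e x -> elt e.1 y -> dot nu (y - x) <= 0]] (face_normal e).
  apply: xgetPex; exists nu0; split.
  - by rewrite /nu0 enormZ normrN ger0_norm ?invr_ge0 ?enorm_ge0// mulVf// gt_eqF.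
  - by move=> x y /F1[_ x0] /F1[_ y0]; rewrite nu0E x0 y0 subrr mulr0.
  - move=> x y /F1[_ x0] y1; rewrite nu0E x0 subr0 mulNr oppr_le0 mulr_ge0//.
      by rewrite invr_ge0 enorm_ge0.
    by move/eltP: y1; exact.
set nu := face_normal e => -[nu1 nuF nuE].
have A1 x0 : face e x0 -> dot nu (vtx e.1 k - x0) <= - (2 * r) /\
    forall y, dot nu (y - x0) = dot nu (vtx e.1 k - x0) * lam e.1 k y.
  move=> fx0; have /F1[x01 x00] := fx0.
  apply: (facet_normalE (bary e.1) (c := ctr e.1)) => //.
  - by move=> x /ball_elt /eltP.
  - by move=> x y xs xk ys yk; apply: nuF; apply/F1; split=> //; exact/eltP.
  - by move=> y ys; apply: nuE => //; exact/eltP.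
  - by move/eltP: x01.
exists k, l; split=> // x0 fx0; have /F2[x02 x00] := fx0.
have [al A] := A1 x0 fx0.
have B x : enorm (x - ctr e.2) <= r -> forall m, 0 <= lam e.2 m x.
  by move=> /ball_elt /eltP.
case: (facet_normalE (bary e.2) d_gt0 r_gt0 B (nu := - nu) (k := l) (x0 := x0)).
- by rewrite enormN.
- move=> x y xs xk ys yk; rewrite dotNl (nuF x y) ?oppr0//; apply/F2; split=> //; exact/eltP.
- move=> y ys; rewrite dotNl oppr_le0 A E mulrA mulr_ge0//.
  rewrite mulr_le0 ?(ltW a0)// (le_trans al)// oppr_le0 mulr_ge0 ?ltW//.
- by move/eltP: x02.
- by [].
- move=> h1 h2; split; first by move: h1; rewrite dotNl lerN2.
  by move=> y; have := h2 y; rewrite !dotNl mulNr => /oppr_inj.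
Qed.

(** * A face in orthonormal coordinates *)

Section FaceCoordinates.
Variables (e : elt_ix * elt_ix).
Hypothesis fe : is_face e.
Local Notation nu := (face_normal e).
Local Notation x0 := (xget 0 (face e)).

Lemma face_normal1 : enorm nu = 1.
Proof. by have [k [l []]] := face_normalP fe. Qed.

Definition face_pt (s : 'rV[R]_d.-1) : V := x0 + s *m frame nu.

(** At the barycentre b of the face the coordinates other than k equal 1/d. They have Lipschitz
    constant 1/(2r), so they remain nonnegative within distance 2r/d in the face plane. *)
Lemma face_barycenter : exists b,
  face e b /\ forall x, dot nu (x - b) = 0 -> enorm (x - b) <= 2 * r / d%:R -> face e x.
Proof.
have [k [l [nu1 F1 _ A1 _]]] := face_normalP fe.
have dp : 0 < d%:R :> R by rewrite ltr0n.
pose c m : R := if m == k then 0 else d%:R^-1.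
have c1 : \sum_m c m = 1.
  rewrite (bigD1 k)//= /c eqxx add0r (eq_bigr (fun=> d%:R^-1)); last by move=> m /negPf ->.
  by rewrite sumr_const cardC1 card_ord /= -[LHS]mulr_natr mulVf// gt_eqF.
pose b := \sum_m c m *: vtx e.1 m.
have lb m : lam e.1 m b = c m by rewrite bary_conv.
have c0 m : 0 <= c m by rewrite /c; case: ifP => // _; rewrite invr_ge0 ltW.
have fb : face e b.
  by apply/F1; split; [apply/eltP => m; rewrite lb|rewrite lb /c eqxx].
exists b; split=> // x xb0 xb.
have lk : lam e.1 k x = 0.
  have [a0 A] := A1 b fb; apply/eqP; have := A x; rewrite xb0 => /esym/eqP.
  rewrite mulf_eq0 => /orP[/eqP a0'|//]; move: a0.
  by rewrite a0' leNgt oppr_lt0 mulr_gt0.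
apply/F1; split=> //; apply/eltP => m.
have [->|mk] := eqVneq m k; first by rewrite lk.
have := bary_lipschitz (bary e.1) d_gt0 r_gt0 (c := ctr e.1) _ m b x.
move=> /(_ (fun y hy => proj1 (eltP _ _) (ball_elt hy))).
rewrite lb /c (negPf mk) enormB => h1.
have : enorm (x - b) / (2 * r) <= d%:R^-1.
  by rewrite ler_pdivrMr ?mulr_gt0// mulrC.
lra.
Qed.

Lemma face_x0 : face e x0.
Proof. by apply: xgetPex; have [b [fb _]] := face_barycenter; exists b. Qed.

Lemma face_ptE x : dot nu (x - x0) = 0 ->
  x = face_pt ((x - x0) *m (frame nu)^T).
Proof.
move=> x0E; rewrite /face_pt -[LHS](subrK x0) addrC; congr (_ + _).
by rewrite [LHS](frame_decomp d_gt0 face_normal1) x0E scale0r add0r.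
Qed.

Lemma face_normal_orth x y : face e x -> face e y -> dot nu (x - y) = 0.
Proof.
have [k [l [_ F1 _ A1 _]]] := face_normalP fe.
by move=> /F1[_ xk] fy; have [_ ->] := A1 y fy; rewrite xk mulr0.
Qed.

Lemma face_ptB s t : face_pt s - face_pt t = (s - t) *m frame nu.
Proof. by rewrite /face_pt opprD addrACA subrr add0r mulmxBl. Qed.

Lemma enorm_face_ptB s t : enorm (face_pt s - face_pt t) = enorm (s - t).
Proof. by rewrite face_ptB (enorm_frame d_gt0 face_normal1). Qed.

Definition face_aff (w : affine R d) : affine R d.-1 :=
  Affine (grad w *m (frame nu)^T) (w x0).

Lemma face_affE w s : face_aff w s = w (face_pt s).
Proof.
rewrite /face_pt -[s *m _]scale1r aff_line mul1r addrC {1}/aff /=.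
by congr (_ + _); rewrite !dot_mulmx trmx_mul mulmxA.
Qed.

Definition face_set (A : set V) : set 'rV[R]_d.-1 := [set s | A (face_pt s)].

Lemma face_intE A f : face_int e A f = vol_int (face_set A) (fun s => f (face_pt s)).
Proof. by []. Qed.

Lemma measurable_face_set_face : measurable (tuple_set (face_set (face e))).
Proof.
have E : face_set (face e) = [set s | forall m,
    (0 <= face_aff (lam e.1 m) s) /\ (0 <= face_aff (lam e.2 m) s)].
  apply/seteqP; split=> s /=.
    by move=> [/eltP s1 /eltP s2] m; rewrite !face_affE.
  by move=> hs; split; apply/eltP => m; have [] := hs m; rewrite !face_affE.
rewrite E [X in measurable X](_ : _ = [set t | forall m,
    (tuple_set [set s | 0 <= face_aff (lam e.1 m) s] `&`
     tuple_set [set s | 0 <= face_aff (lam e.2 m) s]) t]) //.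
by apply: measurable_forall => m; apply: measurableI; exact: measurable_aff_ge0.
Qed.

Lemma bounded_measurable_face : bounded_measurable (face_set (face e)).
Proof.
split; first exact: measurable_face_set_face.
have h0 : 0 <= h.
  by apply: le_trans (enorm_ge0 _) (elt_diam (elt_vtx e.1 ord0) (elt_vtx e.1 ord0)).
exists 0, h; split=> // s fs i; rewrite mxE subr0.
apply: le_trans (coord_le_enorm _ _) _.
have -> : s = s - 0 by rewrite subr0.
rewrite -enorm_face_ptB {2}/face_pt mul0mx addr0.
by apply: (elt_diam (i := e.1)); [exact: (proj1 fs)|exact: (proj1 face_x0)].
Qed.

Lemma face_set_sub_cube : face_set (face e) `<=` cube 0 h.
Proof.
move=> s fs i; rewrite mxE subr0.
apply: le_trans (coord_le_enorm _ _) _.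
have -> : s = s - 0 by rewrite subr0.
rewrite -enorm_face_ptB {2}/face_pt mul0mx addr0.
by apply: (elt_diam (i := e.1)); [exact: (proj1 fs)|exact: (proj1 face_x0)].
Qed.

(** One factor 1/d is that of [face_barycenter]; the other one passes from the Euclidean to the
    maximum norm. *)
Lemma face_contains_cube :
  exists s0, cube s0 (2 * r / d%:R ^+ 2) `<=` face_set (face e).
Proof.
have [b [fb bb]] := face_barycenter.
have dp : 0 < d%:R :> R by rewrite ltr0n.
exists ((b - x0) *m (frame nu)^T) => s sc; rewrite /face_set /=.
have bE := face_ptE (face_normal_orth fb face_x0).
apply: bb; rewrite bE face_ptB; first exact: (frame_normal d_gt0 face_normal1).
rewrite (enorm_frame d_gt0 face_normal1).
apply: le_trans (@enorm_le_coord _ _ _ (2 * r / d%:R ^+ 2) _) _.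
  by move=> i; rewrite !mxE; have := sc i; rewrite !mxE.
rewrite (_ : 2 * r / d%:R = d%:R * (2 * r / d%:R ^+ 2)); last by field; rewrite gt_eqF.
rewrite ler_wpM2r//; last by rewrite ler_nat leq_pred.
by rewrite divr_ge0 ?exprn_ge0// mulr_ge0// ltW.
Qed.

Lemma regular_face (w : affine R d) : regular (fun s => w (face_pt s)).
Proof.
have -> : (fun s => w (face_pt s)) = face_aff w by apply/funext => s; rewrite face_affE.
exact: regular_aff.
Qed.

(** The difference of squares is the squared tangential gradient. In the corner of a cube in the
    face where |w| increases, |w| is at least l/3 times the length of the tangential gradient, and
    the integral over this corner is a lower bound. *)
Lemma inverse_estimate_face (w : affine R d) : let l := 2 * r / d%:R ^+ 2 in
  (2 * (l / 3)) ^+ d.-1 * (l / 3) ^+ 2 *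
    (enorm (grad w) ^+ 2 - dot nu (grad w) ^+ 2)
  <= face_int e (face e) (fun x => w x ^+ 2).
Proof.
set l := 2 * r / _; move=> /=; have [s0 s0c] := face_contains_cube.
have l0 : 0 <= l.
  by rewrite /l divr_ge0 ?exprn_ge0// mulr_ge0// ltW.
rewrite (enorm_frame_decomp d_gt0 face_normal1) addrAC subrr add0r.
set g := _ *m _; have gE : g = grad (face_aff w) by [].
suff [s' ss' hs'] : exists2 s', cube s' (l / 3) `<=` cube s0 l &
    forall s, cube s' (l / 3) s -> (l / 3 * enorm g) ^+ 2 <= w (face_pt s) ^+ 2.
  have rw := regular_sqr (regular_face w).
  have b' := bounded_measurable_cube s' (divr_ge0 l0 (ler0n _ 3)).
  apply: (@le_trans _ _ (vol_int (cube s' (l / 3)) (fun s => w (face_pt s) ^+ 2))).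
    apply: (@le_trans _ _ (vol_int (cube s' (l / 3)) (fun=> (l / 3 * enorm g) ^+ 2))).
      rewrite (vol_int_cst _ b') vol_cube ?(divr_ge0 l0)//.
      by rewrite (_ : _ * enorm g ^+ 2 = (l / 3 * enorm g) ^+ 2 * (2 * (l / 3)) ^+ d.-1)//; ring.
    by apply: le_vol_int => //; exact: regular_cst.
  apply: vol_intS => //; first exact: bounded_measurable_face.
    by move=> s /ss' /s0c.
  by move=> s; rewrite sqr_ge0.
have wE s : w (face_pt s) = w (face_pt s0) + dot g (s - s0).
  by rewrite -!face_affE gE -affB addrC subrK.
have lg : 0 <= l / 3 * enorm g by rewrite mulr_ge0 ?enorm_ge0 ?(divr_ge0 l0).
have [w0|w0] := leP 0 (w (face_pt s0)).
  have [s' ss' hs'] := exists_corner g s0 l0; exists s' => // s /hs' hs.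
  rewrite ler_pXn2r ?nnegrE//; last by rewrite wE addr_ge0// (le_trans lg).
  by rewrite wE (le_trans hs)// lerDr.
have [s' ss' hs'] := exists_corner (- g) s0 l0; exists s' => // s /hs'.
rewrite dotNl enormN => hs; rewrite -[leRHS]sqrrN wE.
rewrite ler_pXn2r ?nnegrE//; lra.
Qed.

End FaceCoordinates.

End MeshGeometry.

(** * Smooth boundaries *)

Section OuterNormals.
Variables (R : realType) (d : nat).
Local Notation V := 'rV[R]_d.
Implicit Types (E Om : set V) (p q x y z nu : V).

Lemma outer_normal_cone E x nu u : is_outer_normal E x nu -> dot nu u != 0 ->
  exists2 s0 : R, 0 < s0 & forall s, 0 < s -> s < s0 ->
    (dot nu u < 0 -> E (x + s *: u)) /\ (0 < dot nu u -> ~ E (x + s *: u)).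
Proof.
move=> [nu1 nuE] du; have u0 : u != 0 by apply: contraNneq du => ->; rewrite dot0r.
have up : 0 < enorm u by rewrite enorm_gt0.
pose eps := `|dot nu u| / (2 * enorm u).
have eps0 : 0 < eps by rewrite divr_gt0 ?normr_gt0// mulr_gt0.
have [r r0 hr] := nuE eps eps0; exists (r / enorm u); first by rewrite divr_gt0.
move=> s s0 sr; have sE : x + s *: u - x = s *: u by rewrite addrAC subrr add0r.
have es : eps * enorm (s *: u) = s * (`|dot nu u| / 2).
  by rewrite enormZ gtr0_norm// /eps; field; rewrite gt_eqF.
have [|h1 h2] := hr (x + s *: u).
  by rewrite sE enormZ gtr0_norm// -ltr_pdivlMr.
rewrite sE mulNr es dotZr in h1 h2.
split=> hd; [apply: h1|apply: h2].
  by rewrite -mulrN ltr_pM2l// ltr0_norm//; lra.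
by rewrite ltr_pM2l// gtr0_norm//; lra.
Qed.

(** The vector nu' - nu points strictly inwards with respect to nu and strictly outwards with
    respect to nu', so a short step along it would be both in E and outside. *)
Lemma is_outer_normal_uniq E x nu nu' :
  is_outer_normal E x nu -> is_outer_normal E x nu' -> nu = nu'.
Proof.
move=> hn hn'; apply/eqP/negP => /negP ne.
have lt1 : dot nu nu' < 1.
  have := dot_ge0 (nu - nu'); rewrite le0r dot_eq0 subr_eq0 (negPf ne) /=.
  rewrite dotBl !dotBr -!enorm_sq (proj1 hn) (proj1 hn') expr1n (dotC nu'); lra.
have d1 : dot nu (nu' - nu) < 0 by rewrite dotBr -enorm_sq (proj1 hn) expr1n; lra.
have d2 : 0 < dot nu' (nu' - nu).
  by rewrite dotBr -enorm_sq (proj1 hn') expr1n dotC; lra.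
have [s1 s10 h1] := outer_normal_cone hn (negbT (lt_eqF d1)).
have [s2 s20 h2] := outer_normal_cone hn' (negbT (gt_eqF d2)).
pose s := Num.min s1 s2 / 2.
have m0 : 0 < Num.min s1 s2 by rewrite lt_min s10.
have s0 : 0 < s by rewrite divr_gt0.
have sm : s < Num.min s1 s2 by rewrite /s; lra.
have /andP[ss1 ss2] : (s < s1) && (s < s2) by rewrite -lt_min.
by have [_ /(_ d2)] := h2 s s0 ss2; apply; have [/(_ d1)] := h1 s s0 ss1.
Qed.

Lemma outer_normalE E x nu : is_outer_normal E x nu -> outer_normal E x = nu.
Proof.
move=> hn; have : is_outer_normal E x (outer_normal E x) by apply: xgetPex; exists nu.
by move/is_outer_normal_uniq; apply.
Qed.

Lemma boundary_segment Om x y : Om x -> ~ Om y ->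
  exists t, [/\ 0 <= t, t <= 1 & boundary Om (x + t *: (y - x))].
Proof.
move=> Ox Oy; pose z t := x + t *: (y - x).
have zB t s : enorm (z t - z s) = `|t - s| * enorm (y - x).
  by rewrite /z opprD addrACA subrr add0r -scalerBl enormZ.
pose T := [set t : R | [/\ 0 <= t, t <= 1 & Om (z t)]].
have T0 : T 0 by split; rewrite // /z scale0r addr0.
have Tub : has_ubound T by exists 1 => t [].
have Tn : T !=set0 by exists 0.
pose s := sup T.
have s0 : 0 <= s by apply: ub_le_sup.
have s1 : s <= 1 by apply: sup_le_ub => // t [].
exists s; split=> //; split.
  move=> W /nbhs_enormP[e e0 hW].
  have D0 : 0 < enorm (y - x) + 1 by rewrite ltr_wpDl ?enorm_ge0.
  have [t Tt st] : exists2 t, T t & s - e / (enorm (y - x) + 1) < t.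
    apply: sup_adherent; first by rewrite divr_gt0.
    by split.
  have ts : t <= s by apply: ub_le_sup.
  exists (z t); split; first by case: Tt.
  apply: hW; rewrite zB ler0_norm; last by rewrite subr_le0.
  have : (s - t) * (enorm (y - x) + 1) < e by rewrite -ltr_pdivlMr//; lra.
  have := enorm_ge0 (y - x); nra.
move=> /nbhs_enormP[e e0 hW].
have : s < 1.
  rewrite lt_neqAle s1 andbT; apply/eqP => e1; apply: Oy.
  by have := hW (z s); rewrite subrr enorm0 => /(_ e0); rewrite /z e1 scale1r addrC subrK.
move=> slt1.
have D0 : 0 < enorm (y - x) + 1 by rewrite ltr_wpDl ?enorm_ge0.
pose t := Num.min 1 (s + e / (2 * (enorm (y - x) + 1))).
have st : s < t by rewrite lt_min slt1 ltrDl divr_gt0// mulr_gt0.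
have : T t.
  split; [exact: le_trans s0 (ltW st)|by rewrite ge_min lexx|apply: hW].
  rewrite zB gtr0_norm ?subr_gt0//.
  have h1 : t - s <= e / (2 * (enorm (y - x) + 1)).
    by rewrite lerBlDl ge_min lexx orbT.
  have : (t - s) * (2 * (enorm (y - x) + 1)) <= e.
    by rewrite -ler_pdivlMr ?mulr_gt0.
  have := enorm_ge0 (y - x); nra.
by move/(ub_le_sup Tub); rewrite leNgt st.
Qed.

(** Suppose x - q has a tangential part tau different from 0. For small c and s the points q + s
    (tau - c nu) and q + s (tau + c nu) lie inside and outside Om, so the boundary meets the segment
    between them; all of this segment is closer to x than q. *)
Lemma is_closest_normal Om x q nu : is_closest (boundary Om) x q ->
  is_outer_normal Om q nu -> x - q = dot nu (x - q) *: nu.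
Proof.
move=> [qB qmin] hn; have nu1 := proj1 hn.
set xi := x - q; pose tau := xi - dot nu xi *: nu.
apply/eqP; rewrite -subr_eq0 -/tau; apply/negP => /negP tau0.
have tn : dot nu tau = 0 by rewrite dotBr dotZr -enorm_sq nu1 expr1n mulr1 subrr.
have tt0 : 0 < dot tau tau by rewrite lt_neqAle eq_sym dot_eq0 tau0 dot_ge0.
have txi : dot tau xi = dot tau tau.
  transitivity (dot tau xi - dot nu xi * dot tau nu).
    by rewrite (dotC tau nu) tn mulr0 subr0.
  by rewrite -dotZr -dotBr.
(* Chosen so that tilting tau by at most c nu costs at most half of dot tau tau in the product with
   x - q. *)
pose c := dot tau tau / (2 * (1 + `|dot nu xi|)).
have c0 : 0 < c by rewrite divr_gt0// mulr_gt0// ltr_pwDl.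
have cxi : c * `|dot nu xi| <= dot tau tau / 2.
  rewrite /c -mulrA -[leRHS]mulr1 -[leRHS]mulrA ler_wpM2l ?dot_ge0//.
  by rewrite ler_pdivrMl ?mulr_gt0 ?ltr_pwDl//; lra.
have dv t : dot nu (tau + t *: nu) = t.
  by rewrite dotDr tn add0r dotZr -enorm_sq nu1 expr1n mulr1.
have vxi t : `|t| <= c -> dot tau tau / 2 <= dot (tau + t *: nu) xi.
  move=> tc; rewrite dotDl txi dotZl.
  have : `|t * dot nu xi| <= dot tau tau / 2.
    by rewrite normrM (le_trans _ cxi)// ler_wpM2r.
  rewrite ler_norml => /andP[]; lra.
have inball t s : `|t| <= c -> 0 < s -> s * dot (tau + t *: nu) (tau + t *: nu) < dot tau tau ->
    enorm (q + s *: (tau + t *: nu) - x) < enorm xi.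
  move=> tc s0 hs; rewrite -(@ltr_pXn2r _ 2)// ?nnegrE ?enorm_ge0// !enorm_sq.
  have -> : q + s *: (tau + t *: nu) - x = s *: (tau + t *: nu) - xi.
    by rewrite /xi opprB addrCA addrA.
  have sq (u w : V) : dot (u - w) (u - w) = dot u u - 2 * dot u w + dot w w.
    by rewrite dotBl !dotBr (dotC w u); ring.
  set v := tau + _ in hs *; rewrite sq !dotZl !dotZr.
  have := vxi t tc; rewrite -/v => hv.
  have : s * (s * dot v v) < s * dot tau tau by rewrite ltr_pM2l.
  have : s * (dot tau tau / 2) <= s * dot v xi by rewrite ler_pM2l.
  lra.
have cNc : `|- c| <= c by rewrite normrN gtr0_norm.
have cc : `|c| <= c by rewrite gtr0_norm.
have dm : dot nu (tau + (- c) *: nu) < 0 by rewrite dv oppr_lt0.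
have dp : 0 < dot nu (tau + c *: nu) by rewrite dv.
have [s1 s10 h1] := outer_normal_cone hn (negbT (lt_eqF dm)).
have [s2 s20 h2] := outer_normal_cone hn (negbT (gt_eqF dp)).
(* A step s below [D t] makes the quadratic term s |v|^2 smaller than |tau|^2, hence smaller than
   the linear gain. *)
pose D t : R := dot tau tau / (1 + dot (tau + t *: nu) (tau + t *: nu)).
have D0 t : 0 < D t by rewrite divr_gt0// ltr_pwDl// dot_ge0.
pose s := Num.min (Num.min s1 s2) (Num.min (D c) (D (- c))) / 2.
have m0 : 0 < Num.min (Num.min s1 s2) (Num.min (D c) (D (- c))).
  by rewrite !lt_min s10 s20 !D0.
have s0 : 0 < s by rewrite divr_gt0.
have sm : s < Num.min (Num.min s1 s2) (Num.min (D c) (D (- c))) by rewrite /s; lra.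
move: sm; rewrite !lt_min => /andP[/andP[ss1 ss2] /andP[sD1 sD2]].
have hD t : s < D t -> s * dot (tau + t *: nu) (tau + t *: nu) < dot tau tau.
  rewrite /D ltr_pdivlMr ?ltr_pwDl ?dot_ge0// mulrDr mulr1; lra.
have zm : Om (q + s *: (tau + (- c) *: nu)) by have [/(_ dm)] := h1 s s0 ss1.
have zp : ~ Om (q + s *: (tau + c *: nu)) by have [_ /(_ dp)] := h2 s s0 ss2.
have [t [t0 t1 bt]] := boundary_segment zm zp.
set z := _ + t *: _ in bt; have : enorm (z - x) < enorm xi.
  have -> : z - x = (1 - t) *: (q + s *: (tau + (- c) *: nu) - x) +
                    t *: (q + s *: (tau + c *: nu) - x).
    rewrite /z; set z1 := q + s *: (tau + (- c) *: nu); set z2 := q + _.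
    by rewrite scalerBl scale1r !scalerBr; apply/rowP => i; rewrite !mxE; ring.
  apply: le_lt_trans (enormD _ _) _; rewrite !enormZ !ger0_norm ?subr_ge0//.
  have i1 := inball (- c) s cNc s0 (hD _ sD2).
  have i2 := inball c s cc s0 (hD _ sD1).
  have [->|tn0] := eqVneq t 0; first by rewrite subr0 mul1r mul0r addr0.
  have tp : 0 < t by rewrite lt_neqAle eq_sym tn0.
  have : t * enorm (q + s *: (tau + c *: nu) - x) < t * enorm xi by rewrite ltr_pM2l.
  have : (1 - t) * enorm (q + s *: (tau + (- c) *: nu) - x) <= (1 - t) * enorm xi.
    by rewrite ler_wpM2l ?subr_ge0// ltW.
  lra.
by have := qmin z bt; rewrite -/xi enormB leNgt => /negP.
Qed.

(** The boundary meets the segment from p + s (u - nu), inside Om, to p + s (u + nu), outside. The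
    point found has component exactly s along u, which [no_boundary] exploits. *)
Lemma tangential_boundary_pt Om p nu u (delta : R) : is_outer_normal Om p nu ->
  enorm u = 1 -> dot u nu = 0 -> 0 < delta ->
  exists s th q, [/\ 0 < s, s < delta, `|th| <= 1, boundary Om q &
    q = p + s *: (u + th *: nu)].
Proof.
move=> hn u1 un delta0; have nu1 := proj1 hn.
have dv t : dot nu (u + t *: nu) = t.
  by rewrite dotDr dotC un add0r dotZr -enorm_sq nu1 expr1n mulr1.
have dm : dot nu (u + (- 1) *: nu) < 0 by rewrite dv oppr_lt0.
have dp : 0 < dot nu (u + 1 *: nu) by rewrite dv.
have [s1 s10 h1] := outer_normal_cone hn (negbT (lt_eqF dm)).
have [s2 s20 h2] := outer_normal_cone hn (negbT (gt_eqF dp)).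
pose s := Num.min (Num.min s1 s2) delta / 2.
have m0 : 0 < Num.min (Num.min s1 s2) delta by rewrite !lt_min s10 s20.
have s0 : 0 < s by rewrite divr_gt0.
have sm : s < Num.min (Num.min s1 s2) delta by rewrite /s; lra.
move: sm; rewrite !lt_min => /andP[/andP[ss1 ss2] sd].
have zm : Om (p + s *: (u + (- 1) *: nu)) by have [/(_ dm)] := h1 s s0 ss1.
have zp : ~ Om (p + s *: (u + 1 *: nu)) by have [_ /(_ dp)] := h2 s s0 ss2.
have [t [t0 t1 bt]] := boundary_segment zm zp.
exists s, (2 * t - 1), (p + s *: (u + (2 * t - 1) *: nu)).
have th1 : `|2 * t - 1| <= 1 by rewrite ler_norml; apply/andP; split; lra.
have qE : p + s *: (u + (2 * t - 1) *: nu) = p + s *: (u + (- 1) *: nu) +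
    t *: (p + s *: (u + 1 *: nu) - (p + s *: (u + (- 1) *: nu))).
  by apply/rowP => i; rewrite !mxE; ring.
by rewrite -qE in bt; exact: And5 s0 sd th1 bt erefl.
Qed.

End OuterNormals.

(** * Gradients and Lipschitz bounds *)

Section Gradient.
Variables (R : realType) (d : nat).
Local Notation V := 'rV[R]_d.
Implicit Types (x y v : V) (f : V -> R).

Definition gradient f x : V := \row_i partial i f x.

Lemma diff_gradient f x v : differentiable f x -> 'd f x v = dot (gradient f x) v.
Proof.
move=> df; rewrite {1}[v]row_sum_delta linear_sum /=.
apply: eq_bigr => i _; rewrite linearZ /= mxE /partial deriveE//.
by rewrite mulrC.
Qed.

Lemma norm_le_enorm v : `|v| <= enorm v.
Proof.
rewrite [leLHS]/Num.norm /= mx_normrE; apply: bigmax_le; first exact: enorm_ge0.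
by move=> -[i j] _; rewrite /= ord1; exact: coord_le_enorm.
Qed.

Lemma differentiable_expansion f x (eps : R) : differentiable f x -> 0 < eps ->
  exists2 r : R, 0 < r & forall z, enorm (z - x) < r ->
    `|f z - f x - dot (gradient f x) (z - x)| <= eps * enorm (z - x).
Proof.
move=> df eps0; have := diff_locallyx df; set k := 'o _ => fE.
have /(littleoP [littleo of k]) : 0 < eps by [].
move=> /nbhs_enormP[r r0 hr]; exists r => // z zr.
have := fE (z - x); rewrite subrK => ->; rewrite -diff_gradient//.
rewrite (_ : _ - _ - _ = k (z - x)); last by ring.
apply: (@le_trans _ _ (eps * `|z - x|)); first by apply: hr; rewrite subr0.
by rewrite ler_pM2l// norm_le_enorm.
Qed.

Lemma is_derive_line f x v t : differentiable f (x + t *: v) ->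
  is_derive t 1 (fun s : R => f (x + s *: v)) (dot (gradient f (x + t *: v)) v).
Proof.
move=> df; have dv : derivable f (x + t *: v) v by exact: diff_derivable.
have E' : (fun h : R => h^-1 *: (((fun s : R => f (x + s *: v)) \o shift t) (h *: (1 : R)) -
    f (x + t *: v))) = (fun h : R => h^-1 *: ((f \o shift (x + t *: v)) (h *: v) -
    f (x + t *: v))).
  apply/funext => h /=; congr (_ *: (f _ - _)).
  by rewrite [h *: 1]mulr1 scalerDl addrCA.
apply: DeriveDef; first by rewrite /derivable E'; exact: dv.
by rewrite -diff_gradient// -deriveE// /derive E'.
Qed.

Lemma lipschitz_on_ball f x (r B : R) :
  (forall y, enorm (y - x) < r -> differentiable f y /\ enorm (gradient f y) <= B) ->
  forall y z, enorm (y - x) < r -> enorm (z - x) < r ->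
    `|f z - f y| <= B * enorm (z - y).
Proof.
move=> H y z yr zr.
have seg t : 0 <= t -> t <= 1 -> enorm (y + t *: (z - y) - x) < r.
  move=> t0 t1; have -> : y + t *: (z - y) - x = (1 - t) *: (y - x) + t *: (z - x).
    by apply/rowP => i; rewrite !mxE; ring.
  apply: le_lt_trans (enormD _ _) _; rewrite !enormZ !ger0_norm ?subr_ge0//.
  have [->|tn0] := eqVneq t 0; first by rewrite subr0 mul1r mul0r addr0.
  have tp : 0 < t by rewrite lt_neqAle eq_sym tn0.
  have h1 : t * enorm (z - x) < t * r by rewrite ltr_pM2l.
  have h2 : (1 - t) * enorm (y - x) <= (1 - t) * r by rewrite ler_wpM2l ?subr_ge0// ltW.
  by have := ltr_leD h1 h2; rewrite -mulrDl addrC (addrC t) subrK mul1r.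
pose g (t : R) := f (y + t *: (z - y)).
have dg (t : R) : 0 <= t -> t <= 1 ->
    is_derive t 1 g (dot (gradient f (y + t *: (z - y))) (z - y)).
  by move=> t0 t1; apply: is_derive_line; have [] := H _ (seg t t0 t1).
have cg : {within `[0, 1], continuous g}.
  apply: derivable_within_continuous => t; rewrite in_itv /= => /andP[t0 t1].
  by have [] := dg t t0 t1.
have [c + E] := MVT ltr01 (fun t (tt : t \in `]0, 1[) =>
  dg t (ltW (proj1 (andP tt))) (ltW (proj2 (andP tt)))) cg.
rewrite in_itv /= => /andP[c0 c1].
have g1 : g 1 = f z by rewrite /g scale1r addrC subrK.
have g0 : g 0 = f y by rewrite /g scale0r addr0.
move: E; rewrite g1 g0 subr0 mulr1 => ->.
apply: le_trans (norm_dot_le _ _) _; rewrite ler_wpM2r ?enorm_ge0//.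
by have [] := H _ (seg c (ltW c0) (ltW c1)).
Qed.

End Gradient.

Section SmoothBoundary.
Variables (R : realType) (d : nat).
Local Notation V := 'rV[R]_d.
Implicit Types (x y p q : V) (W Om : set V) (phi : V -> R).

Lemma unit_lipschitz (a b : V) : a != 0 -> b != 0 ->
  enorm ((enorm a)^-1 *: a - (enorm b)^-1 *: b) <= 2 * enorm (a - b) / enorm b.
Proof.
move=> a0 b0; have ap : 0 < enorm a by rewrite enorm_gt0.
have bp : 0 < enorm b by rewrite enorm_gt0.
have -> : (enorm a)^-1 *: a - (enorm b)^-1 *: b =
    (enorm b)^-1 *: (a - b) + ((enorm a)^-1 - (enorm b)^-1) *: a.
  by apply/rowP => i; rewrite !mxE; ring.
apply: le_trans (enormD _ _) _; rewrite !enormZ [`|_^-1|]gtr0_norm ?invr_gt0//.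
rewrite (_ : (enorm a)^-1 - (enorm b)^-1 = (enorm b - enorm a) / (enorm a * enorm b)); last first.
  by field; rewrite !gt_eqF.
rewrite normrM [`|(_ * _)^-1|]gtr0_norm ?invr_gt0 ?mulr_gt0//.
have : `|enorm b - enorm a| <= enorm (a - b).
  rewrite ler_norml; have := enorm_dist a b 0; have := enorm_dist b a 0.
  rewrite !subr0 (enormB b a); lra.
rewrite -(ler_pM2r bp) => h1.
rewrite -(ler_pM2r bp) divfK ?gt_eqF// mulrDl.
rewrite [X in X + _](_ : _ = enorm (a - b)); last by field; rewrite gt_eqF.
rewrite [X in _ + X](_ : _ = `|enorm b - enorm a|); last by field; rewrite !gt_eqF.
by move: h1; rewrite ler_pM2r//; lra.
Qed.

Lemma le_sum2 (n m : nat) (F : 'I_n -> 'I_m -> R) i j :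
  (forall k l, 0 <= F k l) -> F i j <= \sum_k \sum_l F k l.
Proof.
move=> F0; rewrite (bigD1 i)//= (bigD1 j)//= -addrA lerDl addr_ge0//.
  by apply: sumr_ge0.
by apply: sumr_ge0 => k _; apply: sumr_ge0.
Qed.

(** Near p the second derivatives are bounded and one first derivative keeps half of its modulus, by
    continuity; the mean value theorem then makes the gradient Lipschitz. *)
Lemma smooth_local W phi p : open W -> W p -> smooth_on W phi ->
  (exists i, partial i phi p != 0) ->
  exists r m B : R, [/\ 0 < r, 0 < m, 0 < B,
    forall x, enorm (x - p) < r -> W x /\ m <= enorm (gradient phi x) &
    forall x y, enorm (x - p) < r -> enorm (y - p) < r ->
      enorm (gradient phi x - gradient phi y) <= B * enorm (x - y)].
Proof.
move=> oW Wp sm [i0 gi0]; have [d1 /= c1] := sm 2%N.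
have d2 i x : W x -> differentiable (partial i phi) x by move=> Wx; apply: (c1 i).1.
have cc i j x : W x -> {for x, continuous (partial j (partial i phi))}.
  by move=> Wx; apply: (c1 i).2.
pose S := \sum_i \sum_j (`|partial j (partial i phi) p| + 1).
have S0 i j : `|partial j (partial i phi) p| + 1 <= S.
  by apply: (le_sum2 (F := fun i j => _)) => k l; rewrite addr_ge0.
have n1 : \forall x \near nbhs p, forall i j, `|partial j (partial i phi) x| < S.
  apply: filter_forall => i; apply: filter_forall => j.
  have cij : {for p, continuous (fun x => `|partial j (partial i phi) x|)}.
    by apply: continuous_comp; [exact: cc|exact: norm_continuous].
  apply: (cij [set t | t < S]); apply: lt_nbhsl.
  by apply: lt_le_trans (S0 i j); rewrite ltrDl.
have m0 : 0 < `|partial i0 phi p| / 2 by rewrite divr_gt0// normr_gt0.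
have n2 : \forall x \near nbhs p, `|partial i0 phi p| / 2 < `|partial i0 phi x|.
  have ci : {for p, continuous (fun x => `|partial i0 phi x|)}.
    apply: continuous_comp; last exact: norm_continuous.
    by apply: differentiable_continuous; exact: d2.
  apply: (ci [set t | _ < t]); apply: lt_nbhsr; lra.
have n3 : \forall x \near nbhs p, W x by apply: open_nbhs_nbhs; split.
have [r r0 hr] := (nbhs_enormP _ _).1 (filterI n3 (filterI n1 n2)).
have dp : 0 < d%:R :> R by rewrite ltr0n (leq_ltn_trans _ (ltn_ord i0)).
have Sp : 0 < S by apply: lt_le_trans (S0 i0 i0); rewrite ltr_wpDl.
exists r, (`|partial i0 phi p| / 2), (d%:R * (d%:R * S)).
split=> //; first by rewrite !mulr_gt0.
  move=> x /hr[Wx [_ /ltW hx]]; split=> //; apply: le_trans hx _.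
  by have := coord_le_enorm (gradient phi x) i0; rewrite mxE.
move=> x y xr yr; rewrite -mulrA; apply: enorm_le_coord => i; rewrite !mxE.
apply: (lipschitz_on_ball (r := r) (x := p)) => // z /hr[Wz [hz _]].
split; first exact: d2.
by apply: enorm_le_coord => j; rewrite mxE; exact/ltW/hz.
Qed.

Lemma level_set_normal Om W phi q : open Om -> open W -> W q ->
  (forall x, W x -> (Om x <-> phi x < 0)) -> boundary Om q ->
  differentiable phi q -> gradient phi q != 0 ->
  is_outer_normal Om q ((enorm (gradient phi q))^-1 *: gradient phi q).
Proof.
move=> oOm oW Wq E [clq niq] dq g0; set g := gradient phi q in g0 *.
have gp : 0 < enorm g by rewrite enorm_gt0.
have /nbhs_enormP[r1 r10 hr1] : nbhs q W by apply: open_nbhs_nbhs.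
(* If phi q > 0, points of Om close to q would have phi > 0; if phi q < 0, then q would be interior
   to Om. *)
have q0 : phi q = 0.
  apply/eqP; rewrite eq_le; apply/andP; split; rewrite leNgt; apply/negP => hq.
    have n0 : nbhs q (W `&` [set x | 0 < phi x]).
      apply: filterI; first by apply: open_nbhs_nbhs.
      have cq : {for q, continuous phi} by exact: differentiable_continuous.
      by apply: (cq [set t | 0 < t]); exact: lt_nbhsr.
    have [x [Ox [Wx /= px]]] := clq _ n0.
    by move/(E _ Wx): Ox; rewrite ltNge ltW.
  by apply: niq; apply: open_nbhs_nbhs; split=> //; apply/(E _ Wq).
split; first by rewrite enormZ gtr0_norm ?invr_gt0// mulVf// gt_eqF.
move=> eps eps0; have e0 : 0 < enorm g * eps / 2 by rewrite divr_gt0// mulr_gt0.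
have [r r0 hr] := differentiable_expansion dq e0.
exists (Num.min r r1); first by rewrite lt_min r0.
move=> z; rewrite lt_min => /andP[zr zr1]; have Wz := hr1 _ zr1.
have := hr _ zr; rewrite q0 subr0 -/g dotZl ler_norml => /andP[h1 h2].
have nz := enorm_ge0 (z - q).
split=> h; [apply/(E _ Wz)|move/(E _ Wz)].
  move: h; rewrite mulrC ltr_pdivrMr// => h.
  have zp : 0 < enorm (z - q).
    rewrite lt_neqAle nz andbT; apply/eqP => z0; move: h; rewrite -z0 mulr0 mul0r.
    by have -> : z - q = 0; [apply/eqP; rewrite -enorm_eq0 -z0|rewrite dot0r ltxx].
  have : 0 < enorm g * eps * enorm (z - q) by rewrite !mulr_gt0.
  nra.
move: h; rewrite [ltRHS]mulrC ltr_pdivlMr// => h.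
have : 0 <= enorm g * eps * enorm (z - q).
  by apply: mulr_ge0 => //; apply: mulr_ge0; exact: ltW.
move=> hp; rewrite ltNge => /negP; apply; lra.
Qed.

Lemma compact_boundary Om : bounded_set Om -> compact (boundary Om).
Proof.
move=> bO; apply: bounded_closed_compact.
  have [M [Mr hM]] := bO; exists M; split=> // N MN x [clx _].
  have cl : closed [set y : V | `|y| <= N].
    rewrite (_ : [set y | _] = (fun y : V => `|y|) @^-1` [set t | t <= N]) //.
    by apply: closed_comp => [y _|]; [exact: norm_continuous|exact: closed_le].
  apply: cl; move: clx; apply: closure_subset => y; exact: hM.
apply: closedI; first exact: closed_closure.
by apply: open_closedC; exact: open_interior.
Qed.

(** Locally the normal is the normalized gradient of a defining function. To pass to global
    constants by compactness, the single integer n serves as Lipschitz constant and, through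
    1/(n+1), as radius: the property then holds near each boundary point for all large n. *)
Lemma uniform_normal Om : smooth_bounded_domain Om ->
  (forall q, boundary Om q -> is_outer_normal Om q (outer_normal Om q)) /\
  exists Lam delta : R, [/\ 0 < Lam, 0 < delta &
    forall q q', boundary Om q -> boundary Om q' -> enorm (q - q') < delta ->
      enorm (outer_normal Om q - outer_normal Om q') <= Lam * enorm (q - q')].
Proof.
move=> [oOm _ _ bOm sOm].
have loc p : boundary Om p -> exists r L : R, [/\ 0 < r, 0 < L &
    forall q q', boundary Om q -> boundary Om q' -> enorm (q - p) < r ->
      enorm (q' - p) < r -> is_outer_normal Om q (outer_normal Om q) /\
      enorm (outer_normal Om q - outer_normal Om q') <= L * enorm (q - q')].
  move=> bp; have [W [phi [oW Wp sm gr E]]] := sOm p bp.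
  have [r [m [B [r0 m0 B0 h1 h2]]]] := smooth_local oW Wp sm (gr p Wp).
  have nq q : boundary Om q -> enorm (q - p) < r -> gradient phi q != 0 /\
      is_outer_normal Om q ((enorm (gradient phi q))^-1 *: gradient phi q).
    move=> bq qr; have [Wq gm] := h1 q qr.
    have g0 : gradient phi q != 0 by rewrite -enorm_gt0 (lt_le_trans m0).
    split=> //; apply: (level_set_normal oOm oW Wq E bq) => //.
    by have [dphi _] := sm 1%N; exact: dphi.
  exists r, (2 * B / m); split=> //; first by rewrite divr_gt0// mulr_gt0.
  move=> q q' bq bq' qr qr'; have [g0 hq] := nq q bq qr; have [g0' hq'] := nq q' bq' qr'.
  rewrite (outer_normalE hq) (outer_normalE hq'); split=> //.
  apply: le_trans (unit_lipschitz g0 g0') _.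
  have gm : m <= enorm (gradient phi q') by have [] := h1 q' qr'.
  apply: (@le_trans _ _ (2 * (B * enorm (q - q')) / m)); last first.
    by rewrite le_eqVlt; apply/orP; left; apply/eqP; ring.
  rewrite -!mulrA ler_pM2l// [leRHS]mulrA; apply: ler_pM.
  - exact: enorm_ge0.
  - by rewrite invr_ge0 enorm_ge0.
  - exact: h2.
  - by rewrite lef_pV2 ?posrE// (lt_le_trans m0).
split=> [q bq|].
  by have [r [L [r0 L0 h]]] := loc q bq; have [] := h q q bq bq; rewrite ?subrr ?enorm0.
have /compact_near_coveringP cov := compact_boundary bOm.
pose P (n : nat) q := forall q', boundary Om q -> boundary Om q' ->
  enorm (q - q') < n.+1%:R^-1 ->
  enorm (outer_normal Om q - outer_normal Om q') <= n%:R * enorm (q - q').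
have : \forall n \near \oo, boundary Om `<=` P n.
  apply: cov => p bp; have [r [L [r0 L0 h]]] := loc p bp.
  pose N := (Num.truncn (L + 2 / r)).+1.
  have NL : L + 2 / r < N%:R by exact: Num.Theory.truncnS_gt.
  have Np : 0 < N%:R :> R by rewrite ltr0n.
  have r2 : 0 < 2 / r by rewrite divr_gt0.
  near=> p' n.
  have pn : enorm (p' - p) < r / 2 by near: p'; apply/nbhs_enormP; exists (r / 2); rewrite ?divr_gt0.
  have nN : (N <= n)%N by near: n; exact: nbhs_infty_ge.
  move=> q' bq bq' qq'.
  have nNr : N%:R <= n%:R :> R by rewrite ler_nat.
  have nr : n.+1%:R^-1 < r / 2.
    rewrite -[r / 2]invrK ltf_pV2 ?posrE ?invr_gt0 ?divr_gt0// invf_div.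
    by apply: lt_le_trans (_ : N%:R <= _); [lra|rewrite ler_nat leqW].
  have [] := h p' q' bq bq'.
  - by apply: lt_trans pn _; lra.
  - apply: le_lt_trans (enorm_dist p' _ _) _; rewrite (enormB q' p').
    by rewrite [ltRHS](splitr r) ltrD// (lt_trans qq').
  move=> _ h'; apply: le_trans h' _; rewrite ler_wpM2r ?enorm_ge0//; lra.
move=> [N _ hN]; exists N.+1%:R, N.+2%:R^-1; split; rewrite ?invr_gt0 ?ltr0n//.
move=> q q' bq bq' qq'; apply: (hN N.+1) => //=; exact: leqnSn.
Unshelve. all: by end_near. Qed.

End SmoothBoundary.

(** * The discrete boundary *)

Section ClosestPoint.
Variables (R : realType) (d : nat).
Local Notation V := 'rV[R]_d.
Variables (Om : set V) (delta0 : R).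
Hypothesis tub : tubular Om delta0.
Implicit Types (x y p q : V) (G : set V).

Lemma closestP x : tube Om delta0 x -> is_closest (boundary Om) x (closest Om x).
Proof. by move=> /(proj2 tub)[y [hy _]]; apply: xgetPex; exists y. Qed.

Lemma closest_uniq x q : tube Om delta0 x -> is_closest (boundary Om) x q ->
  closest Om x = q.
Proof.
move=> tx hq; have [y [_ u]] := proj2 tub x tx.
by rewrite -(u _ (closestP tx)) -(u _ hq).
Qed.

Lemma dist_to_closest x : tube Om delta0 x ->
  dist_to (boundary Om) x = enorm (x - closest Om x).
Proof.
move=> tx; have [bc mc] := closestP tx.
have lb : lbound [set enorm (x - y) | y in boundary Om] (enorm (x - closest Om x)).
  by move=> _ [y by_ <-]; exact: mc.
apply/eqP; rewrite eq_le; apply/andP; split.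
  by apply: ge_inf; [exists (enorm (x - closest Om x))|exists (closest Om x)].
by apply: lb_le_inf => //; exists (enorm (x - closest Om x)), (closest Om x).
Qed.

Lemma signed_dist_closest x : tube Om delta0 x ->
  `|signed_dist Om x| = enorm (x - closest Om x).
Proof.
move=> tx; rewrite -(dist_to_closest tx) /signed_dist; case: ifP => _.
  by rewrite normrN ger0_norm// dist_to_closest// enorm_ge0.
by rewrite ger0_norm// dist_to_closest// enorm_ge0.
Qed.

(** The function f y = |y - p| - |y - closest Om y| is at most |closest Om y - p|. It is positive on
    the compact set of points of G at distance at least e from z, since closest points are unique
    and the projection is injective on G. A one-sided Lipschitz bound for f then gives a positive
    lower bound there. *)
Lemma closest_inverse_continuous G z (e : R) : compact G -> G `<=` tube Om delta0 ->
  set_inj G (closest Om) -> G z -> 0 < e ->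
  exists2 m : R, 0 < m & forall y, G y ->
    enorm (closest Om y - closest Om z) < m -> enorm (y - z) < e.
Proof.
move=> cG tG iG Gz e0; set p := closest Om z.
pose K := G `&` [set y | e <= enorm (y - z)].
have cK : compact K.
  apply: compact_closedI => //.
  rewrite (_ : [set y | _] = (fun y => enorm (y - z)) @^-1` [set t | e <= t]) //.
  by apply: closed_comp => [y _|]; [exact: continuous_enorm_dist|exact: closed_ge].
pose f y := enorm (y - p) - enorm (y - closest Om y).
have Gp y : G y -> is_closest (boundary Om) y (closest Om y) by move=> /tG/closestP.
have bp : boundary Om p by have [] := Gp z Gz.
have fE y : f y = enorm (y - p) - enorm (y - closest Om y) by [].
clearbody f.
have f0 y : K y -> 0 < f y.
  move=> [Gy /= yz]; rewrite fE subr_gt0 ltNge; apply/negP => h.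
  have [bc mc] := Gp y Gy.
  have cy : closest Om y = p.
    apply: closest_uniq; first exact: tG.
    by split; [exact: bp|move=> q bq; exact: (le_trans h (mc q bq))].
  have yE : y = z by apply: iG; rewrite ?inE.
  by move: yz; rewrite yE subrr enorm0 leNgt e0.
have fl y y' : K y -> K y' -> f y - 2 * enorm (y - y') <= f y'.
  move=> [Gy _] [Gy' _]; have [bc mc] := Gp y Gy; have [bc' mc'] := Gp y' Gy'.
  rewrite !fE; have := enorm_dist y' y p; have := mc' _ bc; have := enorm_dist y y' (closest Om y).
  move: (closest Om y) (closest Om y') => c c'.
  rewrite (enormB y' y); move: (enorm (y - p)) (enorm (y' - p)) (enorm (y - y'))
    (enorm (y' - c)) (enorm (y - c)) (enorm (y' - c')) => a1 a2 a3 a4 a5 a6; lra.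
pose P (n : nat) y := K y -> n.+1%:R^-1 < f y.
have /compact_near_coveringP cov := cK.
have : \forall n \near \oo, K `<=` P n.
  apply: cov => x Kx; have fx := f0 x Kx.
  pose N := (Num.truncn (2 / f x)).+1.
  have NL : 2 / f x < N%:R by exact: Num.Theory.truncnS_gt.
  near=> y n.
  have yx : enorm (y - x) < f x / 4.
    by near: y; apply/nbhs_enormP; exists (f x / 4); rewrite ?divr_gt0.
  have nN : (N <= n)%N by near: n; exact: nbhs_infty_ge.
  move=> Ky; have := fl x y Kx Ky; rewrite enormB => h.
  apply: (@lt_le_trans _ _ (f x / 2)); last lra.
  rewrite -[f x / 2]invrK ltf_pV2 ?posrE ?invr_gt0 ?divr_gt0// invf_div.
  by apply: lt_le_trans NL _; rewrite ler_nat leqW.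
move=> [N _ hN]; exists N.+1%:R^-1; rewrite ?invr_gt0 ?ltr0n// => y Gy yp.
rewrite ltNge; apply/negP => ye; have Ky : K y by [].
have := hN N (leqnn N) y Ky Ky; rewrite fE => h.
have := enorm_dist (closest Om y) y p; move: h yp.
move: (enorm (closest Om y - p)) (enorm (y - p)) (enorm (y - closest Om y)) (N.+1%:R^-1) => a1 a2 a3 a4; lra.
Unshelve. all: by end_near. Qed.

End ClosestPoint.

Section DiscreteBoundary.
Variables (R : realType) (d : nat).
Local Notation V := 'rV[R]_d.
Variables (M : mesh R d).
Local Notation elt_ix := 'I_(nelt M).
Variables (lam : elt_ix -> 'I_d.+1 -> affine R d) (ctr : elt_ix -> V) (r h : R).
Hypotheses (d_gt0 : (0 < d)%N) (bary : forall i, barycentric (@vtx _ _ M i) (lam i))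
  (conf : conforming_mesh M) (r_gt0 : 0 < r)
  (ball_elt : forall (i : elt_ix) (x : V), enorm (x - ctr i) <= r -> elt i x)
  (elt_diam : forall (i : elt_ix) (x y : V), elt i x -> elt i y -> enorm (x - y) <= h).
Variables (rhoh : V -> R) (wr : elt_ix -> affine R d).
Hypothesis wrE : forall (i : elt_ix) (x : V), elt i x -> rhoh x = wr i x.
Implicit Types (i j : elt_ix) (x y z : V) (k l m : 'I_d.+1).

Definition rnorm i : V := (enorm (grad (wr i)))^-1 *: grad (wr i).

(** The element is cut through its interior. This is stronger than membership in T_Gamma^h, which
    also holds if Gamma_h merely touches an element of T_Omega^h. *)
Definition proper i : bool :=
  [exists k, wr i (vtx i k) < 0] && [exists k, 0 < wr i (vtx i k)].

Lemma proper_grad i : proper i -> 0 < enorm (grad (wr i)).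
Proof.
move=> /andP[/existsP[k hk] /existsP[l hl]]; rewrite enorm_gt0.
apply/eqP => g0; have := affB (wr i) (vtx i k) (vtx i l); rewrite g0 dot0l.
by move=> /eqP; rewrite subr_eq0 => /eqP e; move: (lt_trans hk hl); rewrite e ltxx.
Qed.

Lemma rnorm1 i : proper i -> enorm (rnorm i) = 1.
Proof.
move=> /proper_grad g0.
by rewrite /rnorm enormZ gtr0_norm ?invr_gt0// mulVf// gt_eqF.
Qed.

Lemma dot_rnorm i x : proper i ->
  dot (grad (wr i)) x = enorm (grad (wr i)) * dot (rnorm i) x.
Proof. by move=> /proper_grad g0; rewrite /rnorm dotZl mulrA divff ?mul1r// gt_eqF. Qed.

Lemma wr_rnorm i x y : proper i ->
  wr i x - wr i y = enorm (grad (wr i)) * dot (rnorm i) (x - y).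
Proof. by move=> pi; rewrite affB dot_rnorm. Qed.

Lemma near_vtx_interior i x (e : R) : elt i x -> 0 < e ->
  exists2 y, forall m, 0 < lam i m y & enorm (y - x) < e.
Proof.
move=> ix e0; have D0 : 0 < enorm (ctr i - x) + 1 by rewrite ltr_wpDl ?enorm_ge0.
pose s := Num.min 1 (e / (enorm (ctr i - x) + 1)).
have s0 : 0 < s by rewrite lt_min ltr01 divr_gt0.
have s1 : s <= 1 by rewrite ge_min lexx.
exists (x + s *: (ctr i - x)) => [m|].
  rewrite aff_seg ltr_wpDl//.
    by rewrite mulr_ge0 ?subr_ge0//; move/(eltP bary): ix; exact.
  by rewrite mulr_gt0//; exact: (ctr_pos d_gt0 bary r_gt0 ball_elt).
rewrite addrAC subrr add0r enormZ gtr0_norm//.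
have : s * (enorm (ctr i - x) + 1) <= e by rewrite -ler_pdivlMr// ge_min lexx orbT.
by apply: lt_le_trans; rewrite ltr_pM2l// ltrDl.
Qed.

Lemma proper_zero i : proper i ->
  exists2 x, forall m, 0 < lam i m x & wr i x = 0.
Proof.
move=> pi; have g0 := proper_grad pi.
have /andP[/existsP[k hk] /existsP[l hl]] := pi.
have near v (e : R) : elt i v -> 0 < e -> exists2 y, forall m, 0 < lam i m y & `|wr i y - wr i v| < e.
  move=> iv e0; have [y yp yv] := near_vtx_interior iv (divr_gt0 e0 g0).
  exists y => //; rewrite affB (le_lt_trans (norm_dot_le _ _))// mulrC.
  by rewrite -ltr_pdivlMr.
have [y yp hy] := near _ (- wr i (vtx i k)) (elt_vtx bary i k) (ltac:(by rewrite oppr_gt0)).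
have [z zp hz] := near _ (wr i (vtx i l)) (elt_vtx bary i l) hl.
move: hy hz; rewrite !ltr_norml => /andP[_ hy] /andP[hz _].
have wy : wr i y < 0 by lra.
have wz : 0 < wr i z by lra.
pose t := - wr i y / (wr i z - wr i y).
have D0 : 0 < wr i z - wr i y by lra.
have t0 : 0 < t by rewrite divr_gt0// oppr_gt0.
have t1 : t < 1 by rewrite ltr_pdivrMr//; lra.
exists (y + t *: (z - y)) => [m|]; rewrite aff_seg.
  by apply: addr_gt0; apply: mulr_gt0 => //; rewrite subr_gt0.
by rewrite /t; field; rewrite gt_eqF.
Qed.

Lemma elt_region i x : elt i x -> region M x.
Proof. by exists i. Qed.

Lemma interior_outer_normal i x : proper i -> (forall m, 0 < lam i m x) ->
  wr i x = 0 -> is_outer_normal (Omega_h M rhoh) x (rnorm i).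
Proof.
move=> pi xp x0; have g0 := proper_grad pi; split; first exact: rnorm1.
move=> eps eps0; have := pos_interior_simplex (bary i) xp.
move/nbhs_enormP => [e e0 he]; exists e => // z zx; have iz : elt i z := he z zx.
have := wr_rnorm z x pi; rewrite x0 subr0 => E.
have n0 := enorm_ge0 (z - x).
split=> hz.
  split; first exact: elt_region iz.
  rewrite (wrE iz) E pmulr_rlt0//; apply: lt_le_trans hz _.
  by rewrite mulNr oppr_le0 mulr_ge0// ltW.
move=> [_]; rewrite (wrE iz) E pmulr_rlt0// ltNge => /negP; apply.
by apply: ltW; apply: le_lt_trans hz; rewrite mulr_ge0// ltW.
Qed.

Lemma compact_Gamma_h : compact (Gamma_h M rhoh).
Proof.
have E : Gamma_h M rhoh = \bigcup_(i in [set: elt_ix])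
    (elt i `&` [set x | 0 <= wr i x] `&`
     [set x | 0 <= (Affine (- grad (wr i)) (- Defs.cst (wr i)) : affine R d) x]).
  have N i x : (Affine (- grad (wr i)) (- Defs.cst (wr i)) : affine R d) x = - wr i x.
    by rewrite /aff /= dotNl opprD.
  apply/seteqP; split=> x.
    move=> [[i _ ix] x0]; exists i => //; rewrite (wrE ix) in x0.
    by split; [split=> //=; rewrite x0|rewrite /= N x0 oppr0].
  move=> [i _ [[ix /= h1] /=]]; rewrite N oppr_ge0 => h2; split; first exact: elt_region ix.
  by rewrite (wrE ix); apply/eqP; rewrite eq_le h1 h2.
rewrite E; apply: bounded_closed_compact; last first.
  apply: closed_bigcup; first exact: finite_finset.
  move=> i _; apply: closedI; last exact: closed_aff_ge0.
  by apply: closedI; [exact: (closed_simplex (bary i))|exact: closed_aff_ge0].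
pose S := \sum_i \sum_k enorm (vtx (m := M) i k).
exists S; split; first exact: num_real.
move=> N SN x [i _ [[ix _] _]]; apply: le_trans (norm_le_enorm _) _.
move/(eltP bary): ix => ix.
apply: le_trans (enorm_simplex_le (bary i) ix) _; apply: le_trans (ltW SN).
rewrite /S (bigD1 i)//= lerDl; apply: sumr_ge0 => j _; apply: sumr_ge0 => k _.
exact: enorm_ge0.
Qed.

Section NoBoundary.
Variables (Om : set V) (delta0 crho cn Lam dLam eps : R).
Hypotheses (nOm : forall q, boundary Om q -> is_outer_normal Om q (outer_normal Om q))
  (lipOm : forall q q', boundary Om q -> boundary Om q' -> enorm (q - q') < dLam ->
    enorm (outer_normal Om q - outer_normal Om q') <= Lam * enorm (q - q'))
  (tub : tubular Om delta0)
  (geo : geometry_assumptions M rhoh h Om delta0 crho cn)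
  (Lam_gt0 : 0 < Lam) (dLam_gt0 : 0 < dLam) (h_gt0 : 0 < h)
  (crho_gt0 : 0 < crho) (cn_gt0 : 0 < cn)
  (small1 : crho * h ^+ 2 * Lam * 2 < 1) (small2 : 2 * h + 2 * (crho * h ^+ 2) < dLam)
  (small3 : 2 * (cn * h) + Lam * (2 * h + 2 * (crho * h ^+ 2)) <= eps)
  (eps_le : eps <= 2^-1).
Local Notation Gh := (Gamma_h M rhoh).

Definition nstar x : V := outer_normal Om (closest Om x).

Lemma Gh_closest x : Gh x -> is_closest (boundary Om) x (closest Om x).
Proof. by have [gt _ _ _ _] := geo; move=> /gt; exact: closestP. Qed.

Lemma Gh_dist x : Gh x -> enorm (x - closest Om x) <= crho * h ^+ 2.
Proof.
have [gt _ gd _ _] := geo; move=> gx.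
by rewrite -(signed_dist_closest tub (gt x gx)) gd.
Qed.

Lemma nstar_close x y : Gh x -> Gh y -> enorm (x - y) <= 2 * h ->
  enorm (nstar x - nstar y) <= Lam * (2 * h + 2 * (crho * h ^+ 2)).
Proof.
move=> gx gy xy; have dx := Gh_dist gx; have dy := Gh_dist gy.
have cxy : enorm (closest Om x - closest Om y) <= 2 * h + 2 * (crho * h ^+ 2).
  apply: le_trans (enorm_dist x _ _) _; rewrite enormB.
  apply: le_trans (lerD (lexx _) (enorm_dist y _ _)) _.
  by move: dx dy xy; move: (enorm _) (enorm _) (enorm _) (crho * h ^+ 2) => a b c e; lra.
apply: le_trans (lipOm _ _ (le_lt_trans cxy small2)) _.
- by have [] := Gh_closest gx.
- by have [] := Gh_closest gy.
by rewrite ler_pM2l.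
Qed.

Lemma nstar1 x : Gh x -> enorm (nstar x) = 1.
Proof. by move=> gx; have [bc _] := Gh_closest gx; have [] := nOm bc. Qed.

Lemma elt_zero_Gh i x : elt i x -> wr i x = 0 -> Gh x.
Proof. by move=> ix x0; split; [exact: elt_region ix|rewrite (wrE ix)]. Qed.

(** The normal estimate holds at points where Omega_h has an outer normal. These are dense in
    Gamma_h, so one of them lies in the interior of element i near an interior zero, and there the
    normal is [rnorm wr i]. *)
Lemma proper_normal i : proper i -> exists x,
  [/\ elt i x, Gh x & enorm (nstar x - rnorm i) <= cn * h].
Proof.
move=> pi; have [x0 x0p x00] := proper_zero pi.
have ix0 : elt i x0 by apply/(eltP bary) => m; exact: ltW.
have nb : nbhs x0 (interior (elt i)).
  by apply: open_nbhs_nbhs; split; [exact: open_interior|exact: (pos_interior_simplex (bary i))].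
have [_ _ _ gcl gn] := geo.
have [x [[gx [nu hnu]] xi]] := gcl _ (elt_zero_Gh ix0 x00) _ nb.
have xp m : 0 < lam i m x by exact: (interior_simplex_pos (bary i)).
have ix : elt i x by apply/(eltP bary) => m; exact: ltW.
have wx : wr i x = 0 by rewrite -(wrE ix); case: gx.
exists x; split=> //; have := gn x gx (ex_intro _ nu hnu).
by rewrite (outer_normalE (interior_outer_normal pi xp wx)).
Qed.

Lemma rnorm_close i j : proper i -> proper j -> touching i j ->
  enorm (rnorm i - rnorm j) <= eps.
Proof.
move=> pi pj /asboolP[z [iz jz]].
have [x [ix gx hx]] := proper_normal pi; have [y [jy gy hy]] := proper_normal pj.
have xy : enorm (x - y) <= 2 * h.
  apply: le_trans (enorm_dist z _ _) _.
  by rewrite mulrDl !mul1r lerD ?(elt_diam ix iz) ?(elt_diam jz jy).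
have nxy := nstar_close gx gy xy.
apply: le_trans small3; apply: le_trans (enorm_dist (nstar x) _ _) _; rewrite enormB.
apply: le_trans (lerD hx (enorm_dist (nstar y) _ _)) _.
rewrite mulrDl !mul1r -addrA lerD2l addrC lerD//.
Qed.

Lemma rnorm_close_pt i z : proper i -> elt i z -> Gh z ->
  enorm (rnorm i - nstar z) <= eps.
Proof.
move=> pi iz gz; have [x [ix gx hx]] := proper_normal pi.
have xz : enorm (x - z) <= 2 * h.
  by apply: le_trans (elt_diam ix iz) _; rewrite ler_peMl ?ler1n// ltW.
have nxz := nstar_close gx gz xz.
have chp : 0 <= cn * h by apply: mulr_ge0; exact: ltW.
move: (nstar x) (nstar z) (rnorm i) hx nxz => p q n.
have := enorm_dist p n q; rewrite (enormB n p); move: small3 chp.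
by move: (Lam * _) (cn * h) (enorm (p - n)) (enorm (p - q)) (enorm (n - q)) =>
  A B a1 a2 a3; lra.
Qed.

(* Gamma_h has no boundary: otherwise, near z, it would lie in a half plane,
   while the points of the boundary of Om near the projection of z surround
   it and are all projections of points of Gamma_h. *)
Lemma no_boundary i k z b : proper i -> elt i z -> wr i z = 0 ->
  lam i k z = 0 -> lam i k b = 0 -> wr i b < 0 ->
  exists2 j, j != i & elt j z.
Proof.
move=> pi iz wz lz lb wb; apply: contrapT => no; have gz := elt_zero_Gh iz wz.
have loc : \forall y \near nbhs z, forall j, j != i -> ~ elt j y.
  apply: filter_forall => j; have [->|ji] := eqVneq j i.
    by apply: nearW.
  have oC : open (~` elt j) by apply: closed_openC; exact: (closed_simplex (bary j)).
  have nz : nbhs z (~` elt j).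
    by apply: open_nbhs_nbhs; split=> // jz; apply: no; exists j.
  by apply: filterS nz => y hy _.
have [e e0 he] := (nbhs_enormP _ _).1 loc.
have [gt [_ gi gs] _ _ _] := geo.
have [m m0 hm] := closest_inverse_continuous tub compact_Gamma_h gt gi gz e0.
set p := closest Om z in hm; have [bp _] := Gh_closest gz.
set n := nstar z; have n1 : enorm n = 1 := nstar1 gz.
have hn : is_outer_normal Om p n := nOm bp.
have rn := rnorm_close_pt pi iz gz; rewrite -/n in rn.
have dn : 0 < dot (rnorm i) n.
  have : enorm (rnorm i - n) ^+ 2 <= 2^-1 ^+ 2.
    rewrite ler_pXn2r ?nnegrE ?enorm_ge0 ?invr_ge0//; exact: le_trans rn eps_le.
  rewrite enorm_sq dotBl !dotBr -!enorm_sq n1 (rnorm1 pi) !expr1n (dotC n); lra.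
(* [mv] points out of the element across facet k. Subtracting a multiple of [rnorm i] makes it
   orthogonal to n, and this changes nothing on differences of points of Gamma_h in the element,
   which are orthogonal to [rnorm i]. *)
pose mv := - grad (lam i k).
pose ka := mv - (dot mv n / dot (rnorm i) n) *: rnorm i.
have kan : dot ka n = 0 by rewrite dotBl dotZl divfK ?subrr// gt_eqF.
have g0 := proper_grad pi.
have dzb : 0 < dot (rnorm i) (z - b).
  have := wr_rnorm z b pi; rewrite wz sub0r => E.
  by rewrite -(pmulr_rgt0 _ g0) -E oppr_gt0.
have mzb : dot mv (z - b) = 0 by rewrite dotNl -affB lz lb subrr oppr0.
(* Otherwise [mv] is a multiple of [rnorm i]. Testing with z - b, which is orthogonal to [mv] but
   not to [rnorm i], shows that the factor is 0, although the gradient of a coordinate never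
   vanishes. *)
have ka0 : ka != 0.
  apply/eqP => k0; have : dot ka (z - b) = 0 by rewrite k0 dot0l.
  rewrite dotBl mzb sub0r dotZl => /eqP; rewrite oppr_eq0 mulf_eq0 (gt_eqF dzb) orbF.
  move=> /eqP c0; move: k0; rewrite /ka c0 scale0r subr0 => /eqP.
  by rewrite oppr_eq0 (negPf (grad_bary_neq0 (bary i) k d_gt0)).
have kp : 0 < enorm ka by rewrite enorm_gt0.
have [u [u1 un up]] : exists u : V, [/\ enorm u = 1, dot u n = 0 &
    forall x : V, dot ka x <= 0 -> dot u x <= 0].
  exists ((enorm ka)^-1 *: ka); split=> [||x kx].
  - by rewrite enormZ gtr0_norm ?invr_gt0// mulVf// gt_eqF.
  - by rewrite dotZl kan mulr0.
  - by rewrite dotZl pmulr_rle0// invr_gt0.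
have dl0 : 0 < Num.min m dLam / 2 by rewrite divr_gt0// lt_min m0.
have [s [th [q [s0 sd th1 bq qE]]]] := tangential_boundary_pt hn u1 un dl0.
have qp : enorm (q - p) <= 2 * s.
  rewrite qE addrAC subrr add0r enormZ gtr0_norm// mulrC ler_pM2r//.
  apply: le_trans (enormD _ _) _; rewrite u1 enormZ n1 mulr1; lra.
have s2 : 2 * s < Num.min m dLam by move: sd; rewrite ltr_pdivlMr// mulrC.
move: s2; rewrite lt_min => /andP[sm sL].
have [y gy qy] := gs q bq.
have yz : enorm (y - z) < e by apply: hm => //; rewrite qy; exact: le_lt_trans qp sm.
have iy : elt i y.
  have [[j _ jy] _] := gy; have [<-//|ji] := eqVneq j i.
  by case: (he y yz j ji).
have wy : wr i y = 0 by rewrite -(wrE iy); case: gy.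
have ry : dot (rnorm i) (y - z) = 0.
  have := wr_rnorm y z pi; rewrite wz wy subrr => /esym/eqP.
  by rewrite mulf_eq0 gt_eqF//= => /eqP.
have my : dot mv (y - z) <= 0.
  by rewrite dotNl oppr_le0 -affB lz subr0; move/(eltP bary): iy; exact.
have kay : dot ka (y - z) <= 0 by rewrite dotBl dotZl ry mulr0 subr0.
have uy : dot u (y - z) <= 0 := up _ kay.
have hy := is_closest_normal (Gh_closest gy) (nOm (Gh_closest gy).1).
have hz := is_closest_normal (Gh_closest gz) (nOm (Gh_closest gz).1).
rewrite -/(nstar y) -/(nstar z) -/n -/p in hy hz.
set be := dot (nstar y) _ in hy; set be' := dot n _ in hz.
have beh : `|be| <= crho * h ^+ 2.
  apply: le_trans (norm_dot_le _ _) _; rewrite (nstar1 gy) mul1r; exact: Gh_dist.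
have nqn : enorm (nstar y - n) <= Lam * (2 * s).
  apply: (@le_trans _ _ (Lam * enorm (closest Om y - p))).
    apply: lipOm; [by have [] := Gh_closest gy|by []|].
    by rewrite qy; exact: le_lt_trans qp sL.
  by rewrite ler_pM2l// qy.
have yzE : y - z = be *: nstar y + (q - p) - be' *: n.
  by rewrite -hy -hz -qy -/p; apply/rowP => c; rewrite !mxE; ring.
(* The displacement of the projections contributes s. The two normal offsets contribute only through
   the rotation of the normal, at most crho h^2 Lam 2s, which [small1] makes less than s; so the
   sign contradicts [uy]. *)
have : dot u (y - z) = s + be * dot u (nstar y - n).
  have uq : dot u (q - p) = s.
    rewrite qE addrAC subrr add0r dotZr dotDr dotZr un mulr0 addr0 -enorm_sq u1.
    by rewrite expr1n mulr1.
  have dE (N Q n' : V) : dot u n' = 0 -> dot u Q = s ->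
      dot u (be *: N + Q - be' *: n') = s + be * dot u (N - n').
    move=> un' uQ; rewrite (dotBr _ (be' *: n')) (dotDr (be *: N)) !dotZr un'.
    by rewrite mulr0 subr0 (dotBr N) un' subr0 addrC uQ.
  by rewrite yzE; apply: dE.
move=> E; move: uy; rewrite E leNgt => /negP; apply.
have : `|be * dot u (nstar y - n)| <= crho * h ^+ 2 * (Lam * (2 * s)).
  rewrite normrM; apply: ler_pM => //; apply: le_trans (norm_dot_le _ _) _.
  by rewrite u1 mul1r.
rewrite ler_norml => /andP[h1 _].
have : crho * h ^+ 2 * Lam * 2 * s < 1 * s by rewrite ltr_pM2r.
move: h1; move: (be * _) => B; rewrite mul1r !mulrA (mulrAC _ 2 s); lra.
Qed.

(** Sliding z towards the vertex a, where rho^h is negative, reaches a zero that is still in the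
    relative interior of facet k. By [no_boundary] a second element contains this zero, and
    conformity forces it to contain all d vertices of the facet. *)
Lemma facet_shared i k z (a : 'I_d.+1) : proper i -> elt i z -> 0 <= wr i z ->
  lam i k z = 0 -> (forall m, m != k -> 0 < lam i m z) ->
  a != k -> wr i (vtx i a) < 0 ->
  exists2 j, adjacent i j & forall x, elt i x -> lam i k x = 0 -> elt j x.
Proof.
move=> pi iz wz lz lpos ak wa.
pose v := vtx i a; pose t := wr i z / (wr i z - wr i v).
have D0 : 0 < wr i z - wr i v by rewrite subr_gt0 (lt_le_trans wa).
have t0 : 0 <= t by rewrite divr_ge0// ltW.
have t1 : t < 1 by rewrite ltr_pdivrMr// mul1r ltrDl oppr_gt0.
pose y := z + t *: (v - z).
have lv : lam i k v = 0 by rewrite (bary_vtx (bary i)) eq_sym (negPf ak).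
have ly : lam i k y = 0 by rewrite aff_seg lz lv !mulr0 addr0.
have lyp m : m != k -> 0 < lam i m y.
  move=> mk; rewrite aff_seg ltr_pwDl ?mulr_gt0 ?subr_gt0 ?lpos//.
  by rewrite mulr_ge0// (simplex_vtx (bary i)).
have iy : elt i y.
  by apply/(eltP bary) => m; have [->|/lyp/ltW//] := eqVneq m k; rewrite ly.
have wy : wr i y = 0 by rewrite aff_seg /t; field; rewrite gt_eqF.
have [j ji jy] := no_boundary pi iy wy ly lv wa.
have sub m : m != k -> m \in common i j.
  move=> mk; apply: contraT => /(elt_common bary conf iy jy) e.
  by have := lyp m mk; rewrite e ltxx.
have kc : k \notin common i j.
  apply/negP => kc; rewrite eq_sym in ji.
  have := common_neqT bary conf ji; case/negP; apply/eqP/setP => m.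
  by rewrite [RHS]inE; have [->|/sub] := eqVneq m k.
have cE : common i j = [set~ k]%SET.
  apply/setP => m; rewrite in_setC1; have [->|/sub //] := eqVneq m k.
  exact: negPf.
exists j.
  by rewrite /adjacent cE cardsC1 card_ord eqxx andbT eq_sym.
move=> x ix lx; apply: (common_elt bary conf (i := i)); first by apply/(eltP bary).
by move=> m; rewrite cE !inE negbK => /eqP ->.
Qed.

End NoBoundary.
End DiscreteBoundary.

(** * Walks in the star of a vertex *)

Section Lines.
Variables (R : realType) (d : nat).
Local Notation V := 'rV[R]_d.
Implicit Types (x y p q u : V) (A : set V).

Lemma closed_enorm A x : closed A ->
  (forall e : R, 0 < e -> exists2 y, A y & enorm (y - x) < e) -> A x.
Proof.
move=> cA h; apply: cA => W /nbhs_enormP[e e0 hW].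
by have [y Ay yx] := h e e0; exists y; split=> //; exact: hW.
Qed.

(* Real induction along a segment. *)
Lemma line_stay A p q : closed A -> A p ->
  (forall t : R, 0 <= t < 1 -> A (p + t *: (q - p)) ->
    exists2 de : R, 0 < de & forall s, t <= s -> s < t + de -> A (p + s *: (q - p))) ->
  A q.
Proof.
move=> cA Ap step; pose X (t : R) := p + t *: (q - p).
pose S := [set t : R | 0 <= t <= 1 /\ forall s, 0 <= s <= t -> A (X s)].
have S0 : S 0.
  split=> [|s]; first by rewrite lexx ler01.
  by rewrite -eq_le => /eqP <-; rewrite /X scale0r addr0.
have ubS : ubound S 1 by move=> t [/andP[]].
have nS : S !=set0 by exists 0.
have bS : has_ubound S by exists 1.
pose tau := sup S.
have tau0 : 0 <= tau.
  by have := @ub_le_sup R S bS 0 S0.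

have tau1 : tau <= 1 by exact: ge_sup nS ubS.
have lt_tau s : 0 <= s -> s < tau -> A (X s).
  move=> s0 st; have [t [_ At] lt] := sup_gt nS st.
  by apply: At; rewrite s0 ltW.
have Atau : A (X tau).
  have [E|t0] := eqVneq tau 0; first by rewrite E /X scale0r addr0.
  have tp : 0 < tau by rewrite lt_neqAle eq_sym t0.
  apply: closed_enorm => // e e0.
  have D0 : 0 < enorm (q - p) + 1 by rewrite ltr_wpDl ?enorm_ge0.
  pose s := Num.max 0 (tau - e / (enorm (q - p) + 1)).
  exists (X s).
    by apply: lt_tau; rewrite ?le_max ?lexx// gt_max tp/= ltrBlDr ltrDl divr_gt0.
  rewrite /X opprD addrACA subrr add0r -scalerBl enormZ distrC.
  have st : s <= tau by rewrite ge_max tau0/= lerBlDr lerDl divr_ge0// ltW.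
  rewrite ger0_norm ?subr_ge0//.
  have : tau - s <= e / (enorm (q - p) + 1) by rewrite lerBlDr -lerBlDl le_max lexx orbT.
  move=> /(ler_wpM2r (enorm_ge0 (q - p)))/le_lt_trans; apply.
  by rewrite mulrAC ltr_pdivrMr// ltr_pM2l// ltrDl.
have [E|t1] := eqVneq tau 1.
  by move: Atau; rewrite /X E scale1r addrC subrK.
have tl : tau < 1 by rewrite lt_neqAle t1.
have [|de de0 h] := step tau _ Atau; first by rewrite tau0.
pose s := Num.min 1 (tau + de / 2).
have ts : tau < s by rewrite lt_min tl ltrDl divr_gt0.
have Ss : S s.
  split=> [|s' /andP[s0 ss]]; first by rewrite ge_min lexx (le_trans tau0 (ltW ts)).
  have [lt|ge] := ltP s' tau; first exact: lt_tau.
  apply: h => //; apply: le_lt_trans ss _; rewrite gt_min ltrD2l; apply/orP; right.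
  by rewrite ltr_pdivrMr// ltr_pMr// ltr1n.
by have := ub_le_sup bS Ss; rewrite leNgt ts.
Qed.

Lemma exists_near_nonzero (I : finType) (W : I -> affine R d) p (e : R) : 0 < e ->
  exists2 q, enorm (q - p) < e & forall i, grad (W i) != 0 -> W i q != 0.
Proof.
move=> e0; have D0 : 0 < d%:R + 1 :> R by rewrite ltr_wpDl.
have l0 : 0 < e / (d%:R + 1) by rewrite divr_gt0.
have [c hc hW] := exists_subcube_sign W p l0.
have cc : cube c (e / (d%:R + 1) / 3 ^+ #|I|) c.
  by apply: cube_center; rewrite ltW// divr_gt0 ?exprn_gt0.
exists c; last by move=> i gi; exact: (hW i).2.
have := enorm_le_coord (x := c - p) (c := e / (d%:R + 1)).
move=> /(_ _)/le_lt_trans; apply=> [i|].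
  by rewrite !mxE; exact: hc.
by rewrite mulrCA -ltr_pdivlMl// mulVf ?gt_eqF// ltr_pdivrMr// mul1r ltrDl.
Qed.

End Lines.

Section Star.
Variables (R : realType) (d : nat).
Local Notation V := 'rV[R]_d.
Variables (M : mesh R d).
Local Notation elt_ix := 'I_(nelt M).
Variables (lam : elt_ix -> 'I_d.+1 -> affine R d) (ctr : elt_ix -> V) (r h : R).
Hypotheses (d_gt0 : (0 < d)%N) (bary : forall i, barycentric (@vtx _ _ M i) (lam i))
  (conf : conforming_mesh M) (r_gt0 : 0 < r)
  (ball_elt : forall (i : elt_ix) (x : V), enorm (x - ctr i) <= r -> elt i x)
  (elt_diam : forall (i : elt_ix) (x y : V), elt i x -> elt i y -> enorm (x - y) <= h).
Variables (wr : elt_ix -> affine R d) (eps : R).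
Hypothesis wr_common : forall (i j : elt_ix) (x : V), elt i x -> elt j x -> wr i x = wr j x.
Hypothesis shared : forall (i : elt_ix) (k : 'I_d.+1) (z : V) (b : 'I_d.+1),
  proper wr i -> elt i z -> 0 <= wr i z -> lam i k z = 0 ->
  (forall m, m != k -> 0 < lam i m z) -> b != k -> wr i (vtx i b) < 0 ->
  exists2 j, adjacent i j & forall x, elt i x -> lam i k x = 0 -> elt j x.
Hypothesis rclose : forall i j : elt_ix, proper wr i -> proper wr j -> touching i j ->
  enorm (rnorm wr i - rnorm wr j) <= eps.
Variables (i0 : elt_ix) (a : V).
Hypotheses (i0a : exists k, vtx i0 k = a) (wa : wr i0 a < 0).

(** Reachability through faces matters: because of gaps in the mesh, elements containing a need not
    all be connected through faces containing a. *)
Definition star j : bool :=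
  connect (fun i j => [&& adjacent i j, `[< elt i a >] & `[< elt j a >]]) i0 j.
Hypothesis star_proper : forall j, star j -> proper wr j.
Implicit Types (i j : elt_ix) (x y z p q u : V) (k l m : 'I_d.+1) (s t : R).
Local Notation n := (rnorm wr i0).

Lemma star0 : star i0. Proof. exact: connect0. Qed.

Lemma star_a j : star j -> elt j a.
Proof.
have [k ka] := i0a; have ia : elt i0 a by rewrite -ka; exact: elt_vtx bary _ _.
have cl : fingraph.closed (fun i j => [&& adjacent i j, `[< elt i a >] & `[< elt j a >]])
    [pred j : elt_ix | `[< elt j a >]].
  by move=> i1 i2 /and3P[_ h1 h2]; rewrite !inE h1 h2.
move=> /(closed_connect cl); rewrite !inE (asboolT ia) => /esym.
by move=> /asboolP.
Qed.

Lemma star_adj i j : star i -> adjacent i j -> elt j a -> star j.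
Proof.
move=> si ij ja; apply: (connect_trans si); apply: connect1.
by rewrite ij (asboolT ja) (asboolT (star_a si)).
Qed.

Lemma star_vtx j : star j -> exists k, vtx j k = a.
Proof.
move=> sj; have := star_a sj; have [k <-] := i0a.
exact: (vtx_of_elt bary conf).
Qed.

Lemma star_touching j : star j -> touching i0 j.
Proof. by move=> sj; apply/asboolP; exists a; split; [exact: (star_a star0)|exact: star_a]. Qed.

Lemma star_wa j : star j -> wr j a < 0.
Proof. by move=> sj; rewrite (wr_common (star_a sj) (star_a star0)). Qed.

Lemma star_rnorm j : star j -> enorm (rnorm wr j - n) <= eps.
Proof.
move=> sj; rewrite enormB; apply: rclose; [exact: star_proper star0|exact: star_proper|].
exact: star_touching.
Qed.

(** The tilt is measured relative to |grad (wr j)|, about whose size nothing is known. It follows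
    that rho^h is nondecreasing along every u with eps |u| <= dot n u, in all elements of the
    star. *)
Lemma star_grad j u : star j ->
  `|dot (grad (wr j)) u - enorm (grad (wr j)) * dot n u| <=
    enorm (grad (wr j)) * (eps * enorm u).
Proof.
move=> sj; have pj := star_proper sj.
rewrite (dot_rnorm _ pj) -mulrBr -dotBl normrM ger0_norm ?enorm_ge0//.
rewrite ler_wpM2l ?enorm_ge0//; apply: le_trans (norm_dot_le _ _) _.
by rewrite ler_wpM2r ?enorm_ge0// star_rnorm.
Qed.

(** Walks are confined to the part of the star with rho^h >= 0, because [shared] supplies a
    neighbour only there. *)
Definition good x : Prop := exists j, [/\ star j, elt j x & 0 <= wr j x].

Lemma closed_good : closed [set x | good x].
Proof.
rewrite (_ : [set x | _] = \bigcup_(j in [set j | star j]) (elt j `&` [set x | 0 <= wr j x])).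
  apply: closed_bigcup => [|j _]; first exact: finite_finset.
  by apply: closedI; [exact: (closed_simplex (bary j))|exact: closed_aff_ge0].
apply/seteqP; split=> x; first by move=> [j [sj jx wx]]; exists j.
by move=> [j sj [jx wx]]; exists j.
Qed.

Lemma vtx_pos_near j k x : vtx j k = a -> enorm (x - a) < r -> 0 < lam j k x.
Proof.
move=> ka xa; have L := bary_lipschitz (bary j) d_gt0 r_gt0
  (fun x hx => (eltP bary j x).1 (ball_elt hx)) k a x.
have : lam j k a = 1 by rewrite -ka (bary_vtx (bary j)) eqxx.
move: L; rewrite enormB => L E; rewrite E in L.
have : enorm (x - a) / (2 * r) < 1.
  by rewrite ltr_pdivrMr ?mulr_gt0// mul1r (lt_trans xa)// ltr_pMl// ltr1n.
by move: L; move: (enorm _ / _) (lam j k x) => A B; lra.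
Qed.

(** Together with membership in element j it says that z is interior or in the relative interior of
    a facet, the only places where the next element is determined. *)
Definition one_zero j z : Prop :=
  forall k m, k != m -> lam j k z = 0 -> lam j m z = 0 -> False.

Lemma stay_elt j z u :
  (forall m, 0 < lam j m z \/ forall s, 0 <= s -> 0 <= lam j m (z + s *: u)) ->
  exists2 de : R, 0 < de & forall s, 0 <= s -> s < de -> elt j (z + s *: u).
Proof.
move=> hm; pose f m := `|dot (grad (lam j m)) u| / lam j m z.
pose D := 1 + \sum_m `|f m|.
have D0 : 0 < D by rewrite ltr_pwDl// sumr_ge0.
exists D^-1; rewrite ?invr_gt0// => s s0 sD; apply/(eltP bary) => m.
have [lp|] := hm m; last exact.
have fD : f m < D.
  apply: le_lt_trans (ler_norm _) _; rewrite /D (bigD1 m)//= addrCA ltrDl.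
  by rewrite ltr_pwDl// sumr_ge0.
have : s * f m <= 1.
  have f0 : 0 <= f m by rewrite divr_ge0 ?normr_ge0// ltW.
  rewrite -[leRHS](mulVf (lt0r_neq0 D0)).
  exact: (ler_pM s0 f0 (ltW sD) (ltW fD)).
rewrite mulrA ler_pdivrMr// mul1r => H.
rewrite aff_line; have := ler_wpM2l s0 (ler_norm (- dot (grad (lam j m)) u)).
rewrite normrN mulrN; move: (s * dot _ _) (s * `|_|) (lam j m z) H => A B C; lra.
Qed.

(** If u leaves j through facet k, then a is on this facet: the coordinate of the vertex a is
    positive at distance less than r from a. So [shared] yields a neighbour across the facet that
    belongs to the star, and u points into it. *)
Lemma star_step j z u : star j -> elt j z -> 0 <= wr j z -> enorm (z - a) < r ->
  one_zero j z ->
  exists j' (de : R), [/\ star j', elt j' z, 0 < de &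
    forall s, 0 <= s -> s < de -> elt j' (z + s *: u)].
Proof.
move=> sj jz wz za oz; have ge0 := (eltP bary j z).1 jz.
have [[k [kz ku]]|no] := pselect (exists k, lam j k z = 0 /\ dot (grad (lam j k)) u < 0); last first.
  have [m|de de0 H] := @stay_elt j z u; last by exists j, de.
  have [lp|le0] := ltP 0 (lam j m z); first by left.
  have E : lam j m z = 0 by apply/eqP; rewrite eq_le le0 ge0.
  right=> s s0; rewrite aff_line E add0r mulr_ge0// leNgt.
  by apply/negP => hu; apply: no; exists m.
have pos m : m != k -> 0 < lam j m z.
  move=> mk; rewrite lt_neqAle ge0 andbT; apply/eqP => m0.
  by apply: (oz m k mk) => //; rewrite -m0.
have [c cE] := star_vtx sj.
have ck : c != k.
  by apply/eqP => e; have := vtx_pos_near cE za; rewrite e kz ltxx.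
have [j' jj' sub] : exists2 j', adjacent j j' & forall x, elt j x -> lam j k x = 0 -> elt j' x.
  apply: (shared (star_proper sj) jz wz kz pos ck).
  by rewrite cE; exact: star_wa.
have j'z : elt j' z by exact: sub.
have j'a : elt j' a.
  apply: sub; first exact: star_a.
  by rewrite -cE (bary_vtx (bary j)) eq_sym (negPf ck).
have [k' [l [H1 H2 [al al0 E]]]] := adjacentP d_gt0 bary conf jj'.
have k'k : k' = k.
  apply/eqP; apply: contraT => ne; have := pos _ ne.
  by rewrite ((H1 z jz).1 j'z) ltxx.
rewrite {k'}k'k in H1 E.
have lz x : lam j' l x = al^-1 * lam j k x by rewrite E mulKf// lt_eqF.
have ge0' := (eltP bary j' z).1 j'z.
have [m|de de0 H] := @stay_elt j' z u; last first.
  by exists j', de; split=> //; exact: star_adj sj jj' j'a.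
have [->|ml] := eqVneq m l.
  right=> s s0; rewrite lz aff_line kz add0r mulrCA mulr_ge0// mulr_le0//.
    by rewrite invr_le0 ltW.
  exact: ltW.
(* The vertex m of j' is a vertex p of j other than k. Expanding z in the vertices of j, the term of
   p is positive and the others are nonnegative at z. *)
left; have jm : elt j (vtx j' m).
  apply/(H2 _ (elt_vtx bary j' m)).
  by rewrite (bary_vtx (bary j')) eq_sym (negPf ml).
have [p pE] := vtx_of_elt bary conf jm.
have pk : p != k.
  apply/eqP => e; have : lam j k (vtx j' m) = 0.
    by apply/(H1 _ jm); exact: elt_vtx bary _ _.
  by rewrite -pE e (bary_vtx (bary j)) eqxx => /eqP; rewrite oner_eq0.
rewrite (aff_bary (bary j)) (bigD1 p)//= pE (bary_vtx (bary j')) eqxx mulr1.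
rewrite ltr_pwDl ?pos//; apply: sumr_ge0 => q qp.
have [->|qk] := eqVneq q k; first by rewrite kz mul0r.
rewrite mulr_ge0//; suff : elt j' (vtx j q) by move/(eltP bary); exact.
apply: sub; first exact: elt_vtx bary _ _.
by rewrite (bary_vtx (bary j)) eq_sym (negPf qk).
Qed.

Definition generic q : Prop := forall j k, lam j k q != 0.

(** The segment avoids the intersection of any two facet hyperplanes of one element, so it meets
    faces only in their relative interiors. *)
Definition generic_segment p q : Prop :=
  forall t j, 0 <= t <= 1 -> one_zero j (p + t *: (q - p)).

Lemma generic_near p (e : R) : 0 < e -> exists2 q, enorm (q - p) < e & generic q.
Proof.
move=> e0.
have [q qp hq] := exists_near_nonzero (fun jk : elt_ix * 'I_d.+1 => lam jk.1 jk.2) p e0.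
by exists q => // j k; apply: (hq (j, k)); exact: (grad_bary_neq0 (bary j)).
Qed.

(* A segment starting at p meets {lam j k = lam j m = 0} only if its other end
   lies in the hyperplane spanned by p and this set. *)
Lemma generic_next p q0 (e : R) : 0 < e -> generic p ->
  exists q, [/\ enorm (q - q0) < e, generic q & generic_segment p q].
Proof.
move=> e0 gp.
(* The entries [None] make q itself generic, so that it can be the start of a further segment. *)
pose W (jkm : elt_ix * 'I_d.+1 * option 'I_d.+1) : affine R d :=
  let: (j, k, m) := jkm in
  if m is Some m then
    Affine (lam j m p *: grad (lam j k) - lam j k p *: grad (lam j m))
      (lam j m p * Defs.cst (lam j k) - lam j k p * Defs.cst (lam j m))
  else lam j k.
have WE j k m x : W (j, k, Some m) x = lam j m p * lam j k x - lam j k p * lam j m x.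
  by rewrite /aff /= dotBl !dotZl /aff; ring.
have [q qp hq] := exists_near_nonzero W q0 e0.
exists q; split=> // [j k|t j /andP[t0 t1] k m km kz mz].
  by apply: (hq (j, k, None)); exact: (grad_bary_neq0 (bary j)).
have W0 : W (j, k, Some m) p = 0 by rewrite WE mulrC subrr.
have g0 : grad (W (j, k, Some m)) != 0.
  apply/eqP => g0; have := affB (W (j, k, Some m)) (vtx j k) p.
  rewrite g0 dot0l W0 subr0 WE !(bary_vtx (bary j)) eqxx eq_sym (negPf km).
  by rewrite mulr1 mulr0 subr0 => /eqP; rewrite (negPf (gp _ _)).
have := hq _ g0; have := aff_seg (W (j, k, Some m)) p q t.
rewrite W0 mulr0 add0r WE kz mz !mulr0 subrr => /esym/eqP.
rewrite mulf_eq0 => /orP[/eqP tz|->//] _.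
by move: kz; rewrite tz scale0r addr0 => /eqP; rewrite (negPf (gp _ _)).
Qed.

Lemma enorm_conv_lt u v t (m : R) : enorm u < m -> enorm v < m -> 0 <= t <= 1 ->
  enorm ((1 - t) *: u + t *: v) < m.
Proof.
move=> um vm /andP[t0 t1].
apply: le_lt_trans (enormD _ _) _; rewrite !enormZ !ger0_norm ?subr_ge0//.
have [m' mr [pm qm]] : exists2 m' : R, m' < m & enorm u <= m' /\ enorm v <= m'.
  exists (Num.max (enorm u) (enorm v)); first by rewrite gt_max um vm.
  by rewrite !le_max !lexx orbT.
apply: le_lt_trans mr; rewrite [leRHS](_ : m' = (1 - t) * m' + t * m'); last by ring.
by rewrite lerD// ler_wpM2l// subr_ge0.
Qed.

Lemma near_segment p q t : enorm (p - a) < r -> enorm (q - a) < r -> 0 <= t <= 1 ->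
  enorm (p + t *: (q - p) - a) < r.
Proof.
move=> pa qa t01; rewrite (_ : _ - a = (1 - t) *: (p - a) + t *: (q - a)).
  exact: enorm_conv_lt.
by apply/rowP => c; rewrite !mxE; ring.
Qed.

Lemma seg_shift p u s t : p + s *: u = p + t *: u + (s - t) *: u.
Proof. by rewrite -addrA -scalerDl (addrC t) subrK. Qed.

Lemma good_step p q t : generic_segment p q -> enorm (p - a) < r -> enorm (q - a) < r ->
  0 <= t < 1 -> good (p + t *: (q - p)) ->
  exists j (de : R), [/\ star j, 0 < de, 0 <= wr j (p + t *: (q - p)) &
    forall s, t <= s -> s < t + de -> elt j (p + s *: (q - p))].
Proof.
move=> gs pa qa /andP[t0 t1] [j [sj jx wx]].
have t01 : 0 <= t <= 1 by rewrite t0 ltW.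
have [j' [de [sj' jx' de0 H]]] :=
  star_step (q - p) sj jx wx (near_segment pa qa t01) (gs t j t01).
exists j', de; split=> // [|s ts sd]; first by rewrite -(wr_common jx jx').
by rewrite (seg_shift _ _ s t); apply: H; rewrite ?subr_ge0// ltrBlDl.
Qed.

(** In this cone of directions rho^h does not decrease, so it stays nonnegative and [star_step] can
    always be applied again. *)
Lemma walk_up p q : generic_segment p q -> enorm (p - a) < r -> enorm (q - a) < r ->
  eps * enorm (q - p) <= dot n (q - p) -> good p -> good q.
Proof.
move=> gs pa qa up gp; apply: (line_stay closed_good gp) => t t01 gt.
have [j [de [sj de0 wx H]]] := good_step gs pa qa t01 gt.
exists de => // s ts sd; exists j; split=> //; first exact: H.
rewrite (seg_shift _ _ s t) aff_line addr_ge0// mulr_ge0 ?subr_ge0//.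
have := star_grad (q - p) sj; rewrite ler_norml => /andP[+ _].
have := ler_wpM2l (enorm_ge0 (grad (wr j))) up.
by move: (dot (grad _) _) (_ * dot _ _) (_ * (eps * _)) => A B C; lra.
Qed.

(** As long as no zero is met rho^h is positive, hence still positive a little further on, and the
    walk cannot leave the star either. *)
Lemma walk_down p q : generic_segment p q -> enorm (p - a) < r -> enorm (q - a) < r ->
  good p -> good q \/ exists t j, [/\ 0 <= t <= 1, star j, elt j (p + t *: (q - p)) &
    wr j (p + t *: (q - p)) = 0].
Proof.
move=> gs pa qa gp; have [|no] := pselect (exists t j, [/\ 0 <= t <= 1, star j,
  elt j (p + t *: (q - p)) & wr j (p + t *: (q - p)) = 0]); first by right.
left; apply: (line_stay closed_good gp) => t t01 gt.
have [j [de [sj de0 wx H]]] := good_step gs pa qa t01 gt.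
have jt : elt j (p + t *: (q - p)) by apply: H; rewrite ?ltrDl.
have wp : 0 < wr j (p + t *: (q - p)).
  rewrite lt_neqAle wx andbT eq_sym; apply/eqP => w0; apply: no; exists t, j; split=> //.
  by case/andP: t01 => -> /ltW.
pose w := wr j (p + t *: (q - p)); pose g := `|dot (grad (wr j)) (q - p)|.
have g1 : 0 < g + 1 by rewrite ltr_wpDl ?ltr01 ?normr_ge0.
exists (Num.min de (w / (g + 1))) => [|s ts].
  by rewrite lt_min de0 divr_gt0.
rewrite -ltrBlDl lt_min => /andP[sd sw]; exists j; split=> //.
  by apply: H => //; rewrite -ltrBlDl.
rewrite (seg_shift _ _ s t) aff_line -/w; move: sw; rewrite ltr_pdivlMr// => sw.
have st : 0 <= s - t by rewrite subr_ge0.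
have := ler_wpM2l st (ler_norm (- dot (grad (wr j)) (q - p))); rewrite normrN -/g mulrN.
move: sw; rewrite mulrDr mulr1; move: (_ * dot _ _) (_ * g) => A B; lra.
Qed.

Lemma proper_vtx_pos j : proper wr j -> exists2 b, elt j b & 0 < wr j b.
Proof. by move=> /andP[_ /existsP[k hk]]; exists (vtx j k) => //; exact: elt_vtx bary _ _. Qed.

Lemma proper_vtx_neg j : proper wr j -> exists2 b, elt j b & wr j b < 0.
Proof. by move=> /andP[/existsP[k hk] _]; exists (vtx j k) => //; exact: elt_vtx bary _ _. Qed.

Lemma open_elt_aff j p (w : affine R d) : (forall k, 0 < lam j k p) -> 0 < w p ->
  exists2 e : R, 0 < e & forall y, enorm (y - p) < e ->
    (forall k, 0 < lam j k y) /\ 0 < w y.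
Proof.
move=> jp wp.
have h1 := pos_interior_simplex (bary j) jp.
have h2 : nbhs p (w @^-1` [set t : R | 0 < t]).
  by apply: (continuous_aff (w := w)); exact: lt_nbhsr.
have h3 : nbhs p (interior (elt j)).
  by apply: open_nbhs_nbhs; split; [exact: open_interior|exact: h1].
have [e e0 he] := (nbhs_enormP _ _).1 (filterI h3 h2).
exists e => // y /he[iy wy]; split=> // k.
exact: (interior_simplex_pos (bary j)).
Qed.

Lemma near_zero_pos j p b (w : affine R d) (e : R) : elt j p -> 0 <= w p -> elt j b -> 0 < w b ->
  0 < e -> exists q (e' : R), [/\ enorm (q - p) < e, 0 < e' & forall y, enorm (y - q) < e' ->
    (forall k, 0 < lam j k y) /\ 0 < w y].
Proof.
move=> jp wp jb wb e0; have D0 : 0 < enorm (b - p) + 1 by rewrite ltr_wpDl ?enorm_ge0.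
pose s := Num.min 1 (e / 2 / (enorm (b - p) + 1)).
have s0 : 0 < s by rewrite lt_min ltr01 !divr_gt0.
have s1 : s <= 1 by rewrite ge_min lexx.
pose q := p + s *: (b - p).
have jq : elt j q.
  apply/(eltP bary) => k; rewrite aff_seg addr_ge0// mulr_ge0 ?subr_ge0// ?(ltW s0)//.
    by move/(eltP bary): jp; exact.
  by move/(eltP bary): jb; exact.
have wq : 0 < w q.
  by rewrite aff_seg ltr_wpDl// ?mulr_gt0// mulr_ge0 ?subr_ge0.
have qp : enorm (q - p) < e / 2.
  rewrite /q addrAC subrr add0r enormZ gtr0_norm//.
  have : s * (enorm (b - p) + 1) <= e / 2 by rewrite -ler_pdivlMr// ge_min lexx orbT.
  by apply: lt_le_trans; rewrite ltr_pM2l// ltrDl.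
have h2 : nbhs q (w @^-1` [set t : R | 0 < t]).
  by apply: (continuous_aff (w := w)); exact: lt_nbhsr.
have [e1 e10 he1] := (nbhs_enormP _ _).1 h2.
have e2 : 0 < Num.min e1 (e / 2) by rewrite lt_min e10 divr_gt0.
have [z zp zq] := near_vtx_interior d_gt0 bary r_gt0 ball_elt jq e2.
move: zq; rewrite lt_min => /andP[z1 z2].
have [e' e'0 he'] := open_elt_aff zp (he1 z z1).
exists z, e'; split=> //; apply: le_lt_trans (enorm_dist q _ _) _.
by rewrite [ltRHS](splitr e) ltrD.
Qed.

Lemma near_zero_good j p (e : R) : star j -> elt j p -> wr j p = 0 -> 0 < e ->
  exists q (e' : R), [/\ enorm (q - p) < e, 0 < e' & forall y, enorm (y - q) < e' -> good y].
Proof.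
move=> sj jp wp e0; have [b jb wb] := proper_vtx_pos (star_proper sj).
have wp' : 0 <= wr j p by rewrite wp.
have [q [e' [qp e'0 H]]] := near_zero_pos jp wp' jb wb e0.
exists q, e'; split=> // y /H[ly wy]; exists j; split=> //; last exact: ltW.
by apply/(eltP bary) => k; exact: ltW.
Qed.

(** A point interior to j belongs to no other element, so no other element of the star can make it
    good. *)
Lemma near_zero_bad j p (e : R) : star j -> elt j p -> wr j p = 0 -> 0 < e ->
  exists q (e' : R), [/\ enorm (q - p) < e, 0 < e' & forall y, enorm (y - q) < e' -> ~ good y].
Proof.
move=> sj jp wp e0; have [b jb wb] := proper_vtx_neg (star_proper sj).
pose w : affine R d := Affine (- grad (wr j)) (- Defs.cst (wr j)).
have wE x : w x = - wr j x by rewrite /aff /= dotNl opprD.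
have wp' : 0 <= w p by rewrite wE wp oppr0.
have wb' : 0 < w b by rewrite wE oppr_gt0.
have [q [e' [qp e'0 H]]] := near_zero_pos jp wp' jb wb' e0.
exists q, e'; split=> // y /H[ly]; rewrite wE oppr_gt0 => wy [j' [sj' j'y w'y]].
have jj := elt_pos_uniq bary conf ly j'y.
by move: w'y; rewrite -jj leNgt wy.
Qed.

Lemma eps_ge0 : 0 <= eps.
Proof. exact: le_trans (enorm_ge0 _) (star_rnorm star0). Qed.

Lemma n_unit : enorm n = 1. Proof. exact: rnorm1 (star_proper star0). Qed.

(** Ends of walks must be moved to generic positions; the slack 2e on both sides of the cone
    condition pays for it. *)
Lemma perturbed_up p q p' q' (e : R) : enorm (p' - p) < e -> enorm (q' - q) < e ->
  eps * (enorm (q - p) + 2 * e) <= dot n (q - p) - 2 * e ->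
  eps * enorm (q' - p') <= dot n (q' - p').
Proof.
move=> pe qe up; pose u := (q' - q) - (p' - p).
have E : q' - p' = (q - p) + u by apply/rowP => c; rewrite !mxE; ring.
have ue : enorm u <= 2 * e.
  apply: le_trans (enormD _ _) _; rewrite enormN.
  by move: pe qe; move: (enorm (p' - p)) (enorm _) => A B; lra.
have := norm_dot_le n u; rewrite n_unit mul1r ler_norml => /andP[nu _].
rewrite E dotDr.
have : eps * enorm (q - p + u) <= eps * (enorm (q - p) + 2 * e).
  rewrite ler_wpM2l ?eps_ge0//; apply: le_trans (enormD _ _) _.
  by rewrite lerD2l.
by move: up nu ue; move: (eps * _) (eps * _) (dot n u) (dot n _) (enorm u) => A B C D F; lra.
Qed.

(* The zero set of rho^h near a is part of a Lipschitz graph over n^perp. *)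
Lemma zero_set_cone j1 j2 p q : star j1 -> star j2 -> elt j1 p -> elt j2 q ->
  wr j1 p = 0 -> wr j2 q = 0 -> enorm (p - a) < r -> enorm (q - a) < r ->
  dot n (q - p) <= eps * enorm (q - p).
Proof.
move=> s1 s2 jp jq wp wq pa qa; rewrite leNgt; apply/negP => hlt.
have D0 : 0 < 2 * (1 + eps) by rewrite mulr_gt0// ltr_pwDl// eps_ge0.
(* Small enough for the strict inequality to survive moving both ends by e, and for the ends to stay
   within r of a. The walk then leads up from a good point near p to a point near q that is not
   good. *)
pose e := Num.min ((dot n (q - p) - eps * enorm (q - p)) / (2 * (1 + eps)))
  (Num.min (r - enorm (p - a)) (r - enorm (q - a))).
have e0 : 0 < e by rewrite !lt_min divr_gt0 ?subr_gt0//= pa qa.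
have up : eps * (enorm (q - p) + 2 * e) <= dot n (q - p) - 2 * e.
  have : e * (2 * (1 + eps)) <= dot n (q - p) - eps * enorm (q - p).
    by rewrite -ler_pdivlMr// ge_min lexx.
  by rewrite mulrDr; move: (dot n _) (enorm _) => A B; lra.
have ep : e <= r - enorm (p - a) by rewrite !ge_min lexx orbT.
have eq : e <= r - enorm (q - a) by rewrite !ge_min lexx !orbT.
have e2 : 0 < e / 2 by rewrite divr_gt0.
have [p1 [e1 [p1p e10 G1]]] := near_zero_good s1 jp wp e2.
have [q1 [e3 [q1q e30 G3]]] := near_zero_bad s2 jq wq e2.
have m1 : 0 < Num.min e1 (e / 2) by rewrite lt_min e10.
have m3 : 0 < Num.min e3 (e / 2) by rewrite lt_min e30.
have [p2 p21 gp2] := generic_near p1 m1.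
have [q2 [q21 gq2 gs]] := generic_next q1 m3 gp2.
move: p21 q21; rewrite !lt_min => /andP[pa1 pb1] /andP[qa1 qb1].
have p2p : enorm (p2 - p) < e.
  by apply: le_lt_trans (enorm_dist p1 _ _) _; rewrite [e]splitr ltrD.
have q2q : enorm (q2 - q) < e.
  by apply: le_lt_trans (enorm_dist q1 _ _) _; rewrite [e]splitr ltrD.
apply: (G3 q2 qa1); apply: (walk_up gs).
- apply: le_lt_trans (enorm_dist p _ _) _.
  by rewrite -ltrBrDr (lt_le_trans p2p).
- apply: le_lt_trans (enorm_dist q _ _) _.
  by rewrite -ltrBrDr (lt_le_trans q2q).
- exact: perturbed_up p2p q2q up.
- exact: G1.
Qed.

(** Near z there are a good and a bad point. The good one can be joined upwards to x + H w. If the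
    walk down to x - H w met no zero, its end would be good, and walking up from there would make
    the bad point good. [hH] puts both ascents into the cone, although x and z may be up to 2D
    apart. *)
Lemma column_zero (w : V) (H D : R) z j0 x (e : R) : enorm w = 1 -> 0 < H ->
  eps * (H + 4 * D) <= H * dot n w - 4 * D -> H + 2 * D < r ->
  star j0 -> elt j0 z -> wr j0 z = 0 -> enorm (z - a) <= D -> enorm (x - a) <= D ->
  0 < e -> e <= D ->
  exists j y s, [/\ star j, elt j y, wr j y = 0 & enorm (y - (x + s *: w)) < e].
Proof.
move=> w1 H0 hH HD sj0 jz wz za xa e0 eD.
have e2 : 0 < e / 2 by rewrite divr_gt0.
have D0 : 0 <= D := le_trans (ltW e0) eD.
have [p1 [e1 [p1p e10 G1]]] := near_zero_good sj0 jz wz e2.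
have [q1 [e3 [q1q e30 G3]]] := near_zero_bad sj0 jz wz e2.
have m1 : 0 < Num.min e1 (e / 2) by rewrite lt_min e10.
have m3 : 0 < Num.min e3 (e / 2) by rewrite lt_min e30.
have [p2 p21 gp2] := generic_near p1 m1.
pose c1 := x + H *: w; pose c2 := x - H *: w.
have [u1 [u1c gu1 gs1]] := generic_next c1 e0 gp2.
have [u2 [u2c gu2 gs2]] := generic_next c2 e0 gu1.
have [q2 [q21 gq2 gs3]] := generic_next q1 m3 gu2.
move: p21 q21; rewrite !lt_min => /andP[pa1 pb1] /andP[qa1 qb1].
have p2p : enorm (p2 - z) < e.
  by apply: le_lt_trans (enorm_dist p1 _ _) _; rewrite [e]splitr ltrD.
have q2q : enorm (q2 - z) < e.
  by apply: le_lt_trans (enorm_dist q1 _ _) _; rewrite [e]splitr ltrD.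
have near_z y : enorm (y - z) < e -> enorm (y - a) < r.
  move=> yz; have := enorm_dist z y a; move: yz za; move: (enorm _) (enorm _) (enorm _) => A B C.
  by move: eD H0 HD D0; lra.
have Hw (s : R) : `|s| = H -> enorm (s *: w) = H by move=> sH; rewrite enormZ w1 mulr1.
have H0' : `|H| = H by rewrite gtr0_norm.
have HN : `|- H| = H by rewrite normrN.
have near_c (s : R) y : `|s| = H -> enorm (y - (x + s *: w)) < e -> enorm (y - a) < r.
  move=> sH yc; have := enorm_dist (x + s *: w) y a.
  have := enormD (x - a) (s *: w); rewrite Hw// addrAC.
  move: yc xa; move: (enorm _) (enorm (x - a)) (enorm (_ - a)) (enorm (y - a)) => A B C F.
  by move: eD H0 HD D0; lra.
have c2E : c2 = x + (- H) *: w by rewrite scaleNr.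
have upD (y y' : V) : enorm (y - a) <= D -> enorm (y' - a) <= D ->
    eps * (enorm (y + H *: w - y') + 2 * e) <= dot n (y + H *: w - y') - 2 * e.
  move=> ya y'a; have -> : y + H *: w - y' = H *: w + (y - y') by rewrite addrAC addrC.
  have yy : enorm (y - y') <= 2 * D.
    apply: le_trans (enorm_dist a _ _) _; rewrite (enormB a); move: ya y'a.
    by move: (enorm _) (enorm _) => A B; lra.
  have N : enorm (H *: w + (y - y')) <= H + 2 * D.
    by apply: le_trans (enormD _ _) _; rewrite Hw// lerD2l.
  have := norm_dot_le n (y - y'); rewrite n_unit mul1r ler_norml => /andP[nu _].
  rewrite dotDr dotZr.
  have : eps * (enorm (H *: w + (y - y')) + 2 * e) <= eps * (H + 4 * D).
    by rewrite ler_wpM2l ?eps_ge0//; move: N eD; move: (enorm _) => A; lra.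
  move: nu yy hH eD; move: (eps * _) (eps * _) (H * _) (dot n _) (enorm _) => A B C F G.
  by lra.
have up1 : good u1.
  apply: (walk_up gs1 (near_z _ p2p) (near_c H u1 H0' u1c)); last exact: G1.
  by apply: perturbed_up p2p u1c _; exact: upD.
have [up2|[t [j [t01 sj jy wy]]]] := walk_down gs2 (near_c H u1 H0' u1c)
  (near_c (- H) u2 HN (ltac:(by rewrite -c2E))) up1.
  exfalso; apply: (G3 q2 qa1); apply: (walk_up gs3 _ (near_z _ q2q) _ up2).
    by apply: (near_c (- H)); rewrite -?c2E.
  apply: perturbed_up u2c q2q _.
  by have -> : z - c2 = z + H *: w - x; [rewrite /c2 opprB addrA addrAC|exact: upD].
exists j, (u1 + t *: (u2 - u1)), (H - 2 * t * H); split=> //.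
rewrite (_ : _ - _ = (1 - t) *: (u1 - c1) + t *: (u2 - c2)).
  exact: enorm_conv_lt.
by apply/rowP => c; rewrite !mxE; ring.
Qed.

End Star.

(** * An element with a large part in Omega_h *)

Section GoodElement.
Variables (R : realType) (d : nat).
Local Notation V := 'rV[R]_d.
Variables (M : mesh R d).
Local Notation elt_ix := 'I_(nelt M).
Variables (lam : elt_ix -> 'I_d.+1 -> affine R d) (ctr : elt_ix -> V) (r h B : R).
Hypotheses (d_gt0 : (0 < d)%N) (bary : forall i, barycentric (@vtx _ _ M i) (lam i))
  (conf : conforming_mesh M) (r_gt0 : 0 < r)
  (ball_elt : forall (i : elt_ix) (x : V), enorm (x - ctr i) <= r -> elt i x)
  (elt_diam : forall (i : elt_ix) (x y : V), elt i x -> elt i y -> enorm (x - y) <= h).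
Hypotheses (B_ge1 : 1 <= B) (hB : h <= r * B).
Variables (rhoh : V -> R) (wr : elt_ix -> affine R d) (eps : R).
Hypothesis wrE : forall (i : elt_ix) (x : V), elt i x -> rhoh x = wr i x.
Hypothesis shared : forall (i : elt_ix) (k : 'I_d.+1) (z : V) (b : 'I_d.+1),
  proper wr i -> elt i z -> 0 <= wr i z -> lam i k z = 0 ->
  (forall m, m != k -> 0 < lam i m z) -> b != k -> wr i (vtx i b) < 0 ->
  exists2 j, adjacent i j & forall x, elt i x -> lam i k x = 0 -> elt j x.
Hypothesis rclose : forall i j : elt_ix, proper wr i -> proper wr j -> touching i j ->
  enorm (rnorm wr i - rnorm wr j) <= eps.
Hypothesis eps_le : eps * (8 * d%:R * B) <= 1.
Implicit Types (i j : elt_ix) (x y z p q u : V) (k l m : 'I_d.+1) (s t : R).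

Let dp : 0 < d%:R :> R. Proof. by rewrite ltr0n. Qed.
Let d1 : 1 <= d%:R :> R. Proof. by rewrite ler1n. Qed.
Let Bp : 0 < B. Proof. exact: lt_le_trans B_ge1. Qed.

Definition omega i : set V := elt i `&` Omega_h M rhoh.

Lemma omegaE i : omega i = elt i `&` [set x | wr i x < 0].
Proof.
apply/seteqP; split=> x [ix]; first by move=> [_]; rewrite (wrE ix).
by move=> /= wx; split=> //; split; [exact: elt_region ix|rewrite (wrE ix)].
Qed.

Lemma bounded_measurable_omega i : bounded_measurable (omega i).
Proof.
have be := bounded_measurable_simplex (bary i).
rewrite omegaE; apply: (bounded_measurableS be) => [|x []//].
by apply: measurable_tuple_setI; [exact: (proj1 be)|exact: measurable_aff_lt0].
Qed.

Lemma vol_omega_cube i c (l : R) : 0 <= l -> cube c l `<=` omega i ->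
  (2 * l) ^+ d <= vol (omega i).
Proof.
move=> l0 s; rewrite -(vol_cube c l0); apply: le_vol => //.
  exact: bounded_measurable_cube.
exact: bounded_measurable_omega.
Qed.

(** This is th r/d from [deep_point] with th = 1/(32 d B^2): then a relative depth r/(16dB) is twice
    the possible loss th r B. *)
Definition deep_size : R := r / (32 * d%:R ^+ 2 * B ^+ 2).

Definition deep_vol : R := (2 * deep_size) ^+ d.

Lemma deep_size_ge0 : 0 <= deep_size.
Proof. by rewrite divr_ge0 ?ltW// !mulr_gt0// exprn_gt0. Qed.

Lemma vol_deep i x : elt i x -> wr i x < 0 ->
  wr i x <= - (enorm (grad (wr i)) * (r / (16 * d%:R * B))) -> deep_vol <= vol (omega i).
Proof.
move=> ix w0 wx; pose th := (32 * d%:R * B ^+ 2)^-1.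
have D0 : 0 < 32 * d%:R * B ^+ 2 by rewrite !mulr_gt0// exprn_gt0.
have th0 : 0 < th by rewrite invr_gt0.
have th1 : th <= 1.
  rewrite invf_le1//; have : 1 <= d%:R * B ^+ 2.
    by rewrite mulr_ege1// expr_ge1// ltW.
  by rewrite -mulrA; move: (_ * _) => A; lra.
have dpt : wr i x + th * (enorm (grad (wr i)) * h) < 0.
  have g0 := enorm_ge0 (grad (wr i)).
  have E : r / (16 * d%:R * B) = 2 * (th * (r * B)).
    by rewrite /th; field; rewrite ?gt_eqF.
  have : th * (enorm (grad (wr i)) * h) <= enorm (grad (wr i)) * (th * (r * B)).
    by rewrite mulrCA ler_wpM2l// ler_wpM2l// ltW.
  have : 0 <= enorm (grad (wr i)) * (th * (r * B)).
    by rewrite mulr_ge0// mulr_ge0// ?(ltW th0)// mulr_ge0// ltW.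
  move: wx; rewrite E (mulrCA _ 2).
  by move: (enorm _ * (th * (r * B))) (th * (enorm _ * h)) (wr i x) w0 => A C F; lra.
have [c hc] := deep_point d_gt0 (fun x hx => (eltP bary i x).1 (ball_elt hx))
  ((eltP bary i x).1 ix)
  (fun y hy => elt_diam ((eltP bary i y).2 hy) ix) th0 th1 dpt.
have E : th * r / d%:R = deep_size by rewrite /th /deep_size; field; rewrite ?gt_eqF.
rewrite E in hc; apply: (vol_omega_cube (c := c) deep_size_ge0) => y /hc[ly wy].
by rewrite omegaE; split=> //; apply/(eltP bary).
Qed.

(** All vertex values are nonpositive and one is negative, so rho^h is negative in the whole
    interior, in particular on a cube inside the inscribed ball. *)
Lemma vol_nonproper i : ~~ proper wr i -> (exists k, wr i (vtx i k) < 0) ->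
  deep_vol <= vol (omega i).
Proof.
move=> np [k wk]; have le0 l : wr i (vtx i l) <= 0.
  rewrite leNgt; apply/negP => wl; move/negP: np; apply.
  by apply/andP; split; apply/existsP; [exists k|exists l].
apply: (vol_omega_cube (c := ctr i) deep_size_ge0) => y hy.
have yr : enorm (y - ctr i) < r.
  apply: le_lt_trans (enorm_le_coord (x := y - ctr i) (c := deep_size) _) _.
    by move=> l; rewrite !mxE; exact: hy.
  have -> : d%:R * deep_size = r / (32 * d%:R * B ^+ 2).
    by rewrite /deep_size; field; rewrite ?gt_eqF.
  rewrite ltr_pdivrMr ?mulr_gt0 ?exprn_gt0// ltr_pMr//.
  have : 1 <= d%:R * B ^+ 2 by rewrite mulr_ege1// expr_ge1// ltW.
  by rewrite -mulrA; move: (_ * _) => A; lra.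
have yi : interior (elt i) y.
  apply/nbhs_enormP; exists (r - enorm (y - ctr i)); rewrite ?subr_gt0// => z zy.
  apply: ball_elt; apply: le_trans (enorm_dist y _ _) _.
  by rewrite -lerBrDr ltW.
have yp m : 0 < lam i m y by exact: (interior_simplex_pos (bary i)).
rewrite omegaE; split; first by apply/(eltP bary) => m; exact: ltW.
rewrite /= (aff_bary (bary i)) (bigD1 k)//=.
rewrite -[ltRHS](addr0 0); apply: ltr_leD; first by rewrite pmulr_rlt0.
by apply: sumr_le0 => l _; rewrite pmulr_rle0.
Qed.

Lemma wr_common i j x : elt i x -> elt j x -> wr i x = wr j x.
Proof. by move=> ix jx; rewrite -(wrE ix) (wrE jx). Qed.

Definition face_omega (e : elt_ix * elt_ix) : set 'rV[R]_d.-1 := face_set e (face e `&` Omega_h M rhoh).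

Lemma face_omegaE e i : e.1 = i \/ e.2 = i ->
  face_omega e = face_set e (face e) `&` [set s | face_aff e (wr i) s < 0].
Proof.
move=> ei; have ie x : face e x -> elt i x by case: ei => <- [].
apply/seteqP; split=> s; rewrite /face_omega /face_set /= face_affE.
  by move=> [fx [_ wx]]; split=> //; rewrite -(wrE (ie _ fx)).
move=> [fx wx]; split=> //; split; first exact: elt_region (ie _ fx).
by rewrite (wrE (ie _ fx)).
Qed.

Lemma bounded_measurable_face_omega e : is_face e -> bounded_measurable (face_omega e).
Proof.
move=> fe; have bf := bounded_measurable_face d_gt0 bary conf r_gt0 ball_elt elt_diam fe.
rewrite (face_omegaE (or_introl erefl)); apply: (bounded_measurableS bf) => [|s []//].
by apply: measurable_tuple_setI; [exact: (proj1 bf)|exact: measurable_aff_lt0].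
Qed.

Lemma vol_face_omega e : is_face e -> 0 <= h -> vol (face_omega e) <= (2 * h) ^+ d.-1.
Proof.
move=> fe h0; rewrite -(vol_cube 0 h0).
apply: le_vol; [exact: bounded_measurable_face_omega|exact: bounded_measurable_cube|].
move=> s [fs _]; exact: (face_set_sub_cube d_gt0 bary conf r_gt0 ball_elt elt_diam fe).
Qed.

(** A bound for the number of sign conditions in [star_cover]: d+1 coordinates for each element
    touching [i0]. *)
Definition cover_count : nat := (touch_bound d B * d.+1)%N.

(** The first summand compares (2 r B)^d with [deep_vol]. The second one is the constant of the face
    slab times the inverse of that of the cone in [vol_star_slab]. *)
Definition good_const : R := (32 * d%:R ^+ 2 * B ^+ 3) ^+ d +
  4 * d%:R * B * (2 * B) ^+ d * (16 * d%:R ^+ 2 * 3 ^+ cover_count) ^+ d.-1 *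
    (128 * B * 3 ^+ cover_count).

Let h2B : 2 * h <= r * (2 * B).
Proof. by rewrite (mulrCA r) ler_pM2l. Qed.

Lemma face_bound_deep e j : is_face e -> 0 <= h -> deep_vol <= vol (omega j) ->
  h * vol (face_omega e) <= good_const * vol (omega j).
Proof.
move=> fe h_ge0 dj; have v0 := vol_ge0 (omega j).
apply: (@le_trans _ _ ((32 * d%:R ^+ 2 * B ^+ 3) ^+ d * vol (omega j))); last first.
  rewrite ler_wpM2r// lerDl !mulr_ge0 ?exprn_ge0 ?mulr_ge0 ?exprn_ge0//; exact: ltW.
apply: (@le_trans _ _ ((r * (2 * B)) ^+ d)).
  apply: (@le_trans _ _ ((2 * h) ^+ d)).
    rewrite -{2}(prednK d_gt0) exprS ler_pM ?vol_ge0 ?vol_face_omega//.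
    by rewrite ler_peMl// ler1n.
  by rewrite lerXn2r ?nnegrE ?mulr_ge0 ?(ltW Bp) ?(ltW r_gt0).
have -> : (r * (2 * B)) ^+ d = (32 * d%:R ^+ 2 * B ^+ 3) ^+ d * deep_vol.
  rewrite /deep_vol -exprMn; congr (_ ^+ _); rewrite /deep_size; field.
  by rewrite !gt_eqF.
rewrite ler_wpM2l// exprn_ge0// !mulr_ge0 ?exprn_ge0//; exact: ltW.
Qed.

(** * The case in which every element of the star is cut *)

Section AtVertex.
Variables (i0 : elt_ix) (a : V).
Hypotheses (i0a : exists k, vtx i0 k = a) (wa : wr i0 a < 0).
Hypothesis star_pr : forall j, star i0 a j -> proper wr j.
Local Notation n := (rnorm wr i0).
Local Notation star := (star i0 a).

Let stara j (sj : star j) : elt j a := star_a bary i0a sj.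
Let starg j u (sj : star j) := star_grad bary rclose i0a star_pr u sj.
Let starwa j (sj : star j) : wr j a < 0 := star_wa bary wr_common i0a wa sj.
Let nu1 : enorm n = 1 := n_unit star_pr.

Let eps1 : eps * (4 * d%:R) <= 1.
Proof.
apply: le_trans eps_le; rewrite ler_wpM2l//.
  exact: (eps_ge0 bary rclose i0a star_pr).
by rewrite -mulrA ler_pM// ?ler_nat//; rewrite ler_peMr.
Qed.

Let eps2 : eps * (8 * B) <= 1.
Proof.
apply: le_trans eps_le; rewrite ler_wpM2l//.
  exact: (eps_ge0 bary rclose i0a star_pr).
by apply: ler_wpM2r; [exact: ltW|rewrite ler_peMr].
Qed.

Let eps_h : eps * h <= r / 8.
Proof.
have e0 := eps_ge0 bary rclose i0a star_pr.
apply: le_trans (ler_wpM2l e0 hB) _; rewrite ler_pdivlMr//.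
have -> : eps * (r * B) * 8 = r * (eps * (8 * B)) by ring.
by rewrite ler_piMr// ltW.
Qed.

Let half_deep (w : affine R d) :
  enorm (grad w) * (r / (16 * d%:R * B)) <= enorm (grad w) * (r / 2).
Proof.
rewrite ler_wpM2l ?enorm_ge0// ler_pM2l// lef_pV2 ?posrE ?mulr_gt0//.
by rewrite -mulrA; have : 1 <= d%:R * B := mulr_ege1 d1 B_ge1; move: (_ * _) => A; lra.
Qed.

(** Moving r downwards lowers rho^h by at least |grad (wr j)| r/2, because the tilt of the normal
    costs only eps h <= r/8, and rho^h is already negative at a. *)
Lemma star_drop j x : star j -> elt j x -> dot n (x - a) <= - r ->
  deep_vol <= vol (omega j).
Proof.
move=> sj jx down; have := starg (x - a) sj; rewrite ler_norml -affB => /andP[_ up].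
have g0 := enorm_ge0 (grad (wr j)); have wj := starwa sj.
have xa : eps * enorm (x - a) <= r / 8.
  apply: le_trans eps_h; rewrite ler_wpM2l//; last exact: elt_diam (stara sj).
  exact: (eps_ge0 bary rclose i0a star_pr).
have D : wr j x <= wr j a - enorm (grad (wr j)) * (r / 2).
  have := ler_wpM2l g0 xa; have := ler_wpM2l g0 down; move: up.
  have : 0 <= enorm (grad (wr j)) * r by rewrite mulr_ge0// ltW.
  rewrite mulrN !mulrA; move: (enorm _ * r) (enorm _ * dot _ _) (enorm _ * eps * _)  => A C F.
  by move: (wr j x) (wr j a) => G H; lra.
have gr : 0 <= enorm (grad (wr j)) * (r / 2) by rewrite mulr_ge0// divr_ge0// ltW.
apply: (vol_deep jx).
  by move: D gr wj; move: (_ * _) (wr j x) (wr j a) => A C F; lra.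
have := half_deep (wr j); move: D wj.
by move: (enorm _ * (r / (16 * _ * _))) (enorm _ * (r / 2)) (wr j x) (wr j a) => A C F G; lra.
Qed.

(** Mirror image of [star_drop]: a point r above a with nonpositive value makes a itself deep. *)
Lemma star_up_neg j x : star j -> elt j x -> r <= dot n (x - a) -> wr j x <= 0 ->
  deep_vol <= vol (omega j).
Proof.
move=> sj jx up wx; have := starg (x - a) sj; rewrite ler_norml -affB => /andP[lo _].
have g0 := enorm_ge0 (grad (wr j)); have wj := starwa sj.
have xa : eps * enorm (x - a) <= r / 8.
  apply: le_trans eps_h; rewrite ler_wpM2l//; last exact: elt_diam (stara sj).
  exact: (eps_ge0 bary rclose i0a star_pr).
apply: (vol_deep (stara sj)) => //.
have D : wr j a <= - (enorm (grad (wr j)) * (r / 2)).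
  have := ler_wpM2l g0 xa; have := ler_wpM2l g0 up; move: lo wx.
  have : 0 <= enorm (grad (wr j)) * r by rewrite mulr_ge0// ltW.
  rewrite !mulrA; move: (enorm _ * r) (enorm _ * dot _ _) (enorm _ * eps * _)  => A C F.
  by move: (wr j x) (wr j a) => G H; lra.
by apply: le_trans D _; rewrite lerN2 half_deep.
Qed.

Local Notation D := (r / (16 * d%:R)).

Let Dp : 0 < D. Proof. by rewrite divr_gt0// mulr_gt0. Qed.

Definition cover_size : R := D / d%:R / 3 ^+ cover_count.

Lemma cover_size_gt0 : 0 < cover_size.
Proof. by apply: divr_gt0; [exact: divr_gt0|rewrite exprn_gt0]. Qed.

Lemma cover_size_le : cover_size <= D.
Proof.
rewrite /cover_size -mulrA ler_piMr ?(ltW Dp)// -invfM invf_le1 ?mulr_gt0 ?exprn_gt0//.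
by rewrite mulr_ege1// exprn_ege1// ler1n.
Qed.

Let DE : D = r / d%:R / 16. Proof. by field; rewrite gt_eqF. Qed.

Let column_room : r / 2 + 2 * D < r.
Proof.
have Xr : r / d%:R <= r by rewrite ler_pdivrMr// ler_peMr// ltW.
by rewrite DE; move: (r / d%:R) Xr => X; have := r_gt0; lra.
Qed.

(** The column of half length H = r/2 rises by r/(2d) along n. The term 4D = r/(4d) takes half of
    this, and eps r is at most the other half. *)
Let column_slope (w : V) : d%:R^-1 <= dot n w ->
  eps * (r / 2 + 4 * D) <= r / 2 * dot n w - 4 * D.
Proof.
move=> nw; have eps0 := eps_ge0 bary rclose i0a star_pr.
have X0 : 0 <= r / d%:R by rewrite divr_ge0// ltW.
have Xr : r / d%:R <= r by rewrite ler_pdivrMr// ler_peMr// ltW.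
have h1 : eps * r <= r / d%:R / 4.
  rewrite -mulrA -invfM ler_pdivlMr ?mulr_gt0// mulrAC.
  by rewrite ler_piMl ?(ltW r_gt0)// (mulrC d%:R).
have h2 : r / 2 * d%:R^-1 <= r / 2 * dot n w by rewrite ler_wpM2l// divr_ge0// ltW.
rewrite [leLHS]mulrAC in h2.
have h3 : eps * (r / 2 + 4 * D) <= eps * r.
  by apply: ler_wpM2l; [exact: eps0|rewrite DE; move: (r / d%:R) X0 Xr => X; lra].
move: h1 h2 h3; move: (eps * (r / 2 + 4 * D)) => A; rewrite DE.
by move: (eps * r) (r / 2 * dot n w) (r / d%:R) X0 => C F G; lra.
Qed.

(** Columns run along the coordinate axis k on which n is largest, so |n k| >= 1/d and every [wr j]
    in the star is strictly monotone along them. On a cube where all W below have constant sign, the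
    element that contains one zero over the cube contains all zeros over it. [column_zero] provides
    this one zero. *)
Lemma star_cover z : elt i0 z -> wr i0 z = 0 -> enorm (z - a) <= D ->
  exists j c (k : 'I_d), [/\ star j, cube c cover_size `<=` cube a (D / d%:R),
    grad (wr j) 0 k != 0 &
    forall x, (forall i : 'I_d, i != k -> `|x 0 i - c 0 i| <= cover_size) -> wr j x = 0 -> elt j x].
Proof.
move=> iz wz za.
have [k hk] := dot_max_coord n d_gt0.
pose sg : R := Num.sg (n 0 k); pose w : V := sg *: delta_mx 0 k.
have nk0 : n 0 k != 0.
  by apply/eqP => e; move: hk; rewrite e normr0 mulr0 nu1 ler10.
have sg1 : `|sg| = 1 by rewrite normr_sg nk0.
have wi (i : 'I_d) : w 0 i = sg * (i == k)%:R by rewrite !mxE eqxx.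
have dw (x : V) : dot x w = x 0 k * sg.
  rewrite /dot (bigD1 k)//= wi eqxx mulr1 big1 ?addr0// => i ik.
  by rewrite wi (negPf ik) !mulr0.
have w1 : enorm w = 1.
  rewrite /enorm dw wi eqxx mulr1 -expr2 sqrtr_sqr; exact: sg1.
have nw : d%:R^-1 <= dot n w.
  by rewrite dw mulrC -normrEsg -(ler_pM2l dp) mulfV ?gt_eqF//; move: hk; rewrite nu1.
have eps0 := eps_ge0 bary rclose i0a star_pr.
have gw j : star j -> dot (grad (wr j)) w != 0.
  move=> sj; have := starg w sj; rewrite w1 mulr1 ler_norml => /andP[lo _].
  have g0 := proper_grad (star_pr sj).
  have : 0 < enorm (grad (wr j)) * (dot n w - eps).
    rewrite mulr_gt0// subr_gt0; apply: lt_le_trans nw.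
    rewrite -[ltRHS]mul1r ltr_pdivlMr//; have e0 := mulr_ge0 eps0 (ltW dp).
    by move: eps1 e0; rewrite mulrCA; move: (eps * _) => A; lra.
  rewrite mulrBr => hp; rewrite gt_eqF//.
  by move: lo hp; move: (dot _ w) (_ * dot _ _) (_ * eps) => A C F; lra.
pose T := {j : elt_ix | touching i0 j}.
(* The multiple of f is chosen to make W constant along w; on the zero plane of f it still equals
   the barycentric coordinate g. Membership of a zero in element j is thus a sign condition in the
   other coordinates alone. *)
pose W (jm : T * 'I_d.+1) : affine R d :=
  let f := wr (sval jm.1) in let g := lam (sval jm.1) jm.2 in
  Affine (grad g - (dot (grad g) w / dot (grad f) w) *: grad f)
    (Defs.cst g - (dot (grad g) w / dot (grad f) w) * Defs.cst f).
have WE (j : T) m x : W (j, m) x = lam (sval j) m x -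
    dot (grad (lam (sval j) m)) w / dot (grad (wr (sval j))) w * wr (sval j) x.
  by rewrite /aff /= dotBl dotZl /aff; ring.
have Ww (j : T) m x y : star (sval j) -> (forall i : 'I_d, i != k -> x 0 i = y 0 i) -> W (j, m) x = W (j, m) y.
  move=> sj xy; have -> : x = y + ((x 0 k - y 0 k) * sg) *: w.
    apply/rowP => i; rewrite !mxE eqxx; have [->|/xy ->] := eqVneq i k.
      have sg2 : sg * sg = 1 by rewrite -expr2 sqr_sg nk0.
      by rewrite mulr1 -mulrA sg2; ring.
    by rewrite !mulr0 addr0.
  rewrite aff_line [dot _ w](_ : _ = 0) ?mulr0 ?addr0//.
  by rewrite /= dotBl dotZl divfK ?subrr// gw.
have l0 : 0 < D / d%:R by rewrite divr_gt0.
have [c hc hW] := exists_subcube_sign W a l0.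
have cs : cover_size <= D / d%:R / 3 ^+ #|{: T * 'I_d.+1}|.
  rewrite ler_pM2l// lef_pV2 ?posrE ?exprn_gt0// ler_eXn2l ?ltr1n//.
  rewrite card_prod card_ord leq_mul2r/= card_sig.
  exact: (card_touching d_gt0 bary conf r_gt0 ball_elt elt_diam _ hB).
have sub (x : V) : cube c cover_size x -> cube c (D / d%:R / 3 ^+ #|{: T * 'I_d.+1}|) x.
  by move=> hx i; apply: le_trans (hx i) cs.
have ca : enorm (c - a) <= D.
  apply: le_trans (enorm_le_coord (x := c - a) (c := D / d%:R) _) _.
    by move=> i; rewrite !mxE; apply: hc; apply: sub; apply: cube_center; exact: ltW cover_size_gt0.
  by rewrite mulrC divfK ?gt_eqF.
have H0 : 0 < r / 2 by rewrite divr_gt0.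
have up : eps * (r / 2 + 4 * D) <= r / 2 * dot n w - 4 * D := column_slope nw.
have [j [y [s [sj jy wy yx]]]] := column_zero d_gt0 bary conf r_gt0 ball_elt wr_common shared
  rclose i0a wa star_pr w1 H0 up column_room (star0 _ _) iz wz za ca cover_size_gt0 cover_size_le.
exists j, c, k; split=> [//|x hx||x hx wx].
- exact: hc (sub _ hx).
- apply: contra (gw j sj) => /eqP g0.
  by rewrite dw g0 mul0r.
pose j' : T := exist _ j (star_touching bary i0a sj).
(* Resets coordinate k to that of the centre: W does not see this coordinate, but its sign is known
   only inside the cube. *)
pose fix_k (p : V) : V := \row_i if i == k then c 0 i else p 0 i.
have fixP p : (forall i : 'I_d, i != k -> `|p 0 i - c 0 i| <= cover_size) -> cube c cover_size (fix_k p).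
  move=> hp i; rewrite mxE; case: eqVneq => [->|/hp//].
  by rewrite subrr normr0 ltW// cover_size_gt0.
have fixW p m : W (j', m) (fix_k p) = W (j', m) p.
  by apply: Ww => // i ik; rewrite mxE (negPf ik).
have hy (i : 'I_d) : i != k -> `|y 0 i - c 0 i| <= cover_size.
  move=> ik; apply: le_trans (ltW yx); apply: le_trans (coord_le_enorm _ i).
  by rewrite !mxE eqxx (negPf ik) !mulr0 addr0.
apply/(eltP bary) => m; have [[pos|neg] _] := hW (j', m).
  have := pos _ (sub _ (fixP x hx)).
  by rewrite fixW WE wx mulr0 subr0.
have := neg _ (sub _ (fixP y hy)).
by rewrite fixW WE wy mulr0 subr0 ltNge ((eltP bary j y).1 jy).
Qed.

(** Element j contains the cone with apex a over the covered piece of the zero plane. Instead of the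
    cone a slab close to that plane is measured: it is a prism over half the cube, and projecting it
    from a onto the zero plane stays over the whole cube. *)
Lemma vol_star_slab j c (k : 'I_d) : star j -> cube c cover_size `<=` cube a (D / d%:R) ->
  grad (wr j) 0 k != 0 ->
  (forall x, (forall i : 'I_d, i != k -> `|x 0 i - c 0 i| <= cover_size) -> wr j x = 0 -> elt j x) ->
  cover_size ^+ d.-1 / (16 * 3 ^+ cover_count) * (- wr j a / enorm (grad (wr j))) <=
    vol (omega j).
Proof.
move=> sj ca gk cov; have wj := starwa sj; have g0 := proper_grad (star_pr sj).
pose l0 := D / d%:R; pose l := cover_size.
have l0p : 0 < l0 by rewrite divr_gt0.
have lp : 0 < l := cover_size_gt0.
(* With l = 8 l0 eta the projection from a moves the other coordinates by at most 2 eta times 2 l0,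
   that is l/2. *)
pose eta := (8 * 3 ^+ cover_count)^-1 : R.
have P3 : 1 <= 3 ^+ cover_count :> R by rewrite exprn_ege1// ler1n.
have lE : l = 8 * l0 * eta.
  rewrite /l /cover_size /eta -/l0; move: (3 ^+ _ : R) P3 => X X1.
  by field; rewrite gt_eqF// (lt_le_trans _ X1).
have e0 : 0 < eta by rewrite invr_gt0 mulr_gt0 ?exprn_gt0.
have e1 : eta <= 8^-1.
  by rewrite lef_pV2 ?posrE ?mulr_gt0 ?exprn_gt0// ler_peMr.
have ll0 : l <= l0.
  rewrite lE (mulrC 8) -mulrA ler_piMr ?(ltW l0p)//.
  by rewrite mulrC -ler_pdivlMr// mul1r.
pose lo := eta * wr j a - Defs.cst (wr j); pose hi := eta / 2 * wr j a - Defs.cst (wr j).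
have lohi : lo <= hi.
  rewrite lerD2r -mulrA ler_pM2l//; move: wj; lra.
have l2 : 0 <= l / 2 by rewrite divr_ge0// ltW.
have vE := vol_slab c gk l2 lohi.
apply: (@le_trans _ _ (vol (slab (grad (wr j)) c k (l / 2) lo hi))).
  rewrite vE (mulrC 2) divfK// -/l -mulrA ler_wpM2l ?exprn_ge0 ?(ltW lp)//.
  have -> : hi - lo = (16 * 3 ^+ cover_count)^-1 * - wr j a.
    by rewrite /hi /lo /eta; move: (3 ^+ _ : R) P3 => X X1; field; rewrite gt_eqF// (lt_le_trans _ X1).
  rewrite -mulrA ler_wpM2l ?invr_ge0 ?mulr_ge0 ?exprn_ge0//.
  rewrite ler_wpM2l ?oppr_ge0 ?(ltW wj)//.
  by rewrite lef_pV2 ?posrE ?normr_gt0// coord_le_enorm.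
apply: le_vol; [exact: bounded_measurable_slab|exact: bounded_measurable_omega|].
move=> x [hx /andP[xlo xhi]].
have wxE : wr j x = dot (grad (wr j)) x + Defs.cst (wr j) by [].
have wlo : eta * wr j a < wr j x by rewrite wxE -ltrBlDr.
have whi : wr j x <= eta / 2 * wr j a by rewrite wxE -lerBrDr.
rewrite omegaE; split; last first.
  by apply: le_lt_trans whi _; rewrite pmulr_rlt0// divr_gt0.
pose t := wr j x / wr j a.
have twa : wr j x = t * wr j a by rewrite divfK// lt_eqF.
have te : t < eta by rewrite ltr_ndivrMr.
have t0 : 0 < t by rewrite ltr_ndivlMr// mul0r (le_lt_trans whi)// pmulr_rlt0// divr_gt0.
have t1 : t < 1 by apply: lt_le_trans te _; apply: le_trans e1 _; lra.
have t1' : 1 - t != 0 by rewrite subr_eq0 eq_sym lt_eqF.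
pose y := a + (1 - t)^-1 *: (x - a).
have wy : wr j y = 0.
  by rewrite aff_line -affB twa; field.
have jy : elt j y.
  apply: cov => // i ik; rewrite !mxE.
  have hxi := hx i ik.
  have hca : `|c 0 i - a 0 i| <= l0.
    by have := ca c (cube_center c (ltW lp)) i.
  have -> : a 0 i + (1 - t)^-1 * (x 0 i - a 0 i) - c 0 i =
      (x 0 i - c 0 i) + (t / (1 - t)) * (x 0 i - a 0 i) by field.
  apply: le_trans (ler_normD _ _) _; rewrite normrM [`|t / _|]gtr0_norm; last first.
    by rewrite divr_gt0// subr_gt0.
  have hxa : `|x 0 i - a 0 i| <= 2 * l0.
    rewrite -(subrKA (c 0 i)); apply: le_trans (ler_normD _ _) _.
    have ar (A C F G : R) : A <= F / 2 -> C <= G -> F <= G -> 0 < G -> A + C <= 2 * G by lra.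
    exact: ar hxi hca ll0 l0p.
  have ht : t / (1 - t) <= 2 * eta.
    rewrite ler_pdivrMr ?subr_gt0//.
    have : eta * t <= eta * 8^-1 by rewrite ler_pM2l// (le_trans (ltW te)).
    have ar (A F G : R) : A <= G * 8^-1 -> 0 < G -> F < G -> F <= 2 * G - 2 * A by lra.
    by rewrite mulrBr mulr1 -mulrA => et; exact: ar et e0 te.
  have : t / (1 - t) * `|x 0 i - a 0 i| <= (2 * eta) * (2 * l0).
    by rewrite ler_pM// ltW// divr_gt0// subr_gt0.
  move: hxi; rewrite -/l lE -(mulrA 8) mulrACA (mulrC eta).
  have ar (A C F : R) : F <= 8 * C / 2 -> A <= 2 * 2 * C -> F + A <= 8 * C by lra.
  exact: ar.
have -> : x = a + (1 - t) *: (y - a).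
  by rewrite /y addrAC subrr add0r scalerA mulfV// scale1r addrC subrK.
apply/(eltP bary) => m; rewrite aff_seg addr_ge0// mulr_ge0//.
- by rewrite opprB addrC subrK ltW.
- by move/(eltP bary): (stara sj); exact.
- by rewrite subr_ge0 ltW.
- by move/(eltP bary): jy; exact.
Qed.

(** Transfers the depth of a from i0 to j without comparing gradients. If j has a vertex v far above
    a with positive value, rho^h vanishes at a fraction s of the way from a to v. A fraction s much
    smaller than t would put the zero on the segment from a to b steeply above this one, against
    [zero_set_cone]. *)
Lemma star_depth j b t : star j -> elt i0 b -> r <= dot n (b - a) -> 0 < t -> t * h <= D ->
  wr i0 (a + t *: (b - a)) = 0 ->
  deep_vol <= vol (omega j) \/ t * (r / (8 * B)) <= - wr j a / enorm (grad (wr j)).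
Proof.
move=> sj ib nb t0 th wz; have wj := starwa sj; have g0 := proper_grad (star_pr sj).
have ia := stara (star0 _ _); have hr : D < r.
  by rewrite gtr_pMr// invf_lt1 ?mulr_gt0//; move: d1; move: (d%:R : R) => X; lra.
have [k] := exists_far_vtx (bary j) r_gt0 (fun x hx => (eltP bary j x).1 (ball_elt hx)) a nu1.
pose v := vtx j k; have jv : elt j v := elt_vtx bary j k.
rewrite -/v => -[up|down]; last by left; exact: (star_drop sj jv).
have [wv|wv] := leP (wr j v) 0; first by left; exact: (star_up_neg sj jv).
right; have w0 : 0 < wr j v - wr j a by rewrite subr_gt0 (lt_trans wj).
pose s := - wr j a / (wr j v - wr j a).
have s0 : 0 < s by rewrite divr_gt0// oppr_gt0.
have s1 : s <= 1 by rewrite ler_pdivrMr// mul1r lerDr ltW.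
have grow : enorm (grad (wr j)) * (r / 2) <= wr j v - wr j a.
  have := starg (v - a) sj; rewrite ler_norml -affB => /andP[lo _].
  have va : eps * enorm (v - a) <= r / 8.
    apply: le_trans eps_h; rewrite ler_wpM2l//; last exact: elt_diam (stara sj).
    exact: (eps_ge0 bary rclose i0a star_pr).
  have h1 := ler_wpM2l (ltW g0) va; have h2 := ler_wpM2l (ltW g0) up.
  have h3 : 0 <= enorm (grad (wr j)) * r by rewrite mulr_ge0// ltW.
  move: lo h1 h2 h3; rewrite (mulrA _ r) (mulrA _ r).
  move: (enorm _ * r) (enorm _ * dot _ _) (enorm _ * (eps * _)) (wr j v - wr j a) => A C F G; lra.
(* If s < t/(4B), the point p rises at most s h <= t r/4, while q rises at least t r; the tilt
   allows only t r/4. *)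
have ts : t / (4 * B) <= s.
  rewrite leNgt; apply/negP => st.
  have B4 : 0 < 4 * B by rewrite mulr_gt0.
  pose p := a + s *: (v - a); pose q := a + t *: (b - a).
  have wp : wr j p = 0 by rewrite aff_line -affB /s; field; rewrite gt_eqF.
  have jp : elt j p.
    apply/(eltP bary) => m; rewrite aff_seg addr_ge0// mulr_ge0 ?subr_ge0//.
    - by move/(eltP bary): (stara sj); exact.
    - exact: ltW.
    - by move/(eltP bary): jv; exact.
  have h0 : 0 <= h := le_trans (enorm_ge0 _) (elt_diam ib ia).
  have tt1 : t <= 1.
    have rh : r <= h.
      apply: le_trans nb _; apply: le_trans (ler_norm _) _; apply: le_trans (norm_dot_le _ _) _.
      by rewrite nu1 mul1r; exact: elt_diam ia.
    rewrite -(ler_pM2r r_gt0) mul1r; apply: le_trans (ltW hr); apply: le_trans th.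
    by rewrite ler_pM2l.
  have iq : elt i0 q.
    apply/(eltP bary) => m; rewrite aff_seg addr_ge0// mulr_ge0 ?subr_ge0//.
    - by move/(eltP bary): ia; exact.
    - exact: ltW.
    - by move/(eltP bary): ib; exact.
  have st1 : s <= t.
    apply: le_trans (ltW st) _; rewrite ler_piMr ?(ltW t0)// invf_le1//.
    by move: B_ge1; lra.
  have na (x y : V) (u : R) : enorm (x - y) <= h -> 0 <= u -> u <= t -> enorm (u *: (x - y)) <= t * h.
    by move=> xy u0 ut; rewrite enormZ ger0_norm// ler_pM// enorm_ge0.
  have pa : enorm (p - a) < r.
    rewrite /p addrAC subrr add0r; apply: le_lt_trans hr; apply: le_trans th.
    by apply: na; rewrite ?(ltW s0)//; exact: elt_diam (stara sj).
  have qa : enorm (q - a) < r.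
    rewrite /q addrAC subrr add0r; apply: le_lt_trans hr; apply: le_trans th.
    by apply: na; rewrite ?(ltW t0)//; exact: elt_diam ia.
  have := zero_set_cone d_gt0 bary conf r_gt0 ball_elt wr_common shared
    rclose i0a wa star_pr sj (star0 _ _) jp iq wp wz pa qa.
  have -> : q - p = t *: (b - a) - s *: (v - a) by apply/rowP => c; rewrite !mxE; ring.
  rewrite dotBr !dotZr.
  have e1 : eps * enorm (t *: (b - a) - s *: (v - a)) <= t * (r / 4).
    have eps0 := eps_ge0 bary rclose i0a star_pr.
    apply: (@le_trans _ _ (eps * (t * h + t * h))).
      rewrite ler_wpM2l//; apply: le_trans (enormD _ _) _; rewrite enormN lerD// na//.
      - exact: elt_diam ia.
      - exact: ltW.
      - exact: elt_diam (stara sj).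
      - exact: ltW.
    have -> : eps * (t * h + t * h) = t * (2 * (eps * h)) by ring.
    by rewrite ler_pM2l//; move: eps_h; move: (eps * h) => A; lra.
  have e2 : s * dot n (v - a) <= t * (r / 4).
    apply: (@le_trans _ _ (t / (4 * B) * h)).
      apply: ler_pM; [exact: ltW|exact: le_trans (ltW r_gt0) up|exact: ltW|].
      apply: le_trans (ler_norm _) _; apply: le_trans (norm_dot_le _ _) _.
      by rewrite nu1 mul1r; exact: elt_diam (stara sj).
    rewrite -mulrA ler_pM2l// mulrC ler_pdivrMr//.
    by rewrite (_ : r / 4 * (4 * B) = r * B)//; field.
  have e3 : t * r <= t * dot n (b - a) by rewrite ler_pM2l.
  have e4 : 0 < t * r by rewrite mulr_gt0.
  move: e1 e2 e3 e4; rewrite (mulrA t r).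
  by move: (eps * _) (s * _) (t * dot _ _) (t * r) => A C F G; lra.
have -> : - wr j a = s * (wr j v - wr j a) by rewrite divfK// gt_eqF.
rewrite ler_pdivlMr// mulrAC -mulrA.
apply: (@le_trans _ _ (t / (4 * B) * (enorm (grad (wr j)) * (r / 2)))).
  by rewrite le_eqVlt; apply/orP; left; apply/eqP; field; rewrite gt_eqF.
by apply: ler_pM => //; [rewrite divr_ge0 ?mulr_ge0 ?ltW|rewrite mulr_ge0 ?enorm_ge0// divr_ge0// ltW].
Qed.

Section AtFace.
Variable e : elt_ix * elt_ix.
Hypotheses (fe : is_face e) (e_i0 : e.1 = i0 \/ e.2 = i0) (fa : face e a)
  (a_min : forall x, face e x -> wr i0 a <= wr i0 x).
Local Notation nu := (face_normal e).

(** The hypothesis gives |n - nu'| <= 1/B for nu' = nu or -nu, which costs at most h/B <= r. The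
    element below the face reaches 2r below its plane, hence at least r below a along n, and is
    deep. *)
Lemma horizontal_face : 1 - (2 * B ^+ 2)^-1 < `|dot nu n| ->
  exists2 j, star j & deep_vol <= vol (omega j).
Proof.
move=> hz; have [k [l [nu_1 F1 F2 A1 A2]]] := face_normalP d_gt0 bary conf r_gt0 ball_elt fe.
have [e1a e2a] := fa; have adj := is_face_adjacent fe.
have [s1 s2] : star e.1 /\ star e.2.
  case: e_i0 => E.
    have s1 : star e.1 by rewrite E star0.
    by split=> //; exact: (star_adj bary i0a s1 adj e2a).
  have s2 : star e.2 by rewrite E star0.
  by split=> //; rewrite (adjacent_sym bary) in adj; exact: (star_adj bary i0a s2 adj e1a).
have key (nu' x : V) : enorm nu' = 1 -> 1 - (2 * B ^+ 2)^-1 < dot nu' n ->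
    enorm (x - a) <= h -> dot nu' (x - a) <= - (2 * r) -> dot n (x - a) <= - r.
  move=> n1 nn xa xd.
  have sq : enorm (n - nu') ^+ 2 <= B^-1 ^+ 2.
    rewrite enorm_sq dotBl !dotBr -!enorm_sq n1 nu1 !expr1n (dotC n).
    rewrite exprVn; move: nn; rewrite invfM; move: ((B ^+ 2)^-1) (dot nu' n) => A C; lra.
  have nb : enorm (n - nu') <= B^-1.
    by rewrite -(ler_pXn2r (n := 2)) ?nnegrE ?enorm_ge0 ?invr_ge0 ?(ltW Bp).
  have : dot (n - nu') (x - a) <= r.
    apply: le_trans (ler_norm _) _; apply: le_trans (norm_dot_le _ _) _.
    apply: (@le_trans _ _ (B^-1 * h)); first by rewrite ler_pM ?enorm_ge0.
    by rewrite mulrC ler_pdivrMr.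
  rewrite dotBl; move: (dot n _) (dot nu' _) xd => A C; have := r_gt0; lra.
have v1 : elt e.1 (vtx e.1 k) := elt_vtx bary _ _.
have v2 : elt e.2 (vtx e.2 l) := elt_vtx bary _ _.
have [h1 _] := A1 a fa; have [h2 _] := A2 a fa.
have [dn|dn] := leP 0 (dot nu n).
  exists e.1 => //; apply: (star_drop s1 v1); apply: (key nu) => //.
    by move: hz; rewrite ger0_norm.
  exact: elt_diam e1a.
exists e.2 => //; apply: (star_drop s2 v2); apply: (key (- nu)) => //.
- by rewrite enormN.
- by move: hz; rewrite ltr0_norm// dotNl.
- exact: elt_diam e2a.
- by rewrite dotNl lerN2.
Qed.

(** The component of n tangential to the face has length at least 1/(2B), so rho^h has a slope of
    order |grad (wr i0)| on the face. Its minimum there is the value at a, and the part in Omega_h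
    lies in a slab of thickness of order t h. For d = 1 there is no tangential direction, which
    excludes this case. *)
Lemma sloped_face t : `|dot nu n| <= 1 - (2 * B ^+ 2)^-1 -> 0 < t ->
  - wr i0 a <= enorm (grad (wr i0)) * (t * h) ->
  (1 < d)%N /\ vol (face_omega e) <= (2 * h) ^+ d.-2 * (4 * d%:R * B * (t * h)).
Proof.
move=> sl t0 wt; have h0 : 0 <= h.
  by apply: le_trans (enorm_ge0 _) (elt_diam (stara (star0 _ _)) (stara (star0 _ _))).
have nu_1 := face_normal1 d_gt0 bary conf r_gt0 ball_elt fe.
pose p := n *m (frame nu)^T.
have pn : enorm p ^+ 2 = 1 - dot nu n ^+ 2.
  have := enorm_frame_decomp d_gt0 nu_1 n; rewrite nu1 expr1n => ->.
  by rewrite addrC addKr.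
have pB : (2 * B)^-1 <= enorm p.
  rewrite -(ler_pXn2r (n := 2)) ?nnegrE ?enorm_ge0 ?invr_ge0 ?mulr_ge0 ?(ltW Bp)//.
  rewrite pn exprVn exprMn_comm; last exact: mulrC.
  have : dot nu n ^+ 2 <= (1 - (2 * B ^+ 2)^-1) ^+ 2.
    by rewrite -(real_normK (num_real (dot nu n))) lerXn2r ?nnegrE//; exact: le_trans sl.
  rewrite (invfM 2) (invfM (2 ^+ 2)).
  have : 0 < (B ^+ 2)^-1 by rewrite invr_gt0 exprn_gt0.
  have : (B ^+ 2)^-1 <= 1 by rewrite invf_le1 ?exprn_gt0// expr_ge1// ltW.
  move: ((B ^+ 2)^-1) (dot nu n ^+ 2) => A C A1 A0.
  have E : (1 - 2^-1 * A) ^+ 2 = 1 - A + A * A / 4 by field.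
  have E2 : (2 ^+ 2)^-1 * A = A / 4 by field.
  have AA : A * A <= A by rewrite ler_piMr// ltW.
  by rewrite E E2; move: (A * A) AA => X; lra.
have pp : 0 < enorm p by apply: lt_le_trans pB; rewrite invr_gt0 mulr_gt0.
have d2 : (0 < d.-1)%N.
  rewrite lt0n; apply/negP => /eqP d0; move: pp; rewrite lt_neqAle => /andP[/negP + _].
  apply; rewrite eq_sym enorm_eq0; apply/eqP/rowP => i; have := ltn_ord i.
  by rewrite [X in (_ < X)%N]d0.
split; first by move: d2; case: (d) => [|[]].
have [k hk] := dot_max_coord p d2.
have dd : d.-1%:R <= d%:R :> R by rewrite ler_nat leq_pred.
have pk : (2 * B * d%:R)^-1 <= `|p 0 k|.
  have : (2 * B)^-1 <= d%:R * `|p 0 k|.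
    by apply: le_trans pB _; apply: le_trans hk _; rewrite ler_wpM2r.
  by rewrite -ler_pdivrMl// mulrC -invfM.
have p0 : 0 < `|p 0 k| by apply: lt_le_trans pk; rewrite invr_gt0 !mulr_gt0.
have g0 := proper_grad (star_pr (star0 _ _)).
pose w := face_aff e (wr i0).
have gw : grad w = enorm (grad (wr i0)) *: p.
  rewrite /w /face_aff /= /p /rnorm -scalemxAl scalerA mulfV ?scale1r// gt_eqF//.
have wk : grad w 0 k != 0.
  by rewrite gw mxE; apply: mulf_neq0; [rewrite gt_eqF|rewrite -normr_gt0].
(* The slab is open at its lower end while the minimum [wr i0 a] is attained; hence the factor 2. *)
pose lo := 2 * wr i0 a - Defs.cst w; pose hi := - Defs.cst w.
have lohi : lo <= hi by rewrite lerBlDr addNr pmulr_rle0// ltW.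
have vE := vol_slab 0 wk h0 lohi.
apply: (@le_trans _ _ (vol (slab (grad w) 0 k h lo hi))).
  apply: le_vol; [exact: bounded_measurable_face_omega|exact: bounded_measurable_slab|].
  rewrite (face_omegaE e_i0) => s [fs ws]; split.
    by move=> i _; exact: (face_set_sub_cube d_gt0 bary conf r_gt0 ball_elt elt_diam fe).
  have wsE : w s = dot (grad w) s + Defs.cst w by [].
  have := a_min fs; rewrite -/(face_pt e s) -face_affE -/w => ws'.
  have wa2 : 2 * wr i0 a < w s by apply: lt_le_trans ws'; move: wa; lra.
  rewrite /lo /hi ltrBlDr -wsE wa2 /=.
  by move: ws; rewrite /= -/w wsE -ltrBrDr sub0r => /ltW.
rewrite vE ler_wpM2l ?exprn_ge0 ?mulr_ge0//.
have -> : hi - lo = 2 * - wr i0 a by rewrite /hi /lo; ring.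
rewrite gw mxE normrM gtr0_norm// invfM.
apply: (@le_trans _ _ (2 * (enorm (grad (wr i0)) * (t * h)) * ((enorm (grad (wr i0)))^-1 * (2 * B * d%:R)))).
  apply: ler_pM => //.
  - by rewrite mulr_ge0// oppr_ge0 ltW.
  - by rewrite mulr_ge0// invr_ge0// ltW.
  - by rewrite ler_pM2l.
  rewrite ler_pM2l ?invr_gt0// -[leRHS]invrK lef_pV2 ?posrE ?invr_gt0 ?mulr_gt0//.
by rewrite le_eqVlt; apply/orP; left; apply/eqP; field; rewrite gt_eqF.
Qed.

Let h_ge0 : 0 <= h.
Proof. exact: le_trans (enorm_ge0 _) (elt_diam (stara (star0 _ _)) (stara (star0 _ _))). Qed.

Let slab_const : cover_size ^+ d.-1 / (16 * 3 ^+ cover_count) * (r / (8 * B)) =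
  r ^+ d / ((16 * d%:R ^+ 2 * 3 ^+ cover_count) ^+ d.-1 * (128 * B * 3 ^+ cover_count)).
Proof.
have X0 : 3 ^+ cover_count != 0 :> R by rewrite gt_eqF// exprn_gt0.
have -> : cover_size = r / (16 * d%:R ^+ 2 * 3 ^+ cover_count).
  by rewrite /cover_size; field; rewrite X0 gt_eqF.
have rd : r ^+ d = r * r ^+ d.-1 by rewrite -exprS prednK.
rewrite expr_div_n rd.
have Y0 : (16 * d%:R ^+ 2 * 3 ^+ cover_count) ^+ d.-1 != 0 :> R.
  by rewrite gt_eqF// exprn_gt0// !mulr_gt0// exprn_gt0.
move: Y0; set X := (16 * d%:R ^+ 2 * 3 ^+ cover_count) ^+ d.-1; clearbody X => Y0.
by field; rewrite X0 Y0 !gt_eqF.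
Qed.

Lemma good_element : exists2 j, star j & h * vol (face_omega e) <= good_const * vol (omega j).
Proof.
have s0 : star i0 := star0 _ _; have ia := stara s0.
have deep j : star j -> deep_vol <= vol (omega j) ->
    exists2 j, star j & h * vol (face_omega e) <= good_const * vol (omega j).
  by move=> sj dj; exists j => //; exact: face_bound_deep.
have [hz|sl] := ltP (1 - (2 * B ^+ 2)^-1) `|dot nu n|.
  by have [j sj dj] := horizontal_face hz; exact: deep dj.
have [k] := exists_far_vtx (bary i0) r_gt0 (fun x hx => (eltP bary i0 x).1 (ball_elt hx)) a nu1.
pose b := vtx i0 k; have ib : elt i0 b := elt_vtx bary i0 k.
rewrite -/b => -[up|down]; last exact: deep (star_drop s0 ib down).
have [wb|wb] := leP (wr i0 b) 0; first exact: deep (star_up_neg s0 ib up wb).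
have w0 : 0 < wr i0 b - wr i0 a by rewrite subr_gt0 (lt_trans wa).
(* Fraction of the segment from a to b at which rho^h vanishes; both sides of the final estimate are
   linear in it. *)
pose t := - wr i0 a / (wr i0 b - wr i0 a).
have t0 : 0 < t by rewrite divr_gt0// oppr_gt0.
have t1 : t <= 1 by rewrite ler_pdivrMr// mul1r lerDr ltW.
have p0 := star_pr s0; have g0 := proper_grad p0.
have waE : - wr i0 a = enorm (grad (wr i0)) * (t * dot n (b - a)).
  by rewrite mulrCA -wr_rnorm// divfK// gt_eqF.
have bah : dot n (b - a) <= h.
  apply: le_trans (ler_norm _) _; apply: le_trans (norm_dot_le _ _) _.
  by rewrite nu1 mul1r; exact: elt_diam ia.
(* For t h > D the vertex a is at a depth of order r in i0, and i0 itself serves. *)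
have [th|th] := leP (t * h) D; last first.
  apply: (deep i0 s0); apply: (vol_deep ia wa).
  rewrite -[wr i0 a]opprK waE lerN2 ler_wpM2l ?(ltW g0)//.
  apply: (@le_trans _ _ (t * r)); last by rewrite ler_pM2l.
  rewrite invfM mulrA ler_pdivrMr// -mulrA; apply: le_trans (ltW th) _.
  by rewrite ler_pM2l.
have wt : - wr i0 a <= enorm (grad (wr i0)) * (t * h).
  by rewrite waE ler_pM2l// ler_pM2l.
have [d2 vF] := sloped_face sl t0 wt.
pose z := a + t *: (b - a).
have wz : wr i0 z = 0 by rewrite aff_line -affB /t; field; rewrite gt_eqF.
have iz : elt i0 z.
  apply/(eltP bary) => m; rewrite aff_seg addr_ge0// mulr_ge0 ?subr_ge0//.
  - by move/(eltP bary): ia; exact.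
  - exact: ltW.
  - by move/(eltP bary): ib; exact.
have za : enorm (z - a) <= D.
  rewrite /z addrAC subrr add0r enormZ gtr0_norm//; apply: le_trans th.
  by rewrite ler_pM2l//; exact: elt_diam ia.
have [j [c [m [sj ca gm cov]]]] := star_cover iz wz za.
have [dj|dp'] := star_depth sj ib up t0 th wz; first exact: deep dj.
exists j => //; have vS := vol_star_slab sj ca gm cov.
pose S : R := cover_size ^+ d.-1 / (16 * 3 ^+ cover_count).
have S0 : 0 <= S by rewrite divr_ge0 ?mulr_ge0 ?exprn_ge0// ltW// cover_size_gt0.
have vt : t * (S * (r / (8 * B))) <= vol (omega j).
  by apply: le_trans vS; rewrite mulrCA ler_wpM2l.
set C2 := 4 * d%:R * B * (2 * B) ^+ d * (16 * d%:R ^+ 2 * 3 ^+ cover_count) ^+ d.-1 *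
    (128 * B * 3 ^+ cover_count).
have X0 : 0 < 3 ^+ cover_count :> R by rewrite exprn_gt0.
have C20 : 0 <= C2 by rewrite !mulr_ge0 ?exprn_ge0 ?mulr_ge0 ?exprn_ge0//; exact: ltW.
apply: (@le_trans _ _ (C2 * vol (omega j))); last first.
  rewrite ler_wpM2r ?vol_ge0// /good_const -/C2 lerDr exprn_ge0// !mulr_ge0 ?exprn_ge0 ?(ltW Bp)//.
apply: (@le_trans _ _ (C2 * (t * (S * (r / (8 * B)))))); last by rewrite ler_wpM2l.
have -> : C2 * (t * (S * (r / (8 * B)))) = t * (4 * d%:R * B * (r * (2 * B)) ^+ d).
  rewrite slab_const /C2 (exprMn _ r).
  have Y0 : (16 * d%:R ^+ 2 * 3 ^+ cover_count) ^+ d.-1 != 0 :> R.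
    by rewrite gt_eqF// exprn_gt0// !mulr_gt0// exprn_gt0.
  move: Y0; set X := (16 * d%:R ^+ 2 * 3 ^+ cover_count) ^+ d.-1; clearbody X => Y0.
  by field; rewrite Y0 !gt_eqF.
have hv := ler_wpM2l h_ge0 vF; apply: le_trans hv _.
have -> : h * ((2 * h) ^+ d.-2 * (4 * d%:R * B * (t * h))) =
  t * (4 * d%:R * B * (h * h * (2 * h) ^+ d.-2)) by ring.
rewrite ler_pM2l// ler_pM2l ?mulr_gt0//.
apply: (@le_trans _ _ ((2 * h) ^+ d)); last first.
  by rewrite lerXn2r ?nnegrE ?mulr_ge0 ?(ltW Bp) ?(ltW r_gt0).
have dE : d = (d.-2).+2 by case: (d) d2 => [|[]].
rewrite {2}dE !exprS mulrA ler_wpM2r ?exprn_ge0 ?mulr_ge0//.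
by rewrite mulrACA ler_peMl ?mulr_ge0//; lra.
Qed.

End AtFace.
End AtVertex.
End GoodElement.

(** * Energy estimates *)

Lemma sum_sqr_le (R : realType) (I : finType) (P : pred I) (x : I -> R) :
  (\sum_(i | P i) x i) ^+ 2 <= #|P|%:R * \sum_(i | P i) x i ^+ 2.
Proof.
rewrite expr2 big_distrlr /=.
apply: (@le_trans _ _ (\sum_(i | P i) \sum_(j | P j) (x i ^+ 2 / 2 + x j ^+ 2 / 2))).
  apply: ler_sum => i _; apply: ler_sum => j _.
  by have := sqr_ge0 (x i - x j); rewrite sqrrB; move: (x i) (x j) => y z; nra.
have E i : \sum_(j | P j) (x i ^+ 2 / 2 + x j ^+ 2 / 2) =
    (x i ^+ 2 / 2) *+ #|P| + \sum_(j | P j) x j ^+ 2 / 2.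
  by rewrite big_split /= sumr_const.
rewrite (eq_bigr _ (fun i _ => E i)) big_split /= sumr_const sumrMnl -!mulr_suml.
by rewrite mulr_natl -mulrnDl -splitr.
Qed.

(** The path is first made free of repetitions, so each step can be charged to its starting point
    and no pair is used twice. *)
Lemma path_dist (R : realType) (I : finType) (E : rel I) (G : I -> I -> R) x y :
  (forall a b, 0 <= G a b) -> (forall a, G a a = 0) ->
  (forall a b c, G a c <= G a b + G b c) -> connect E x y ->
  G x y <= \sum_(p : I * I | E p.1 p.2) G p.1 p.2.
Proof.
move=> G0 Gxx Gt /connectP[s0 p0 ->]; case: (shortenP p0) => s ps us _ {s0 p0}.
pose g k := \sum_(l | E k l) G k l.
have g0 k : 0 <= g k by apply: sumr_ge0.
have : G x (last x s) <= \sum_(k <- x :: s) g k.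
  elim: s x ps {us} => [|z s IH] x /=; first by rewrite Gxx big_seq1.
  move=> /andP[xz /IH h]; rewrite big_cons; apply: le_trans (Gt _ z _) _.
  by rewrite lerD// /g (bigD1 z)//= lerDl sumr_ge0.
move/le_trans; apply; rewrite -(pair_big_dep xpredT E G) /= -/g.
rewrite big_uniq// big_mkcond /=; apply: ler_sum => k _.
by case: ifP => _; [exact: lexx|exact: g0].
Qed.

Section Energy.
Variables (R : realType) (d : nat).
Local Notation V := 'rV[R]_d.
Variables (M : mesh R d).
Local Notation elt_ix := 'I_(nelt M).
Variables (lam : elt_ix -> 'I_d.+1 -> affine R d) (ctr : elt_ix -> V) (r h B : R).
Hypotheses (d_gt0 : (0 < d)%N) (bary : forall i, barycentric (@vtx _ _ M i) (lam i))
  (conf : conforming_mesh M) (r_gt0 : 0 < r)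
  (ball_elt : forall (i : elt_ix) (x : V), enorm (x - ctr i) <= r -> elt i x)
  (elt_diam : forall (i : elt_ix) (x y : V), elt i x -> elt i y -> enorm (x - y) <= h).
Hypotheses (B_ge1 : 1 <= B) (hB : h <= r * B) (h_gt0 : 0 < h).
Variables (rhoh : V -> R) (wr : elt_ix -> affine R d) (eps : R).
Hypothesis wrE : forall (i : elt_ix) (x : V), elt i x -> rhoh x = wr i x.
Hypothesis shared : forall (i : elt_ix) (k : 'I_d.+1) (z : V) (b : 'I_d.+1),
  proper wr i -> elt i z -> 0 <= wr i z -> lam i k z = 0 ->
  (forall m, m != k -> 0 < lam i m z) -> b != k -> wr i (vtx i b) < 0 ->
  exists2 j, adjacent i j & forall x, elt i x -> lam i k x = 0 -> elt j x.
Hypothesis rclose : forall i j : elt_ix, proper wr i -> proper wr j -> touching i j ->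
  enorm (rnorm wr i - rnorm wr j) <= eps.
Hypothesis eps_le : eps * (8 * d%:R * B) <= 1.
Variable v : DG M.
Implicit Types (i j : elt_ix) (x y z : V) (k l m : 'I_d.+1) (e : elt_ix * elt_ix).
Local Notation N := (touch_bound d B).
Local Notation omega := (omega rhoh).
Local Notation face_omega := (face_omega rhoh).

Lemma touchingC i j : touching i j = touching j i.
Proof. by rewrite /touching setIC. Qed.

(** Finite overlap: each b is counted once for every element that touches [f b]. *)
Lemma sum_touching (J : finType) (Q : pred J) (f : J -> elt_ix) (X : J -> R) :
  (forall b, 0 <= X b) ->
  \sum_i \sum_(b | Q b && touching i (f b)) X b <= N%:R * \sum_(b | Q b) X b.
Proof.
move=> X0; rewrite (exchange_big_dep Q) /=; last by move=> i b _ /andP[].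
rewrite mulr_sumr; apply: ler_sum => b Qb.
under eq_bigl do rewrite Qb /= touchingC.
rewrite sumr_const mulr_natl ler_wpMn2l//.
exact: (card_touching d_gt0 bary conf r_gt0 ball_elt elt_diam _ hB).
Qed.

Lemma TOmega_vtx i : in_TOmega rhoh i -> exists k, wr i (vtx i k) < 0.
Proof.
move=> /asboolP[x [/interior_subset ix [_ xo]]]; apply: contrapT => no.
move: xo; rewrite (wrE ix) (aff_bary (bary i)) ltNge => /negP; apply.
apply: sumr_ge0 => k _; apply: mulr_ge0; first by move/(eltP bary): ix; exact.
by rewrite leNgt; apply/negP => h'; apply: no; exists k.
Qed.

Lemma neg_TOmega i x : elt i x -> wr i x < 0 -> in_TOmega rhoh i.
Proof.
move=> ix wx.
have h2 : nbhs x (wr i @^-1` [set t : R | t < 0]).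
  by apply: (continuous_aff (w := wr i)); exact: lt_nbhsl.
have [e e0 he] := (nbhs_enormP _ _).1 h2.
have [y yp yx] := near_vtx_interior d_gt0 bary r_gt0 ball_elt ix e0.
have iy : interior (elt i) y := pos_interior_simplex (bary i) yp.
apply/asboolP; exists y; split=> //; split; first exact: elt_region (interior_subset iy).
by rewrite (wrE (interior_subset iy)); exact: he.
Qed.

Lemma proper_TGamma i : proper wr i -> in_TGamma rhoh i.
Proof.
move=> pi; have /andP[/existsP[k hk] _] := pi.
apply/andP; split; first exact: neg_TOmega (elt_vtx bary i k) hk.
have [x xp x0] := proper_zero d_gt0 bary r_gt0 ball_elt pi.
have ix : elt i x by apply/(eltP bary) => m; exact: ltW.
by apply/asboolP; exists x; split=> //; split; [exact: elt_region ix|rewrite (wrE ix)].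
Qed.

Section OneFace.
Variables (e : elt_ix * elt_ix) (i : elt_ix).
Hypotheses (fe : is_face e) (ei : e.1 = i \/ e.2 = i).

Lemma exists_lowest_vtx : exists k, [/\ face e (vtx i k) &
  forall x, face e x -> wr i (vtx i k) <= wr i x].
Proof.
have [k kE] : exists k, forall x, face e x <-> elt i x /\ lam i k x = 0.
  have [k [l [_ F1 F2 _ _]]] := face_normalP d_gt0 bary conf r_gt0 ball_elt fe.
  by case: ei => <-; [exists k|exists l].
have [m0 m0k] : exists m0, m0 != k.
  by case: (unliftP ord0 k) => [j ->|->];
    [exists ord0|exists (lift ord0 (Ordinal d_gt0))]; rewrite // eq_sym.
case: (@arg_minP _ R _ m0 (fun m => m != k) (fun m => wr i (vtx i m)) m0k) => m mk mmin.
exists m; split=> [|x /kE[ix kx]].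
  apply/kE; split; first exact: elt_vtx bary _ _.
  by rewrite (bary_vtx (bary i)) eq_sym (negPf mk).
rewrite (aff_bary (bary i) _ x) (bigD1 k)//= kx mul0r add0r.
have <- : \sum_(l | l != k) lam i l x * wr i (vtx i m) = wr i (vtx i m).
  rewrite -mulr_suml; have := bary_sum (bary i) x; rewrite (bigD1 k)//= kx add0r => ->.
  exact: mul1r.
apply: ler_sum => l lk; rewrite ler_wpM2l ?mmin//.
by move/(eltP bary): ix; exact.
Qed.

(** Every step starts in a cut element, so the face that it crosses carries a ghost penalty. *)
Definition proper_step (a : V) (j1 j2 : elt_ix) : bool :=
  [&& proper wr j1, adjacent j1 j2, `[< elt j1 a >] & `[< elt j2 a >]].

(** Since a is the lowest vertex of the face, rho^h is negative at a unless the face misses Omega_h.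
    If an uncut element can be reached, it contains a, and [vol_nonproper] makes it deep. *)
Lemma exists_good_path : 0 < vol (face_omega e) -> exists a j,
  [/\ elt i a, elt j a, rhoh a < 0, connect (proper_step a) i j &
    h * vol (face_omega e) <= good_const d B * vol (omega j)].
Proof.
move=> vp; have [k [fa a_min]] := exists_lowest_vtx.
set a := vtx i k in fa a_min.
have ia : elt i a := elt_vtx bary i k.
have wa : wr i a < 0.
  rewrite ltNge; apply/negP => wa; move: vp; rewrite /vol.
  rewrite (_ : face_omega e = set0).
    by rewrite (_ : tuple_set set0 = set0)// measure0 ltxx.
  rewrite (face_omegaE wrE ei) -subset0 => s [fs] /=; rewrite face_affE.
  by rewrite ltNge (le_trans wa (a_min _ fs)).
have cl j : connect (proper_step a) i j -> elt j a.
  have cl : fingraph.closed (proper_step a) [pred j : elt_ix | `[< elt j a >]].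
    by move=> i1 i2 /and4P[_ _ h1 h2]; rewrite !inE h1 h2.
  move=> /(closed_connect cl); rewrite !inE (asboolT ia) => /esym.
  by move=> /asboolP.
have rho_a : rhoh a < 0 by rewrite (wrE ia).
have [[j [cj npj]]|all_pr] := pselect (exists j, connect (proper_step a) i j /\ ~~ proper wr j).
  exists a, j; split=> //; first exact: cl.
  apply: (face_bound_deep d_gt0 bary conf r_gt0 ball_elt elt_diam B_ge1 hB wrE fe (ltW h_gt0)).
  apply: (vol_nonproper d_gt0 bary r_gt0 ball_elt B_ge1 wrE npj).
  have ja := cl _ cj; apply: TOmega_vtx; apply: (neg_TOmega ja).
  by rewrite -(wrE ja).
(* When all reachable elements are cut, every step in the star is a [proper_step]; so the whole star
   is reached and [good_element] applies. *)
have step_star j : star i a j -> connect (proper_step a) i j.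
  have cl2 : fingraph.closed (fun i j => [&& adjacent i j, `[< elt i a >] & `[< elt j a >]])
      [pred j : elt_ix | connect (proper_step a) i j].
    have stp j1 j2 : adjacent j1 j2 -> elt j1 a -> elt j2 a ->
        connect (proper_step a) i j1 -> connect (proper_step a) i j2.
      move=> a12 h1 h2 c1; apply: (connect_trans c1); apply: connect1.
      rewrite /proper_step a12 (asboolT h1) (asboolT h2) !andbT.
      by apply: contrapT => np; apply: all_pr; exists j1; split=> //; exact/negP.
    move=> j1 j2 /and3P[a12 /asboolP h1 /asboolP h2]; rewrite !inE.
    apply/idP/idP; first exact: stp a12 h1 h2.
    by apply: stp h2 h1; rewrite (adjacent_sym bary).
  by move=> /(closed_connect cl2); rewrite !inE connect0 => /esym.
have star_pr j : star i a j -> proper wr j.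
  move=> /step_star cj; apply: contrapT => np; apply: all_pr; exists j; split=> //.
  exact/negP.
have [j sj hj] := good_element d_gt0 bary conf r_gt0 ball_elt elt_diam B_ge1 hB wrE shared
  rclose eps_le (ex_intro _ k erefl) wa star_pr fe ei fa a_min.
by exists a, j; split=> //; [apply: cl|]; exact: step_star.
Qed.

Definition grad_jump e : R := enorm (grad (v e.1) - grad (v e.2)).

(** 2^d comes from h |F| <= (2h)^d, N^2 from Cauchy-Schwarz over the possible steps, one factor 2
    from the square of a sum and one from the two orders in which a pair can be crossed. *)
Definition path_const : R := 4 * 2 ^+ d * N%:R ^+ 2.

(** The gradient is compared with that of the end of the path. The end term is weighted by the small
    measure of F in Omega_h, which [exists_good_path] converts into volume; for the jumps the crude
    weight (2h)^d suffices. *)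
Lemma face_gradient : h * vol (face_omega e) * enorm (grad (v i)) ^+ 2 <=
  2 * good_const d B * (\sum_(j | in_TOmega rhoh j && touching i j)
    vol (omega j) * enorm (grad (v j)) ^+ 2) +
  path_const * \sum_(e' | in_FOmega_g rhoh e' && touching i e'.1) h ^+ d * grad_jump e' ^+ 2.
Proof.
have S1 : 0 <= \sum_(j | in_TOmega rhoh j && touching i j) vol (omega j) * enorm (grad (v j)) ^+ 2.
  by apply: sumr_ge0 => j _; rewrite mulr_ge0 ?vol_ge0 ?sqr_ge0.
have S2 : 0 <= \sum_(e' | in_FOmega_g rhoh e' && touching i e'.1) h ^+ d * grad_jump e' ^+ 2.
  apply: sumr_ge0 => j _; apply: mulr_ge0; last exact: sqr_ge0.
  by apply: exprn_ge0; exact: ltW.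
have C1 : 0 <= good_const d B.
  by rewrite addr_ge0 ?mulr_ge0 ?exprn_ge0 ?mulr_ge0 ?exprn_ge0 ?(le_trans _ B_ge1).
have C2 : 0 <= path_const by rewrite !mulr_ge0 ?exprn_ge0.
have [v0|vp] := leP (vol (face_omega e)) 0.
  have -> : vol (face_omega e) = 0 by apply/eqP; rewrite eq_le v0 vol_ge0.
  by rewrite mulr0 mul0r addr_ge0 ?mulr_ge0.
have [a [j [ia ja ra cj hj]]] := exists_good_path vp.
pose G (k l : elt_ix) := enorm (grad (v k) - grad (v l)).
have Gd : G i j <= \sum_(p : elt_ix * elt_ix | proper_step a p.1 p.2) G p.1 p.2.
  apply: path_dist => // [k l|k|k l m]; first exact: enorm_ge0.
    by rewrite /G subrr enorm0.
  exact: enorm_dist.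
pose K (p : elt_ix * elt_ix) := in_FOmega_g rhoh p && touching i p.1.
pose Y (p : elt_ix * elt_ix) := G p.1 p.2 ^+ 2.
have ti (k : elt_ix) : elt k a -> touching i k by move=> ka; apply/asboolP; exists a.
have to (k : elt_ix) : elt k a -> in_TOmega rhoh k.
  by move=> ka; apply: (neg_TOmega ka); rewrite -(wrE ka).
pose sw (p : elt_ix * elt_ix) := (p.2, p.1).
(* Faces are listed with the smaller index first, whereas a path crosses them in either
   direction. *)
have YK : \sum_(p : elt_ix * elt_ix | proper_step a p.1 p.2) Y p <= 2 * \sum_(p | K p) Y p.
  have Y0 p : 0 <= Y p by rewrite sqr_ge0.
  have Ysw p : Y (sw p) = Y p by rewrite /Y /G enormB.
  have E2 : \sum_(p | K p) Y p = \sum_p (if K (sw p) then Y p else 0).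
    rewrite big_mkcond (reindex sw)/=; last by exists sw => -[].
    by apply: eq_bigr => p _; rewrite Ysw.
  have E1 : \sum_(p | K p) Y p = \sum_p (if K p then Y p else 0) by exact: big_mkcond.
  rewrite mulr_natl mulr2n [X in _ <= X + _]E1 [X in _ <= _ + X]E2 -big_split big_mkcond /=.
  apply: ler_sum => -[k l] _ /=; case: ifP => [/and4P[pk kl /asboolP ka /asboolP la]|_]; last first.
    by rewrite addr_ge0//; case: ifP.
  have [ltkl|ltlk|eqkl] := ltngtP k l.
  - have -> : K (k, l).
      have /andP[_ ckl] := kl.
      by rewrite /K /in_FOmega_g /in_FOmega /is_face /= ltkl ckl !to// (proper_TGamma pk) ti.
    by rewrite lerDl; case: ifP.
  - have -> : K (sw (k, l)).
      have /andP[_ ckl] : adjacent l k by rewrite (adjacent_sym bary).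
      by rewrite /K /in_FOmega_g /in_FOmega /is_face /= ltlk ckl !to// (proper_TGamma pk) orbT ti.
    by rewrite lerDr; case: ifP.
  - by move: kl => /andP[/negP + _]; case; apply/eqP/val_inj.
have card_pairs : (#|[pred p : elt_ix * elt_ix | proper_step a p.1 p.2]| <= N * N)%N.
  have ct := card_touching d_gt0 bary conf r_gt0 ball_elt elt_diam i hB.
  apply: leq_trans (leq_mul ct ct); rewrite -cardX; apply: subset_leq_card.
  apply/fintype.subsetP => -[k l]; rewrite !inE /= => /and4P[_ _ /asboolP ka /asboolP la].
  by apply/andP; split; exact: ti.
have YK0 : 0 <= \sum_(p | K p) Y p by apply: sumr_ge0 => p _; rewrite sqr_ge0.
have GG : G i j ^+ 2 <= N%:R ^+ 2 * (2 * \sum_(p | K p) Y p).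
  apply: (@le_trans _ _ ((\sum_(p : elt_ix * elt_ix | proper_step a p.1 p.2) G p.1 p.2) ^+ 2)).
    by rewrite lerXn2r ?nnegrE ?enorm_ge0//; apply: sumr_ge0 => p _; exact: enorm_ge0.
  apply: le_trans (sum_sqr_le _ _) _; apply: ler_pM => //.
    by apply: sumr_ge0 => p _; rewrite sqr_ge0.
  by rewrite -natrX ler_nat -mulnn.
have tri : enorm (grad (v i)) ^+ 2 <= 2 * enorm (grad (v j)) ^+ 2 + 2 * G i j ^+ 2.
  have : enorm (grad (v i)) <= enorm (grad (v j)) + G i j.
    by rewrite -{1}(subrK (grad (v j)) (grad (v i))) addrC enormD.
  have := enorm_ge0 (grad (v i)); move: (enorm (grad (v i))) (enorm (grad (v j))) (G i j) => x y z x0 xyz.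
  apply: (@le_trans _ _ ((y + z) ^+ 2)).
    by rewrite lerXn2r ?nnegrE// (le_trans x0).
  have := sqr_ge0 (y - z); rewrite sqrrB sqrrD; move: (y ^+ 2) (z ^+ 2) (y * z) => Y2 Z2 YZ; lra.
have hv : h * vol (face_omega e) <= 2 ^+ d * h ^+ d.
  have -> : 2 ^+ d * h ^+ d = (2 * h) * (2 * h) ^+ d.-1 by rewrite -exprMn -exprS prednK.
  rewrite ler_pM ?vol_ge0 ?(ltW h_gt0)//.
    by rewrite ler_peMl ?ler1n ?(ltW h_gt0).
  exact: (vol_face_omega d_gt0 bary conf r_gt0 ball_elt elt_diam wrE fe (ltW h_gt0)).
have hv0 : 0 <= h * vol (face_omega e) by rewrite mulr_ge0 ?vol_ge0 ?(ltW h_gt0).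
apply: le_trans (ler_wpM2l hv0 tri) _; rewrite mulrDr; apply: lerD.
  rewrite mulrCA -mulrA ler_pM2l//.
  apply: (@le_trans _ _ (good_const d B * (vol (omega j) * enorm (grad (v j)) ^+ 2))).
    by rewrite mulrA ler_wpM2r ?sqr_ge0.
  rewrite ler_wpM2l// (bigD1 j) /=; last by rewrite to// ti.
  by rewrite lerDl sumr_ge0// => k _; rewrite mulr_ge0 ?vol_ge0 ?sqr_ge0.
have -> : \sum_(e' | in_FOmega_g rhoh e' && touching i e'.1) h ^+ d * grad_jump e' ^+ 2 =
  h ^+ d * \sum_(p | K p) Y p by rewrite mulr_sumr.
apply: (@le_trans _ _ (2 ^+ d * h ^+ d * (2 * (N%:R ^+ 2 * (2 * \sum_(p | K p) Y p))))).
  apply: ler_pM; [exact: hv0| |exact: hv|by rewrite ler_pM2l].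
  by apply: mulr_ge0 => //; exact: sqr_ge0.
by rewrite /path_const le_eqVlt; apply/orP; left; apply/eqP; ring.
Qed.

End OneFace.

Definition grad_energy : R :=
  \sum_(i | in_TOmega rhoh i) vol (omega i) * enorm (grad (v i)) ^+ 2.

Definition grad_jump_energy : R :=
  \sum_(e | in_FOmega_g rhoh e) h ^+ d * grad_jump e ^+ 2.

Let good_const_ge0 : 0 <= good_const d B.
Proof. by rewrite addr_ge0 ?mulr_ge0 ?exprn_ge0 ?mulr_ge0 ?exprn_ge0 ?(le_trans _ B_ge1). Qed.

Let path_const_ge0 : 0 <= path_const.
Proof. by rewrite !mulr_ge0 ?exprn_ge0. Qed.

Lemma grad_energy_ge0 : 0 <= grad_energy.
Proof. by apply: sumr_ge0 => i _; rewrite mulr_ge0 ?vol_ge0 ?sqr_ge0. Qed.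

(** Faces are among the touching pairs, which costs one overlap factor N; undoing the localization
    in [Psi] costs another. *)
Lemma sum_face_gradient :
  \sum_(e | in_FOmega rhoh e) h * vol (face_omega e) *
    (enorm (grad (v e.1)) ^+ 2 + enorm (grad (v e.2)) ^+ 2) <=
  2 * N%:R ^+ 2 * (2 * good_const d B * grad_energy + path_const * grad_jump_energy).
Proof.
pose Y j := vol (omega j) * enorm (grad (v j)) ^+ 2.
pose Z e := h ^+ d * grad_jump e ^+ 2.
have Y0 j : 0 <= Y j by rewrite mulr_ge0 ?vol_ge0 ?sqr_ge0.
have Z0 e : 0 <= Z e.
  by apply: mulr_ge0; [apply: exprn_ge0; exact: ltW|exact: sqr_ge0].
pose Psi i := 2 * good_const d B * (\sum_(j | in_TOmega rhoh j && touching i j) Y j) +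
  path_const * \sum_(e' | in_FOmega_g rhoh e' && touching i e'.1) Z e'.
have Psi0 i : 0 <= Psi i.
  by rewrite addr_ge0// mulr_ge0 ?mulr_ge0//; apply: sumr_ge0.
have SPsi : \sum_i Psi i <= N%:R * (2 * good_const d B * grad_energy + path_const * grad_jump_energy).
  rewrite big_split /= -!mulr_sumr [leRHS]mulrDr; apply: lerD; rewrite [leRHS]mulrCA.
    by rewrite ler_wpM2l ?mulr_ge0//; exact: (sum_touching (in_TOmega rhoh) id).
  by rewrite ler_wpM2l//; exact: (sum_touching (in_FOmega_g rhoh) fst).
have T1 : \sum_i \sum_(j | true && touching i j) Psi j <= N%:R * \sum_j Psi j.
  exact: (sum_touching predT id).
have T2 : \sum_i \sum_(j | true && touching i j) Psi i <= N%:R * \sum_j Psi j.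
  rewrite (exchange_big_dep predT) //=; apply: le_trans T1.
  by apply: ler_sum => i _; under eq_bigl do rewrite touchingC.
apply: (@le_trans _ _ (\sum_i \sum_(j | true && touching i j) (Psi i + Psi j))).
  rewrite (pair_big_dep xpredT (fun i j => true && touching i j) (fun i j => Psi i + Psi j)) /=.
  rewrite big_mkcond [leRHS]big_mkcond; apply: ler_sum => e _.
  case: ifP => [/and3P[fe _ _]|_]; last by case: ifP => // _; rewrite addr_ge0.
  have -> : touching e.1 e.2.
    by apply/asboolP; exists (xget 0 (face e)); exact: (face_x0 d_gt0 bary conf r_gt0 ball_elt fe).
  by rewrite mulrDr; apply: lerD; apply: face_gradient => //; [left|right].
under eq_bigr do rewrite big_split /=.
rewrite big_split /=; apply: le_trans (lerD T2 T1) _.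
have NS := ler_wpM2l (ler0n R N) SPsi; apply: le_trans (lerD NS NS) _.
by rewrite le_eqVlt; apply/orP; left; apply/eqP; ring.
Qed.

Definition jump_aff e : affine R d :=
  Affine (grad (v e.1) - grad (v e.2)) (Defs.cst (v e.1) - Defs.cst (v e.2)).

Lemma jump_affE e x : jump v e x = jump_aff e x.
Proof. by rewrite /jump /aff /= dotBl; ring. Qed.

Lemma regular_jump e : regular (fun s => jump v e (face_pt e s)).
Proof.
rewrite (_ : (fun s => _) = (fun s => jump_aff e (face_pt e s))).
  exact: regular_face.
by apply/funext => s; rewrite jump_affE.
Qed.

Definition face_jump_sq e : R := face_int e (face e) (fun x => jump v e x * jump v e x).

Definition flux_jump_sq e : R := face_int e (face e) (fun=> jump_flux v e * jump_flux v e).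

(** The first summand belongs to the tangential part of the gradient jump, the second one to its
    normal part; powers of B turn h into r. *)
Definition jump_const : R :=
  B ^+ d.+1 / ((4 / (3 * d%:R ^+ 2)) ^+ d.-1 * (2 / (3 * d%:R ^+ 2)) ^+ 2) +
  B ^+ d.-1 / (4 / d%:R ^+ 2) ^+ d.-1.

(** The tangential part of the gradient jump is controlled by the jump of v through
    [inverse_estimate_face]. The normal part is the flux jump, constant on a face whose measure is
    at least that of a cube of size comparable to r. *)
Lemma grad_jump_bound e : is_face e ->
  h ^+ d * grad_jump e ^+ 2 <= jump_const * (h^-1 * face_jump_sq e + h * flux_jump_sq e).
Proof.
move=> fe; have dp : 0 < d%:R :> R by rewrite ltr0n.
have Bp : 0 < B := lt_le_trans ltr01 B_ge1.
have I1 := inverse_estimate_face d_gt0 bary conf r_gt0 ball_elt elt_diam fe (jump_aff e).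
have I1E : face_int e (face e) (fun x => jump_aff e x ^+ 2) = face_jump_sq e.
  by congr (face_int _ _ _); apply/funext => x; rewrite jump_affE expr2.
rewrite /= I1E in I1 => {I1E}.
have [s0 hs] := face_contains_cube d_gt0 bary conf r_gt0 ball_elt fe.
set l := 2 * r / d%:R ^+ 2 in I1 hs.
have l0 : 0 < l by rewrite divr_gt0 ?mulr_gt0 ?exprn_gt0.
have bf := bounded_measurable_face d_gt0 bary conf r_gt0 ball_elt elt_diam fe.
have I2 : (2 * l) ^+ d.-1 * jump_flux v e ^+ 2 <= flux_jump_sq e.
  rewrite /flux_jump_sq face_intE vol_int_cst// mulrC ler_wpM2l ?sqr_ge0//.
  rewrite -(vol_cube s0 (ltW l0)); apply: le_vol => //.
  by apply: bounded_measurable_cube; exact: ltW.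
have gE : grad_jump e ^+ 2 =
    (enorm (grad (jump_aff e)) ^+ 2 - dot (face_normal e) (grad (jump_aff e)) ^+ 2) +
    jump_flux v e ^+ 2 by rewrite subrK.
have dn : d%:R != 0 :> R by rewrite gt_eqF.
have hpow (m : nat) : h ^+ m <= r ^+ m * B ^+ m.
  by rewrite -exprMn lerXn2r ?nnegrE ?mulr_ge0 ?(ltW h_gt0) ?(ltW r_gt0) ?(ltW Bp).
set X := _ - _ in gE I1.
have X0 : 0 <= X.
  rewrite subr_ge0 -(real_normK (num_real (dot _ _))) lerXn2r ?nnegrE ?enorm_ge0//.
  by apply: le_trans (norm_dot_le _ _) _;
    rewrite (face_normal1 d_gt0 bary conf r_gt0 ball_elt fe) mul1r.
pose c1 : R := (4 / (3 * d%:R ^+ 2)) ^+ d.-1 * (2 / (3 * d%:R ^+ 2)) ^+ 2.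
pose c2 : R := (4 / d%:R ^+ 2) ^+ d.-1.
have c10 : 0 < c1 by rewrite mulr_gt0 ?exprn_gt0// divr_gt0 ?mulr_gt0 ?exprn_gt0.
have c20 : 0 < c2 by rewrite exprn_gt0// divr_gt0 ?exprn_gt0.
have J1 : 0 <= face_jump_sq e.
  by rewrite /face_jump_sq face_intE; apply: vol_int_ge0 => s _; rewrite -expr2 sqr_ge0.
have J2 : 0 <= flux_jump_sq e.
  by rewrite /flux_jump_sq face_intE; apply: vol_int_ge0 => s _; rewrite -expr2 sqr_ge0.
have e1 : h ^+ d * X <= B ^+ d.+1 / c1 * (h^-1 * face_jump_sq e).
  rewrite mulrCA -ler_pdivrMl ?invr_gt0// invrK mulrA -exprS.
  apply: (@le_trans _ _ (B ^+ d.+1 / c1 * ((2 * (l / 3)) ^+ d.-1 * (l / 3) ^+ 2 * X))); last first.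
    by rewrite ler_wpM2l// divr_ge0 ?exprn_ge0 ?(ltW Bp) ?(ltW c10).
  rewrite mulrA ler_wpM2r//; apply: le_trans (hpow _) _.
  have -> : (2 * (l / 3)) ^+ d.-1 * (l / 3) ^+ 2 = r ^+ d.+1 * c1.
    have -> : 2 * (l / 3) = r * (4 / (3 * d%:R ^+ 2)) by rewrite /l; field; rewrite dn.
    have -> : l / 3 = r * (2 / (3 * d%:R ^+ 2)) by rewrite /l; field; rewrite dn.
    have -> : r ^+ d.+1 = r ^+ d.-1 * r ^+ 2 by rewrite -exprD addn2 prednK.
    by rewrite !(exprMn _ r) /c1; ring.
  by rewrite le_eqVlt; apply/orP; left; apply/eqP; field; rewrite gt_eqF.
have e2 : h ^+ d * jump_flux v e ^+ 2 <= B ^+ d.-1 / c2 * (h * flux_jump_sq e).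
  have -> : h ^+ d = h * h ^+ d.-1 by rewrite -exprS prednK.
  rewrite -mulrA [leRHS]mulrCA ler_pM2l//.
  apply: (@le_trans _ _ (B ^+ d.-1 / c2 * ((2 * l) ^+ d.-1 * jump_flux v e ^+ 2))); last first.
    by rewrite ler_wpM2l// divr_ge0 ?exprn_ge0 ?(ltW Bp) ?(ltW c20).
  rewrite mulrA ler_wpM2r ?sqr_ge0//; apply: le_trans (hpow _) _.
  have -> : 2 * l = r * (4 / d%:R ^+ 2) by rewrite /l; field; rewrite dn.
  rewrite (exprMn _ r) -/c2.
  by rewrite le_eqVlt; apply/orP; left; apply/eqP; field; rewrite gt_eqF.
rewrite gE mulrDr /jump_const -/c1 -/c2 mulrDl; apply: lerD; [apply: le_trans e1 _|apply: le_trans e2 _].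
  by rewrite ler_wpM2l ?divr_ge0 ?exprn_ge0 ?(ltW Bp) ?(ltW c10)// lerDl mulr_ge0// ltW.
by rewrite ler_wpM2l ?divr_ge0 ?exprn_ge0 ?(ltW Bp) ?(ltW c20)// lerDr mulr_ge0 ?invr_ge0 ?(ltW h_gt0).
Qed.

Let face_bm e : is_face e -> bounded_measurable (face_set e (face e)).
Proof. exact: (bounded_measurable_face d_gt0 bary conf r_gt0 ball_elt elt_diam). Qed.

Let regular_jump_sq e : regular (fun s => jump v e (face_pt e s) * jump v e (face_pt e s)).
Proof. by apply: regularM; exact: regular_jump. Qed.

Lemma face_jump_sq_ge0 e : 0 <= face_jump_sq e.
Proof.
by rewrite /face_jump_sq face_intE; apply: vol_int_ge0 => s _; rewrite -expr2 sqr_ge0.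
Qed.

Lemma flux_jump_sq_ge0 e : 0 <= flux_jump_sq e.
Proof.
by rewrite /flux_jump_sq face_intE; apply: vol_int_ge0 => s _; rewrite -expr2 sqr_ge0.
Qed.

Lemma face_int_penalty e : is_face e ->
  face_int e (face e) (fun x => (h^-1 * jump v e x) * jump v e x) = h^-1 * face_jump_sq e.
Proof.
move=> fe; rewrite /face_jump_sq !face_intE -(vol_intZ _ (face_bm fe) (regular_jump_sq e)).
by congr vol_int; apply/funext => s; rewrite mulrA.
Qed.

Lemma face_int_norm e : is_face e ->
  face_int e (face e) (fun x => ((Num.sqrt h)^-1 * jump v e x) ^+ 2) = h^-1 * face_jump_sq e.
Proof.
move=> fe; rewrite -face_int_penalty//; congr face_int; apply/funext => x.
by rewrite exprMn exprVn sqr_sqrtr ?(ltW h_gt0)// expr2 mulrA.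
Qed.

Lemma avg_flux_sq e : is_face e -> avg_flux v e ^+ 2 <=
  (enorm (grad (v e.1)) ^+ 2 + enorm (grad (v e.2)) ^+ 2) / 2.
Proof.
move=> fe; have nu1 := face_normal1 d_gt0 bary conf r_gt0 ball_elt fe.
set x := enorm (grad (v e.1)); set y := enorm (grad (v e.2)).
have D : `|dot (face_normal e) (grad (v e.1) + grad (v e.2))| <= x + y.
  by apply: le_trans (norm_dot_le _ _) _; rewrite nu1 mul1r enormD.
rewrite /avg_flux exprMn -(real_normK (num_real (dot _ _))).
have x0 : 0 <= x := enorm_ge0 _; have y0 : 0 <= y := enorm_ge0 _.
apply: (@le_trans _ _ (2^-1 ^+ 2 * (x + y) ^+ 2)).
  by rewrite ler_wpM2l ?sqr_ge0// lerXn2r ?nnegrE ?addr_ge0.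
rewrite -subr_ge0 (_ : _ - _ = 2^-1 ^+ 2 * (x - y) ^+ 2); last by field.
by rewrite mulr_ge0 ?sqr_ge0.
Qed.

(** Young's inequality with weight th h. The flux term keeps the measure of the part in Omega_h, as
    [face_gradient] requires, and the jump term is enlarged to the whole face, where the penalty
    acts. *)
Lemma face_int_flux e (th : R) : is_face e -> 0 < th ->
  face_int e (face e `&` Omega_h M rhoh) (fun x => avg_flux v e * jump v e x) <=
  th / 4 * (h * vol (face_omega e) * (enorm (grad (v e.1)) ^+ 2 + enorm (grad (v e.2)) ^+ 2)) +
  (2 * th)^-1 * (h^-1 * face_jump_sq e).
Proof.
move=> fe th0; rewrite face_intE -/(face_omega e).
have bo : bounded_measurable (face_omega e) :=
  bounded_measurable_face_omega d_gt0 bary conf r_gt0 ball_elt elt_diam wrE fe.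
have rj := regular_jump e; have rq := regular_jump_sq e.
set A := avg_flux v e; pose c := th * h; have c0 : 0 < c by rewrite mulr_gt0.
have rc1 : regular (fun _ : 'rV[R]_d.-1 => c / 2 * A ^+ 2) by exact: regular_cst.
have rc2 : regular (fun s => (2 * c)^-1 * (jump v e (face_pt e s) * jump v e (face_pt e s))).
  by apply: regularM => //; exact: regular_cst.
have rA : regular (fun s => A * jump v e (face_pt e s)).
  by apply: regularM => //; exact: regular_cst.
apply: (@le_trans _ _ (vol_int (face_omega e) (fun s => c / 2 * A ^+ 2 +
    (2 * c)^-1 * (jump v e (face_pt e s) * jump v e (face_pt e s))))).
  apply: le_vol_int => //; first exact: regularD.
  move=> s _; move: (jump v e _) => J; rewrite -subr_ge0.
  rewrite (_ : _ - _ = (2 * c)^-1 * (c * A - J) ^+ 2); last by field; rewrite gt_eqF.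
  by rewrite mulr_ge0 ?sqr_ge0// invr_ge0 mulr_ge0// ltW.
rewrite (vol_intD bo rc1 rc2) (vol_int_cst _ bo) (vol_intZ _ bo rq); apply: lerD.
  rewrite (_ : c / 2 * A ^+ 2 * _ = th / 2 * (h * vol (face_omega e) * A ^+ 2)); last first.
    by rewrite /c; ring.
  have hv : 0 <= h * vol (face_omega e) by rewrite mulr_ge0 ?vol_ge0 ?(ltW h_gt0).
  have := ler_wpM2l hv (avg_flux_sq fe); rewrite -/A => H.
  apply: le_trans (ler_wpM2l _ H) _; first by rewrite divr_ge0// ltW.
  by rewrite le_eqVlt; apply/orP; left; apply/eqP; field.
rewrite (_ : (2 * th)^-1 * (h^-1 * face_jump_sq e) = (2 * c)^-1 * face_jump_sq e); last first.
  by rewrite /c; field; rewrite !gt_eqF.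
apply: ler_wpM2l; first by rewrite invr_ge0 mulr_ge0// ltW.
rewrite /face_jump_sq face_intE.
apply: vol_intS => //; first exact: face_bm.
- by move=> s [].
- by move=> s; rewrite -expr2 sqr_ge0.
Qed.

Definition flux_const (mu tau : R) : R :=
  2 * N%:R ^+ 2 * (2 * good_const d B + path_const * jump_const * (mu^-1 + tau^-1)).

Let jump_const_ge0 : 0 <= jump_const.
Proof.
have Bp : 0 <= B by exact: le_trans ler01 B_ge1.
by rewrite addr_ge0 ?divr_ge0 ?mulr_ge0 ?exprn_ge0 ?divr_ge0 ?mulr_ge0 ?exprn_ge0.
Qed.

Lemma flux_const_ge0 (mu tau : R) : 0 < mu -> 0 < tau -> 0 <= flux_const mu tau.
Proof.
move=> mu0 tau0; rewrite mulr_ge0 ?mulr_ge0 ?exprn_ge0// addr_ge0 ?mulr_ge0//.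
by rewrite addr_ge0 ?invr_ge0 ?ltW.
Qed.

Lemma j_formE (mu tau : R) : j_form rhoh h mu tau v v =
  mu * (h^-1 * \sum_(e | in_FOmega_g rhoh e) face_jump_sq e) +
  tau * (h * \sum_(e | in_FOmega_g rhoh e) flux_jump_sq e).
Proof. by rewrite /j_form !mulrA. Qed.

Lemma j_form_ge0 (mu tau : R) : 0 < mu -> 0 < tau -> 0 <= j_form rhoh h mu tau v v.
Proof.
move=> mu0 tau0; rewrite j_formE addr_ge0// mulr_ge0 ?(ltW mu0) ?(ltW tau0)//.
  by rewrite mulr_ge0 ?invr_ge0 ?(ltW h_gt0)// sumr_ge0// => e _; exact: face_jump_sq_ge0.
by rewrite mulr_ge0 ?(ltW h_gt0)// sumr_ge0// => e _; exact: flux_jump_sq_ge0.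
Qed.

Lemma sum_face_gradient_le (mu tau : R) : 0 < mu -> 0 < tau ->
  \sum_(e | in_FOmega rhoh e) h * vol (face_omega e) *
    (enorm (grad (v e.1)) ^+ 2 + enorm (grad (v e.2)) ^+ 2) <=
  flux_const mu tau * (grad_energy + j_form rhoh h mu tau v v).
Proof.
move=> mu0 tau0; apply: le_trans sum_face_gradient _.
rewrite /flux_const -[leRHS]mulrA ler_wpM2l ?mulr_ge0 ?exprn_ge0//.
have jp := j_form_ge0 mu0 tau0; set jj := j_form _ _ _ _ _ _ in jp *.
set P := h^-1 * \sum_(e | in_FOmega_g rhoh e) face_jump_sq e.
set Q := h * \sum_(e | in_FOmega_g rhoh e) flux_jump_sq e.
have P0 : 0 <= P.
  by rewrite mulr_ge0 ?invr_ge0 ?(ltW h_gt0)// sumr_ge0// => e _; exact: face_jump_sq_ge0.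
have Q0 : 0 <= Q.
  by rewrite mulr_ge0 ?(ltW h_gt0)// sumr_ge0// => e _; exact: flux_jump_sq_ge0.
have jE : jj = mu * P + tau * Q by exact: j_formE.
have Pj : P <= mu^-1 * jj.
  by rewrite -(ler_pM2l mu0) (mulrA mu mu^-1) mulfV ?gt_eqF// mul1r jE lerDl mulr_ge0// ltW.
have Qj : Q <= tau^-1 * jj.
  by rewrite -(ler_pM2l tau0) (mulrA tau tau^-1) mulfV ?gt_eqF// mul1r jE lerDr mulr_ge0// ltW.
have GJ : grad_jump_energy <= jump_const * ((mu^-1 + tau^-1) * jj).
  apply: (@le_trans _ _ (jump_const * (P + Q))); last first.
    by rewrite ler_wpM2l// mulrDl lerD.
  rewrite /P /Q !mulr_sumr -big_split mulr_sumr /=; apply: ler_sum => e /andP[/and3P[fe _ _] _].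
  exact: grad_jump_bound.
have gc := grad_energy_ge0; have it : 0 <= mu^-1 + tau^-1 by rewrite addr_ge0 ?invr_ge0 ?ltW.
rewrite [leRHS]mulrDl; apply: lerD.
  by rewrite ler_wpM2l ?mulr_ge0// lerDl.
apply: le_trans (ler_wpM2l path_const_ge0 GJ) _.
by rewrite !mulrA ler_wpM2l ?mulr_ge0// lerDr.
Qed.

Lemma A_form_coercive (mu tau gamma : R) : 0 < mu -> 0 < tau ->
  flux_const mu tau + 2 <= gamma ->
  energy_norm_sq rhoh h mu tau v <= 2 * A_form rhoh h gamma mu tau v v.
Proof.
have ar (a1 a2 a3 g vv J j X : R) : X <= a1 + (a2 / 2 + J / 2) -> a1 <= (g + j) / 4 ->
    a2 + 2 * J <= a3 -> 0 <= vv -> 0 <= J -> 0 <= j -> 0 <= g ->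
    g + vv + J + j <= 2 * (g + vv + a3 - X - X + j) by lra.
move=> mu0 tau0 hg; set K := flux_const mu tau in hg.
have K0 : 0 <= K := flux_const_ge0 mu0 tau0.
rewrite /energy_norm_sq /A_form /a_form.
set VV := \sum_(i | in_TOmega rhoh i) vol_int (elt i `&` Omega_h M rhoh) (fun x => v i x ^+ 2).
set jj := j_form _ _ _ _ _ _.
pose J := \sum_(e | in_FOmega rhoh e) h^-1 * face_jump_sq e.
pose X := \sum_(e | in_FOmega rhoh e)
  face_int e (face e `&` Omega_h M rhoh) (fun x => avg_flux v e * jump v e x).
have GE1 : \sum_(i | in_TOmega rhoh i)
    vol_int (elt i `&` Omega_h M rhoh) (fun=> enorm (grad (v i)) ^+ 2) = grad_energy.
  apply: eq_bigr => i _; rewrite mulrC.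
  exact: (vol_int_cst _ (bounded_measurable_omega bary wrE i)).
have GE2 : \sum_(i | in_TOmega rhoh i)
    vol_int (elt i `&` Omega_h M rhoh) (fun=> dot (grad (v i)) (grad (v i))) = grad_energy.
  by rewrite -GE1; apply: eq_bigr => i _; rewrite -enorm_sq.
have VE : \sum_(i | in_TOmega rhoh i)
    vol_int (elt i `&` Omega_h M rhoh) (fun x => v i x * v i x) = VV.
  by apply: eq_bigr => i _; congr vol_int; apply/funext => x; rewrite expr2.
have JE1 : \sum_(e | in_FOmega rhoh e)
    face_int e (face e) (fun x => (h^-1 * jump v e x) * jump v e x) = J.
  by apply: eq_bigr => e /and3P[fe _ _]; exact: face_int_penalty.
have JE2 : \sum_(e | in_FOmega rhoh e)
    face_int e (face e) (fun x => ((Num.sqrt h)^-1 * jump v e x) ^+ 2) = J.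
  by apply: eq_bigr => e /and3P[fe _ _]; exact: face_int_norm.
have XE : \sum_(e | in_FOmega rhoh e)
    face_int e (face e `&` Omega_h M rhoh) (fun x => jump v e x * avg_flux v e) = X.
  apply: eq_bigr => e _; rewrite !face_intE; congr vol_int.
  by apply/funext => s; rewrite mulrC.
rewrite GE1 GE2 ?VE JE1 JE2 XE -/X.
have VV0 : 0 <= VV.
  by apply: sumr_ge0 => i _; apply: vol_int_ge0 => x _; exact: sqr_ge0.
have J0 : 0 <= J.
  by apply: sumr_ge0 => e _; rewrite mulr_ge0 ?face_jump_sq_ge0// invr_ge0 ltW.
have j0 : 0 <= jj := j_form_ge0 mu0 tau0.
have G0 := grad_energy_ge0.
(* With this weight the two flux terms together absorb at most half of the gradient energy and of j,
   and cost (K + 1) J. Since gamma >= K + 2, at least one J remains. *)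
pose th := (K + 1)^-1; have K1 : 0 < K + 1 by rewrite ltr_pwDr.
have th0 : 0 < th by rewrite invr_gt0.
have XB : X <= th / 4 * (K * (grad_energy + jj)) + (2 * th)^-1 * J.
  have S := sum_face_gradient_le mu0 tau0.
  apply: (@le_trans _ _ (th / 4 * (\sum_(e | in_FOmega rhoh e) h * vol (face_omega e) *
    (enorm (grad (v e.1)) ^+ 2 + enorm (grad (v e.2)) ^+ 2)) + (2 * th)^-1 * J)).
    rewrite /J !mulr_sumr -big_split /=; apply: ler_sum => e /and3P[fe _ _].
    exact: face_int_flux.
  by rewrite lerD2r ler_wpM2l// divr_ge0// ltW.
have thK : th / 4 * (K * (grad_energy + jj)) <= (grad_energy + jj) / 4.
  have tK : th * K <= 1 by rewrite /th mulrC ler_pdivrMr// mul1r lerDl.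
  move: (grad_energy + jj) (addr_ge0 G0 j0) => E E0.
  have -> : th / 4 * (K * E) = th * K * (E / 4) by rewrite mulrACA [4^-1 * _]mulrC.
  by rewrite ler_piMl// divr_ge0.
have thJ : (2 * th)^-1 * J = (K + 1) / 2 * J by rewrite /th invfM invrK [2^-1 * _]mulrC.
have gJ : (K + 2) * J <= gamma * J by rewrite ler_wpM2r.
move: XB thK gJ; rewrite thJ.
have -> : (K + 1) / 2 * J = K * J / 2 + J / 2 by field.
have -> : (K + 2) * J = K * J + 2 * J by ring.
by move=> XB thK gJ; exact: ar XB thK gJ VV0 J0 j0 G0.
Qed.

End Energy.

(** * Choice of the constants *)

Theorem proposition2 (R : realType) (d : nat) (hd : (0 < d)%N)
    (Om : set 'rV[R]_d) (hOm : smooth_bounded_domain Om)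
    (delta0 : R) (hdelta0 : tubular Om delta0)
    (sigma kappa crho cn : R) (hsigma : 0 < sigma) (hkappa : 0 < kappa)
    (hcrho : 0 < crho) (hcn : 0 < cn) :
  exists2 h0 : R, 0 < h0 &
  forall mu tau : R, 0 < mu -> 0 < tau ->
  exists2 gamma0 : R, 0 < gamma0 &
  forall gamma : R, gamma0 <= gamma ->
  exists2 C : R, 0 < C &
  forall (M : mesh R d) (rhoh : 'rV[R]_d -> R) (h : R),
    conforming_mesh M -> shape_regular M sigma -> quasi_uniform M kappa ->
    h = mesh_size M -> 0 < h -> h <= h0 ->
    Om `<=` region M ->
    is_piecewise_linear M rhoh ->
    geometry_assumptions M rhoh h Om delta0 crho cn ->
  forall v : DG M,
    energy_norm_sq rhoh h mu tau v <= C * A_form rhoh h gamma mu tau v v.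
Proof.
have [nOm [Lam [dLam [Lam0 dLam0 lipOm]]]] := uniform_normal hOm.
have d1 : 1 <= d%:R :> R by rewrite ler1n.
(* Bound for the ratio of h to the common inscribed radius r below; the maximum with 1 allows B >= 1
   in the estimates. *)
pose B : R := Num.max 1 (kappa * sigma).
have B1 : 1 <= B by rewrite le_max lexx.
have B0 : 0 < B := lt_le_trans ltr01 B1.
have dB0 : 0 < 8 * d%:R * B by rewrite !mulr_gt0// (lt_le_trans ltr01).
(* Tolerance for the normals: it gives eps h <= r/8 in the star and a slope of n along some axis
   well above eps. *)
pose eps : R := (8 * d%:R * B)^-1.
have eps0 : 0 < eps by rewrite invr_gt0.
have eps_B : eps * (8 * d%:R * B) <= 1 by rewrite /eps mulVf ?gt_eqF.
have eps_half : eps <= 2^-1.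
  rewrite lef_pV2 ?posrE// -mulrA; have := mulr_ege1 d1 B1.
  by move: (d%:R * B) => X; lra.
pose C1 := crho * Lam * 2; pose C2 := (2 + 2 * crho) / dLam.
pose C3 := (2 * cn + Lam * (2 + 2 * crho)) / eps.
have C10 : 0 < C1 by rewrite !mulr_gt0.
have C20 : 0 < C2 by rewrite divr_gt0// addr_gt0// mulr_gt0.
have C30 : 0 < C3 by rewrite divr_gt0// addr_gt0 ?mulr_gt0// addr_gt0// mulr_gt0.
(* The summand 2 ensures h <= 1 and thus h^2 <= h; then C1, C2 and C3 give [small1], [small2] and
   [small3] in turn. *)
pose h0 := (2 + C1 + C2 + C3)^-1.
have D0 : 0 < 2 + C1 + C2 + C3 by rewrite !addr_gt0.
exists h0; first by rewrite invr_gt0.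
move=> mu tau mu0 tau0; exists (flux_const d B mu tau + 2).
  by apply: ltr_wpDl => //; exact: flux_const_ge0.
move=> gamma hgamma; exists 2 => // M rhoh h conf sr qu hE hp hh0 _ [_ pl] geo v.
have /choice[lam bary] (i : 'I_(nelt M)) : exists l, barycentric (@vtx _ _ M i) l.
  by apply: exists_barycentric; have [+ _ _] := conf.
have [ctr ctrP] := choice sr.
have [wr wrE] := choice pl.
have ks0 : 0 < kappa * sigma by rewrite mulr_gt0.
(* Quasi-uniformity turns the balls of radius diam/sigma into balls of one radius r for all
   elements. *)
pose r := h / (kappa * sigma).
have r0 : 0 < r by rewrite divr_gt0.
have hB : h <= r * B.
  by rewrite /r mulrAC ler_pdivlMr// ler_pM2l// le_max lexx orbT.
have ball_elt (i : 'I_(nelt M)) (x : 'rV[R]_d) : enorm (x - ctr i) <= r -> elt i x.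
  move=> hx; apply: ctrP; apply: le_trans hx _.
  rewrite /r invfM mulrA ler_wpM2r ?invr_ge0 ?(ltW hsigma)// ler_pdivrMr//.
  by rewrite hE mulrC; exact: qu.
have elt_diam (i : 'I_(nelt M)) (x y : 'rV[R]_d) : elt i x -> elt i y -> enorm (x - y) <= h.
  move=> /(simplexP (bary i)) ix /(simplexP (bary i)) iy.
  apply: le_trans (le_diam_simplex (bary i) ix iy) _.
  by rewrite hE /mesh_size; exact: (le_bigmax _ (fun i => diam (@elt R d M i)) i).
have Sh : (2 + C1 + C2 + C3) * h <= 1 by rewrite -ler_pdivlMl// mulr1.
have c1h : 0 < C1 * h by rewrite mulr_gt0.
have c2h : 0 < C2 * h by rewrite mulr_gt0.
have c3h : 0 < C3 * h by rewrite mulr_gt0.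
have [h1 [C1h [C2h C3h]]] : h <= 1 /\ C1 * h < 1 /\ C2 * h < 1 /\ C3 * h <= 1.
  move: Sh c1h c2h c3h; rewrite !mulrDl; clear -hp.
  by move: (C1 * h) (C2 * h) (C3 * h) => x y z *; repeat split; lra.
have hh : h ^+ 2 <= h by rewrite expr2 ler_piMl// ltW.
have crh : crho * h ^+ 2 <= crho * h by rewrite ler_pM2l.
have sm : 2 * h + 2 * (crho * h ^+ 2) <= (2 + 2 * crho) * h.
  by rewrite [leRHS]mulrDl lerD2l -[leRHS]mulrA ler_pM2l.
have small1 : crho * h ^+ 2 * Lam * 2 < 1.
  apply: le_lt_trans C1h.
  have -> : C1 * h = crho * h * Lam * 2 by rewrite /C1; ring.
  by rewrite ler_pM2r// ler_pM2r.
have small2 : 2 * h + 2 * (crho * h ^+ 2) < dLam.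
  apply: le_lt_trans sm _.
  have -> : (2 + 2 * crho) * h = C2 * h * dLam by rewrite /C2; field; rewrite gt_eqF.
  by rewrite gtr_pMl.
have small3 : 2 * (cn * h) + Lam * (2 * h + 2 * (crho * h ^+ 2)) <= eps.
  apply: (@le_trans _ _ ((2 * cn + Lam * (2 + 2 * crho)) * h)).
    by rewrite [leRHS]mulrDl -[X in _ <= X + _]mulrA lerD2l -[leRHS]mulrA ler_pM2l.
  have -> : (2 * cn + Lam * (2 + 2 * crho)) * h = C3 * h * eps.
    by rewrite /C3 mulrAC divfK// gt_eqF.
  by rewrite ler_piMl// ltW.
have rclose := rnorm_close hd bary r0 ball_elt elt_diam wrE lipOm hdelta0 geo Lam0 small2 small3.
have shared := facet_shared hd bary conf r0 ball_elt elt_diam wrE nOm lipOm hdelta0 geo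
  Lam0 dLam0 hp hcn small1 small2 small3 eps_half.
exact: (A_form_coercive hd bary conf r0 ball_elt elt_diam B1 hB hp wrE shared rclose eps_B).
Qed.
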